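(* Let $\mathbf{k}$ be an algebraically closed field and let $u,v\geq 1$ be integers. Then $${}_vT(u)=\Big(\bigoplus_{i=1}^{u+1}I_i\Big)\oplus\Big(\bigoplus_{j=1}^{u+v-1}S_{u+j}^{(j)}\Big)$$ is a tilting object in $\mathrm{D}^{b}(N(2u+v,u+v+1))$, whose endomorphism algebra is isomorphic to the one-branch extension algebra ${}_{v}A(u)$.
   Context: $N(n,r)$ is the Nakayama algebra given as the path algebra over $\mathbf{k}$ of the quiver $1\leftarrow 2\leftarrow\cdots\leftarrow n$ modulo the ideal generated by all paths of length $r$ (if $r=n$ it is the path algebra itself). Paths are composed like functions, so that left modules are representations of the quiver; thus the projective module at vertex $1$ is simple. $\mathrm{D}^b(A)$ is the bounded derived category of finitely generated left $A$-modules, with modules viewed as complexes in degree $0$. For $1\le i\le 2u+v$, $I_i$ and $S_i$ denote the indecomposable injective and the simple $N(2u+v,u+v+1)$-module at vertex $i$, and $S_i^{(j)}$ denotes the indecomposable $N(2u+v,u+v+1)$-module of length $j$ with top $S_i$. An object $T$ of $\mathrm{D}^b(A)$ is tilting if $\mathrm{Hom}(T,T[k])=0$ for all $k\neq0$ and $T$ generates $\mathrm{D}^b(A)$ as a thick triangulated subcategory. Endomorphism algebras are taken with usual composition of maps, so (with paths composed like functions) arrows of the quiver of the endomorphism algebra point in the direction of the morphisms between indecomposable summands. ${}_vA(u)$ is the algebra over $\mathbf{k}$ of the following quiver with relations: vertices $t_1,\dots,t_u$, $b_1,\dots,b_u$, $c_1,\dots,c_v$; arrows $t_i\to t_{i+1}$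 and $b_i\to b_{i+1}$ ($1\le i\le u-1$), $t_i\to b_i$ ($1\le i\le u$), $c_i\to c_{i+1}$ ($1\le i\le v-1$), and $c_v\to b_1$; relations: each square $t_i,t_{i+1},b_i,b_{i+1}$ commutes. *)

(* Defs.v *)
From HB Require Import structures.
From mathcomp Require Import all_boot all_order all_algebra.
From mathcomp Require Import finmap boolp zify.
From mathcomp.multinomials Require Import monalg.

Set Implicit Arguments.
Unset Strict Implicit.
Unset Printing Implicit Defensive.

Import GRing.Theory.
Local Open Scope ring_scope.
Local Open Scope quotient_scope.

(* A finite quiver without parallel arrows is given by a relation adj on its
   vertices: there is an arrow x -> y iff adj x y. A path is given by its start
   and the sequence of the later vertices. *)

Section PathAlgebra.
Variables (k : fieldType) (V : finType) (adj : rel V).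

Definition qpath : Type := {s : V * seq V | path adj s.1 s.2}.
HB.instance Definition _ := Choice.on qpath.

Definition qstart (p : qpath) : V := (val p).1.
Definition qend (p : qpath) : V := last (val p).1 (val p).2.
Definition qlength (p : qpath) : nat := size (val p).2.

Definition qtriv (x : V) : qpath := exist (fun s => path adj s.1 s.2) (x, [::]) isT.

Lemma qcomp_subproof (q p : qpath) :
  let s := if qend p == qstart q then (qstart p, (val p).2 ++ (val q).2)
           else val p in
  path adj s.1 s.2.
Proof.
case: eqP => [e|_]; last exact: (valP p).
by rewrite /= cat_path (valP p) -/(qend p) e (valP q).
Qed.

(* Only meaningful when p ends where q starts. *)
Definition qcomp (q p : qpath) : qpath := exist (fun s => path adj s.1 s.2) _ (qcomp_subproof q p).

Definition pathalg : Type := {malg k[qpath]}.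
HB.instance Definition _ := GRing.Lmodule.on pathalg.

(* Paths are composed like functions: q * p is "p, then q". *)
Definition path_mul (q p : qpath) : pathalg :=
  if qend p == qstart q then << qcomp q p >> else 0.

Definition pa_mul (f g : pathalg) : pathalg :=
  \sum_(q <- msupp f) \sum_(p <- msupp g) (f@_q * g@_p) *: path_mul q p.

Definition pa_one : pathalg := \sum_(x : V) << qtriv x >>.

Lemma pa_mulw (d1 d2 : {fset qpath}) (f g : pathalg) :
  (msupp f `<=` d1)%fset -> (msupp g `<=` d2)%fset ->
  pa_mul f g = \sum_(q <- d1) \sum_(p <- d2) (f@_q * g@_p) *: path_mul q p.
Proof.
move=> le1 le2; rewrite /pa_mul (big_fset_incl _ le1) /=.
  apply: eq_bigr => q _; apply/big_fset_incl => // p _ /mcoeff_outdom ->.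
  by rewrite mulr0 scale0r.
move=> q _ /mcoeff_outdom e; rewrite big1 // => p _.
by rewrite e mul0r scale0r.
Qed.

Lemma pa_mulDl : left_distributive pa_mul +%R.
Proof.
move=> f1 f2 g; pose d := (msupp f1 `|` msupp f2)%fset.
rewrite (@pa_mulw d (msupp g) (f1 + f2)) ?msuppD_le //.
rewrite (@pa_mulw d (msupp g) f1) ?fsubsetUl //.
rewrite (@pa_mulw d (msupp g) f2) ?fsubsetUr //.
rewrite -big_split; apply: eq_bigr => q _; rewrite -big_split.
by apply: eq_bigr => p _; rewrite mcoeffD mulrDl scalerDl.
Qed.

Lemma pa_mulDr : right_distributive pa_mul +%R.
Proof.
move=> f g1 g2; pose d := (msupp g1 `|` msupp g2)%fset.
rewrite (@pa_mulw (msupp f) d f (g1 + g2)) ?msuppD_le //.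
rewrite (@pa_mulw (msupp f) d f g1) ?fsubsetUl //.
rewrite (@pa_mulw (msupp f) d f g2) ?fsubsetUr //.
rewrite -big_split; apply: eq_bigr => q _; rewrite -big_split.
by apply: eq_bigr => p _; rewrite mcoeffD mulrDr scalerDl.
Qed.

Lemma pa_mul0l f : pa_mul 0 f = 0.
Proof. by rewrite /pa_mul msupp0 big_seq_fset0. Qed.

Lemma pa_mul0r f : pa_mul f 0 = 0.
Proof. by rewrite /pa_mul big1 // => q _; rewrite msupp0 big_seq_fset0. Qed.

Lemma pa_mulZl c f g : pa_mul (c *: f) g = c *: pa_mul f g.
Proof.
rewrite (pa_mulw (msuppZ_le _ _) (fsubset_refl _)) scaler_sumr.
apply: eq_bigr => q _; rewrite scaler_sumr; apply: eq_bigr => p _.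
by rewrite mcoeffZ scalerA mulrA.
Qed.

Lemma pa_mulZr c f g : pa_mul f (c *: g) = c *: pa_mul f g.
Proof.
rewrite (pa_mulw (fsubset_refl _) (msuppZ_le _ _)) scaler_sumr.
apply: eq_bigr => q _; rewrite scaler_sumr; apply: eq_bigr => p _.
by rewrite mcoeffZ scalerA mulrCA.
Qed.

Lemma pa_mulUU (q p : qpath) : pa_mul << q >> << p >> = path_mul q p.
Proof.
rewrite (pa_mulw msuppU_le msuppU_le) !big_seq_fset1.
by rewrite !mcoeffUU mulr1 scale1r.
Qed.

Lemma pathalgE (f : pathalg) : f = \sum_(p <- msupp f) f@_p *: << p >>.
Proof.
rewrite [LHS]monalgE; apply: eq_bigr => p _; apply/malgP => q.
by rewrite mcoeffZ !mcoeffU mulrnAr mulr1.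
Qed.

Lemma pathalg_ind (P : pathalg -> Prop) :
  P 0 -> (forall f g, P f -> P g -> P (f + g)) ->
  (forall c f, P f -> P (c *: f)) -> (forall p, P << p >>) -> forall f, P f.
Proof.
move=> P0 PD PZ PU f; rewrite [f]pathalgE; elim/big_rec: _ => // p g _ Pg.
by apply: PD => //; apply: PZ.
Qed.

Lemma val_qcomp (q p : qpath) : qend p = qstart q ->
  val (qcomp q p) = (qstart p, (val p).2 ++ (val q).2).
Proof. by move=> e; rewrite /= e eqxx. Qed.

Lemma qend_comp q p : qend p = qstart q -> qend (qcomp q p) = qend q.
Proof. by move=> e; rewrite /qend val_qcomp //= last_cat -/(qend p) e. Qed.

Lemma qstart_comp q p : qstart (qcomp q p) = qstart p.
Proof. by rewrite /qstart /qcomp /=; case: ifP. Qed.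

Lemma path_mulA q1 q2 q3 :
  pa_mul << q1 >> (path_mul q2 q3) = pa_mul (path_mul q1 q2) << q3 >>.
Proof.
rewrite /path_mul; case: (eqVneq (qend q3)) => [e|ne].
  rewrite pa_mulUU /path_mul qend_comp //.
  case: (eqVneq (qend q2)) => [e'|]; last by rewrite pa_mul0l.
  rewrite pa_mulUU /path_mul qstart_comp e eqxx; congr << _ >>.
  apply: val_inj; rewrite !val_qcomp ?qend_comp ?qstart_comp //=.
  by rewrite catA.
rewrite pa_mul0r; case: eqP => _; last by rewrite pa_mul0l.
by rewrite pa_mulUU /path_mul qstart_comp (negPf ne).
Qed.

Lemma pa_mulA : associative pa_mul.
Proof.
move=> f g h; elim/pathalg_ind: f => [|f f' Hf Hf'|c f Hf|q1].
- by rewrite !pa_mul0l.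
- by rewrite !pa_mulDl Hf Hf'.
- by rewrite !pa_mulZl Hf.
elim/pathalg_ind: g => [|f f' Hf Hf'|c f Hf|q2].
- by rewrite !(pa_mul0l, pa_mul0r).
- by rewrite !(pa_mulDl, pa_mulDr) Hf Hf'.
- by rewrite !(pa_mulZl, pa_mulZr) Hf.
elim/pathalg_ind: h => [|f f' Hf Hf'|c f Hf|q3].
- by rewrite !pa_mul0r.
- by rewrite !pa_mulDr Hf Hf'.
- by rewrite !pa_mulZr Hf.
by rewrite !pa_mulUU path_mulA.
Qed.

Lemma pa_mul_suml (I : Type) (s : seq I) (F : I -> pathalg) g :
  pa_mul (\sum_(i <- s) F i) g = \sum_(i <- s) pa_mul (F i) g.
Proof. by apply: (big_morph (pa_mul^~ g)); [move=> ? ?; exact: pa_mulDl|exact: pa_mul0l]. Qed.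

Lemma pa_mul_sumr (I : Type) (s : seq I) (F : I -> pathalg) g :
  pa_mul g (\sum_(i <- s) F i) = \sum_(i <- s) pa_mul g (F i).
Proof. by apply: (big_morph (pa_mul g)); [move=> ? ?; exact: pa_mulDr|exact: pa_mul0r]. Qed.

Lemma pa_mul1l : left_id pa_one pa_mul.
Proof.
elim/pathalg_ind => [|f g Hf Hg|c f Hf|p].
- by rewrite pa_mul0r.
- by rewrite pa_mulDr Hf Hg.
- by rewrite pa_mulZr Hf.
rewrite pa_mul_suml (bigD1 (qend p)) //= big1 => [|x ne].
  rewrite addr0 pa_mulUU /path_mul eqxx; congr << _ >>.
  by apply: val_inj; rewrite val_qcomp //= cats0; case: (p) => -[].
by rewrite pa_mulUU /path_mul eq_sym (negPf ne).
Qed.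

Lemma pa_mul1r : right_id pa_one pa_mul.
Proof.
elim/pathalg_ind => [|f g Hf Hg|c f Hf|p].
- by rewrite pa_mul0l.
- by rewrite pa_mulDl Hf Hg.
- by rewrite pa_mulZl Hf.
rewrite pa_mul_sumr (bigD1 (qstart p)) //= big1 => [|x ne].
  rewrite addr0 pa_mulUU /path_mul eqxx; congr << _ >>.
  by apply: val_inj; rewrite val_qcomp //=; case: (p) => -[].
by rewrite pa_mulUU /path_mul (negPf ne).
Qed.

HB.instance Definition _ := GRing.Zmodule_isPzRing.Build pathalg
  pa_mulA pa_mul1l pa_mul1r pa_mulDl pa_mulDr.

End PathAlgebra.

Section BoundQuiverAlgebra.
Variables (k : fieldType) (V : finType) (adj : rel V).
Local Notation kQ := (pathalg k adj).

Definition two_sided_ideal (J : kQ -> Prop) : Prop :=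
  [/\ J 0, forall f g, J f -> J g -> J (f - g) &
      forall f g, J g -> J (f * g) /\ J (g * f)].

Variable rels : kQ -> Prop.

Definition ideal_gen : {pred kQ} := fun f =>
  `[< forall J, two_sided_ideal J -> (forall g, rels g -> J g) -> J f >].

Lemma ideal_genP f : reflect
  (forall J, two_sided_ideal J -> (forall g, rels g -> J g) -> J f)
  (f \in ideal_gen).
Proof. exact: asboolP. Qed.

Lemma ideal_gen_closed : zmod_closed ideal_gen.
Proof.
split=> [|f g /ideal_genP Jf /ideal_genP Jg].
  by apply/ideal_genP => J [].
apply/ideal_genP => J HJ HG; have [_ JB _] := HJ.
by apply: JB; [apply: Jf|apply: Jg].
Qed.

HB.instance Definition _ := GRing.isZmodClosed.Build kQ ideal_gen ideal_gen_closed.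

Lemma ideal_genMl f g : g \in ideal_gen -> f * g \in ideal_gen.
Proof.
move=> /ideal_genP Jg; apply/ideal_genP => J HJ HG.
by have [_ _ /(_ f g (Jg J HJ HG)) []] := HJ.
Qed.

Lemma ideal_genMr f g : g \in ideal_gen -> g * f \in ideal_gen.
Proof.
move=> /ideal_genP Jg; apply/ideal_genP => J HJ HG.
by have [_ _ /(_ f g (Jg J HJ HG)) []] := HJ.
Qed.

Lemma pathalg_scalerAl (c : k) (f g : kQ) : c *: (f * g) = (c *: f) * g.
Proof. exact/esym/pa_mulZl. Qed.

Lemma pathalg_scalerAr (c : k) (f g : kQ) : c *: (f * g) = f * (c *: g).
Proof. exact/esym/pa_mulZr. Qed.

Lemma ideal_genZ (c : k) f : f \in ideal_gen -> c *: f \in ideal_gen.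
Proof. by rewrite -[f in c *: f]mul1r pathalg_scalerAl; apply: ideal_genMl. Qed.

(* The bound quiver algebra: the path algebra modulo the ideal generated by rels. *)
Definition bqa : Type := {ideal_quot ideal_gen}.
HB.instance Definition _ := GRing.Zmodule.on bqa.
HB.instance Definition _ := EqQuotient.on bqa.

Definition bqa_pi (f : kQ) : bqa := \pi_({ideal_quot ideal_gen}) f.

Lemma bqa_piP f g : reflect (bqa_pi f = bqa_pi g) (f - g \in ideal_gen).
Proof. by rewrite Quotient.idealrBE; apply: eqP. Qed.

Lemma bqa_repr (a : bqa) : bqa_pi (repr a) = a.
Proof. exact: (@reprK _ {ideal_quot ideal_gen}). Qed.

Lemma bqa_piB : zmod_morphism bqa_pi.
Proof. by move=> f g; exact: (@raddfB _ _ (\pi_({ideal_quot ideal_gen}))). Qed.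
HB.instance Definition _ := GRing.isZmodMorphism.Build kQ bqa bqa_pi bqa_piB.

Definition bqa_mul (a b : bqa) : bqa := bqa_pi (repr a * repr b).
Definition bqa_scale (c : k) (a : bqa) : bqa := bqa_pi (c *: repr a).

Lemma bqa_piM f g : bqa_mul (bqa_pi f) (bqa_pi g) = bqa_pi (f * g).
Proof.
have If : repr (bqa_pi f) - f \in ideal_gen by apply/bqa_piP; rewrite bqa_repr.
have Ig : repr (bqa_pi g) - g \in ideal_gen by apply/bqa_piP; rewrite bqa_repr.
rewrite /bqa_mul; move: (repr (bqa_pi f)) (repr (bqa_pi g)) If Ig => f' g' If Ig.
apply/bqa_piP.
have -> : f' * g' - f * g = (f' - f) * g' + f * (g' - g).
  by rewrite mulrBl mulrBr addrA subrK.
by apply: rpredD; [apply: ideal_genMr|apply: ideal_genMl].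
Qed.

Lemma bqa_piZ c f : bqa_scale c (bqa_pi f) = bqa_pi (c *: f).
Proof.
apply/bqa_piP; rewrite -scalerBr; apply: ideal_genZ.
by apply/bqa_piP; rewrite bqa_repr.
Qed.

Let bqaW := (fun a => esym (bqa_repr a)).

Lemma bqa_mulA : associative bqa_mul.
Proof. by move=> a b c; rewrite [a]bqaW [b]bqaW [c]bqaW !bqa_piM mulrA. Qed.
Lemma bqa_mul1l : left_id (bqa_pi 1) bqa_mul.
Proof. by move=> a; rewrite [a]bqaW bqa_piM mul1r. Qed.
Lemma bqa_mul1r : right_id (bqa_pi 1) bqa_mul.
Proof. by move=> a; rewrite [a]bqaW bqa_piM mulr1. Qed.
Lemma bqa_mulDl : left_distributive bqa_mul +%R.
Proof.
by move=> a b c; rewrite [a]bqaW [b]bqaW [c]bqaW -raddfD !bqa_piM mulrDl raddfD.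
Qed.
Lemma bqa_mulDr : right_distributive bqa_mul +%R.
Proof.
by move=> a b c; rewrite [a]bqaW [b]bqaW [c]bqaW -raddfD !bqa_piM mulrDr raddfD.
Qed.
HB.instance Definition _ := GRing.Zmodule_isPzRing.Build bqa
  bqa_mulA bqa_mul1l bqa_mul1r bqa_mulDl bqa_mulDr.

Lemma bqa_scaleA c d a : bqa_scale c (bqa_scale d a) = bqa_scale (c * d) a.
Proof. by rewrite [a]bqaW !bqa_piZ scalerA. Qed.
Lemma bqa_scale1 : left_id 1 bqa_scale.
Proof. by move=> a; rewrite [a]bqaW bqa_piZ scale1r. Qed.
Lemma bqa_scaleDr : right_distributive bqa_scale +%R.
Proof.
by move=> c a b; rewrite [a]bqaW [b]bqaW -raddfD !bqa_piZ scalerDr raddfD.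
Qed.
Lemma bqa_scaleDl a : {morph bqa_scale^~ a : c d / c + d}.
Proof. by move=> c d; rewrite [a]bqaW !bqa_piZ scalerDl raddfD. Qed.
HB.instance Definition _ := GRing.Zmodule_isLmodule.Build k bqa
  bqa_scaleA bqa_scale1 bqa_scaleDr bqa_scaleDl.

Lemma bqa_scalerAl (c : k) (a b : bqa) : c *: (a * b) = (c *: a) * b.
Proof.
rewrite [a]bqaW [b]bqaW.
rewrite -[c *: bqa_pi _]/(bqa_scale _ _) -![_ * _ : bqa]/(bqa_mul _ _).
rewrite -[c *: bqa_mul _ _]/(bqa_scale _ _).
by rewrite !(bqa_piM, bqa_piZ) pathalg_scalerAl.
Qed.

Lemma bqa_scalerAr (c : k) (a b : bqa) : c *: (a * b) = a * (c *: b).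
Proof.
rewrite [a]bqaW [b]bqaW.
rewrite -[c *: bqa_pi _]/(bqa_scale _ _) -![_ * _ : bqa]/(bqa_mul _ _).
rewrite -[c *: bqa_mul _ _]/(bqa_scale _ _).
by rewrite !(bqa_piM, bqa_piZ) pathalg_scalerAr.
Qed.

Definition vertex_idem (x : V) : bqa := bqa_pi << qtriv adj x >>.

End BoundQuiverAlgebra.

Section Modules.
Variable A : pzRingType.

Definition finitely_generated (M : lmodType A) : Prop :=
  exists (J : finType) (g : J -> M),
    forall x, exists a : J -> A, x = \sum_j a j *: g j.

Record fgModule := FgModule {
  fg_sort :> lmodType A;
  fgP : finitely_generated fg_sort
}.

Definition trivial_module (M : lmodType A) : Prop := forall x : M, x = 0.

Lemma zero_fg : finitely_generated 'rV[A]_0.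
Proof.
exists 'I_0, (fun _ => 0) => x; exists (fun _ => 0).
by rewrite [x]thinmx0 [RHS]thinmx0.
Qed.
Definition fg_zero : fgModule := FgModule zero_fg.

Lemma pair_fg (M N : fgModule) : finitely_generated (M * N)%type.
Proof.
have [[I [g gP]] [J [h hP]]] := (fgP M, fgP N).
exists (I + J)%type, (fun s => match s with inl i => (g i, 0) | inr j => (0, h j) end).
move=> [x y]; have [[a ->] [b ->]] := (gP x, hP y).
exists (fun s => match s with inl i => a i | inr j => b j end).
rewrite big_sumType /=; apply: injective_projections.
  rewrite (raddfD (@fst M N)) !(raddf_sum (@fst M N)) /=.
  by rewrite [X in _ + X]big1 ?addr0 // => j _; exact: scaler0.
rewrite (raddfD (@snd M N)) !(raddf_sum (@snd M N)) /=.
by rewrite [X in X + _]big1 ?add0r // => j _; exact: scaler0.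
Qed.
Definition fg_pair (M N : fgModule) : fgModule := FgModule (pair_fg M N).

Section Transport.
Variables (I : eqType) (M : I -> fgModule).

(* The identity when i = j, and 0 otherwise. *)
Definition transport i j (x : M i) : M j :=
  if i =P j is ReflectT e then ecast l (M l) e x else 0.

Lemma transport_id i (x : M i) : transport i x = x.
Proof. by rewrite /transport; case: eqP => // e; rewrite (eq_axiomK e). Qed.

Lemma transport_neq i j (x : M i) : i != j -> transport j x = 0.
Proof. by rewrite /transport; case: eqP => // ->; rewrite eqxx. Qed.

Lemma transport_linear i j : linear (@transport i j).
Proof.
move=> a u v; have [<-|ne] := eqVneq i j; first by rewrite !transport_id.
by rewrite !transport_neq // scaler0 addr0.
Qed.

Lemma transport0 i j : transport j (0 : M i) = 0.
Proof.
by have [<-|ne] := eqVneq i j; rewrite ?transport_id ?transport_neq.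
Qed.
End Transport.

Section DirectSum.
Variables (I : finType) (M : I -> fgModule).

Definition dsum : Type := {dffun forall i, M i}.
HB.instance Definition _ := Choice.on dsum.

Definition dsum_zero : dsum := finfun (fun i => 0 : M i).
Definition dsum_opp (f : dsum) : dsum := finfun (fun i => - f i).
Definition dsum_add (f g : dsum) : dsum := finfun (fun i => f i + g i).
Definition dsum_scale (a : A) (f : dsum) : dsum := finfun (fun i => a *: f i).

Lemma dsum_addA : associative dsum_add.
Proof. by move=> f g h; apply/ffunP => i; rewrite !ffunE addrA. Qed.
Lemma dsum_addC : commutative dsum_add.
Proof. by move=> f g; apply/ffunP => i; rewrite !ffunE addrC. Qed.
Lemma dsum_add0 : left_id dsum_zero dsum_add.
Proof. by move=> f; apply/ffunP => i; rewrite !ffunE add0r. Qed.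
Lemma dsum_addN : left_inverse dsum_zero dsum_opp dsum_add.
Proof. by move=> f; apply/ffunP => i; rewrite !ffunE addNr. Qed.
HB.instance Definition _ := GRing.isZmodule.Build dsum
  dsum_addA dsum_addC dsum_add0 dsum_addN.

Lemma dsum_scaleA a b f : dsum_scale a (dsum_scale b f) = dsum_scale (a * b) f.
Proof. by apply/ffunP => i; rewrite !ffunE scalerA. Qed.
Lemma dsum_scale1 : left_id 1 dsum_scale.
Proof. by move=> f; apply/ffunP => i; rewrite !ffunE scale1r. Qed.
Lemma dsum_scaleDr : right_distributive dsum_scale +%R.
Proof. by move=> a f g; apply/ffunP => i; rewrite !ffunE scalerDr. Qed.
Lemma dsum_scaleDl f : {morph dsum_scale^~ f : a b / a + b}.
Proof. by move=> a b; apply/ffunP => i; rewrite !ffunE scalerDl. Qed.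
HB.instance Definition _ := GRing.Zmodule_isLmodule.Build A dsum
  dsum_scaleA dsum_scale1 dsum_scaleDr dsum_scaleDl.

Lemma dsum_sumE (J : finType) (F : J -> dsum) i : (\sum_j F j) i = \sum_j F j i.
Proof.
by apply: (big_morph (fun f : dsum => f i)) => [f g|]; rewrite ffunE.
Qed.

Definition dsum_inj i (x : M i) : dsum := finfun (fun j => transport j x).

Lemma dsum_injE i (x : M i) : dsum_inj x i = x.
Proof. by rewrite ffunE transport_id. Qed.

Lemma dsum_inj_neq i j (x : M i) : i != j -> dsum_inj x j = 0.
Proof. by move=> ne; rewrite ffunE transport_neq. Qed.

Lemma dsum_fg : finitely_generated dsum.
Proof.
pose J i : finType := projT1 (cid (fgP (M i))).
have gJ i : {g : J i -> M i | forall x, exists a, x = \sum_j a j *: g j}.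
  by apply: cid; exact: (projT2 (cid (fgP (M i)))).
exists {i : I & J i}, (fun s => dsum_inj (sval (gJ (tag s)) (tagged s))) => f.
have aJ i : {a : J i -> A | f i = \sum_j a j *: sval (gJ i) j}.
  by apply: cid; exact: (svalP (gJ i)).
exists (fun s => sval (aJ (tag s)) (tagged s)); apply/ffunP => i.
rewrite -(sig_big_dep (fun=> true) (fun _ _ => true)
  (fun i j => sval (aJ i) j *: dsum_inj (sval (gJ i) j))) /=.
rewrite dsum_sumE (bigD1 i) //= [X in _ + X]big1 ?addr0 => [|i' ne].
  rewrite dsum_sumE [LHS](svalP (aJ i)); apply: eq_bigr => j _.
  by rewrite ffunE dsum_injE.
by rewrite dsum_sumE big1 // => j _; rewrite ffunE dsum_inj_neq ?scaler0.
Qed.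
Definition fg_dsum : fgModule := FgModule dsum_fg.

End DirectSum.

Definition simple_module (M : lmodType A) : Prop :=
  (exists x : M, x != 0) /\
  forall U : {pred M}, submod_closed U -> U =i pred1 0 \/ U =i predT.

(* For submodules U <= W: the quotient W / U is simple. *)
Definition simple_step (M : lmodType A) (U W : {pred M}) : Prop :=
  [/\ {subset U <= W}, exists2 x, x \in W & x \notin U &
      forall U', submod_closed U' -> {subset U <= U'} -> {subset U' <= W} ->
        U' =i U \/ U' =i W].

Definition maximal_submodule (M : lmodType A) (U : {pred M}) : Prop :=
  submod_closed U /\ simple_step U predT.

Definition module_radical (M : lmodType A) (x : M) : Prop :=
  forall U : {pred M}, maximal_submodule U -> x \in U.

Definition has_length (M : lmodType A) (l : nat) : Prop :=
  exists F : nat -> {pred M},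
    [/\ forall i, (i <= l)%N -> submod_closed (F i), F 0 =i pred1 0,
        F l =i predT & forall i, (i < l)%N -> simple_step (F i) (F i.+1)].

Definition has_top (M S : lmodType A) : Prop :=
  exists f : {linear M -> S},
    (forall y, exists x, f x = y) /\ (forall x, f x = 0 <-> module_radical x).

Definition indecomposable (M : lmodType A) : Prop :=
  ~ trivial_module M /\
  forall (X Y : lmodType A) (f : {linear M -> (X * Y)%type}), bijective f ->
    trivial_module X \/ trivial_module Y.

(* Injective object of the category of finitely generated modules. *)
Definition injective_module (M : fgModule) : Prop :=
  forall (X Y : fgModule) (f : {linear X -> Y}) (g : {linear X -> M}),
    injective f -> exists h : {linear Y -> M}, forall x, h (f x) = g x.

End Modules.

Section DerivedCategory.
Variable A : pzRingType.

Definition mk_linear (U V : lmodType A) (f : U -> V) (H : linear f) :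
  {linear U -> V} := HB.pack f (GRing.isLinear.Build A U V _ f H).

(* Bounded cochain complexes of finitely generated modules, the objects of
   D^b(A). The differential is given between all pairs of degrees
   and vanishes except from i to i + 1: this avoids transports in [shift]. *)
Record complex := Complex {
  cobj :> int -> fgModule A;
  cdiff : forall i j, {linear cobj i -> cobj j};
  cdiff_shape : forall i j x, j != i + 1 -> cdiff i j x = 0;
  cdiff_sq : forall i j l x, cdiff j l (cdiff i j x) = 0;
  cbounded : exists n : nat, forall i : int, (n < `|i|)%N ->
    trivial_module (cobj i)
}.
Arguments cdiff : clear implicits.

Record cmap (X Y : complex) := CMap {
  cfun :> forall i, {linear X i -> Y i};
  cfun_comm : forall i j x, cfun j (cdiff X i j x) = cdiff Y i j (cfun i x)
}.

Definition cmap_id (X : complex) : cmap X X :=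
  @CMap X X (fun i => idfun : {linear X i -> X i}) (fun i j x => erefl).

Lemma cmap_zero_subproof (X Y : complex) i j x :
  (\0 : {linear X j -> Y j}) (cdiff X i j x) =
  cdiff Y i j ((\0 : {linear X i -> Y i}) x).
Proof. by rewrite /= linear0. Qed.
Definition cmap_zero (X Y : complex) : cmap X Y := CMap (@cmap_zero_subproof X Y).

Lemma cmap_comp_subproof (X Y Z : complex) (g : cmap Y Z) (f : cmap X Y) i j x :
  (g j \o f j : {linear X j -> Z j}) (cdiff X i j x) =
  cdiff Z i j ((g i \o f i : {linear X i -> Z i}) x).
Proof. by rewrite /= !cfun_comm. Qed.
Definition cmap_comp (X Y Z : complex) (g : cmap Y Z) (f : cmap X Y) : cmap X Z :=
  CMap (@cmap_comp_subproof X Y Z g f).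

Definition homotopic (X Y : complex) (f g : cmap X Y) : Prop :=
  exists s : forall i j, {linear X i -> Y j},
    forall i x, f i x - g i x =
      cdiff Y (i - 1) i (s i (i - 1) x) + s (i + 1) i (cdiff X i (i + 1) x).

Definition cocycle (X : complex) i (x : X i) : Prop := cdiff X i (i + 1) x = 0.
Definition coboundary (X : complex) i (x : X i) : Prop :=
  exists y, x = cdiff X (i - 1) i y.

(* Injectivity and surjectivity of H^i(f) for all i. *)
Definition quasi_iso (X Y : complex) (f : cmap X Y) : Prop :=
  forall i,
    (forall x, cocycle x -> coboundary (f i x) -> coboundary x) /\
    (forall y : Y i, cocycle y -> exists2 x, cocycle x & coboundary (f i x - y)).

Section Shift.
Variables (n : int) (X : complex).

Lemma shift_linear_subproof i j :
  linear (fun x => (-1) ^+ `|n|%N *: cdiff X (i + n) (j + n) x).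
Proof.
move=> a u v; rewrite linearP scalerDr !scalerA.
by rewrite (commr_sign a `|n|%N).
Qed.
Definition shift_diff i j := mk_linear (@shift_linear_subproof i j).

Lemma shift_shape i j x : j != i + 1 -> shift_diff i j x = 0.
Proof.
move=> ne; rewrite /= cdiff_shape ?scaler0 //.
by apply: contraNneq ne => e; rewrite -(inj_eq (addIr n)) e addrAC.
Qed.

Lemma shift_sq i j l x : shift_diff j l (shift_diff i j x) = 0.
Proof. by rewrite /= linearZ_LR /= cdiff_sq !scaler0. Qed.

Lemma shift_bounded : exists m : nat, forall i : int, (m < `|i|)%N ->
  trivial_module (X (i + n)).
Proof.
have [m mP] := cbounded X; exists (m + `|n|)%N => i lt; apply: mP.
lia.
Qed.

Definition shift : complex :=
  @Complex (fun i => X (i + n)) shift_diff shift_shape shift_sq shift_bounded.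
End Shift.


Section Cone.
Variables (X Y : complex) (f : cmap X Y).

Definition cone_obj (i : int) : fgModule A := fg_pair (X (i + 1)) (Y i).

Lemma cone_linear_subproof i j :
  linear ((fun p => (- cdiff X (i + 1) (j + 1) p.1,
                     transport j (f (i + 1) p.1) + cdiff Y i j p.2))
          : cone_obj i -> cone_obj j).
Proof.
move=> a [x y] [x' y']; apply: injective_projections => /=.
  by rewrite linearP opprD scalerN.
by rewrite !linearP transport_linear scalerDr addrACA.
Qed.
Definition cone_diff i j := mk_linear (@cone_linear_subproof i j).

Lemma cone_shape i j x : j != i + 1 -> cone_diff i j x = 0.
Proof.
move=> ne; rewrite /= !cdiff_shape ?(inj_eq (addIr 1)) //.
by rewrite transport_neq 1?eq_sym // oppr0 addr0.
Qed.

Lemma cone_sq i j l x : cone_diff j l (cone_diff i j x) = 0.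
Proof.
case: x => x y; apply: injective_projections => /=.
  by rewrite linearN cdiff_sq !oppr0.
rewrite linearD /= cdiff_sq addr0 linearN /= cfun_comm.
have [->|ne] := eqVneq j (i + 1).
  have [->|ne] := eqVneq l (i + 1 + 1).
    by rewrite !transport_id addNr.
  by rewrite transport_neq 1?eq_sym // cdiff_shape // addr0.
rewrite [transport j _]transport_neq 1?eq_sym // linear0 addr0.
rewrite cdiff_shape ?(inj_eq (addIr 1)) // oppr0.
by rewrite transport0.
Qed.

Lemma cone_bounded : exists m : nat, forall i : int, (m < `|i|)%N ->
  trivial_module (cone_obj i).
Proof.
have [m mP] := cbounded X; have [n nP] := cbounded Y.
exists (m + n).+1 => i lt [x y]; apply: injective_projections => /=.
  by apply: mP; lia.
by apply: nP; lia.
Qed.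

Definition cone : complex :=
  @Complex cone_obj cone_diff cone_shape cone_sq cone_bounded.
End Cone.

Section ComplexSum.
Variables X Y : complex.

Definition csum_obj (i : int) : fgModule A := fg_pair (X i) (Y i).

Lemma csum_linear_subproof i j :
  linear ((fun p => (cdiff X i j p.1, cdiff Y i j p.2))
          : csum_obj i -> csum_obj j).
Proof. by move=> a u v; apply: injective_projections; rewrite /= linearP. Qed.
Definition csum_diff i j := mk_linear (@csum_linear_subproof i j).

Lemma csum_shape i j x : j != i + 1 -> csum_diff i j x = 0.
Proof. by move=> ne; rewrite /= !cdiff_shape. Qed.

Lemma csum_sq i j l x : csum_diff j l (csum_diff i j x) = 0.
Proof. by rewrite /= !cdiff_sq. Qed.

Lemma csum_bounded : exists m : nat, forall i : int, (m < `|i|)%N ->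
  trivial_module (csum_obj i).
Proof.
have [m mP] := cbounded X; have [n nP] := cbounded Y.
exists (m + n)%N => i lt [x y]; apply: injective_projections => /=.
  by apply: mP; lia.
by apply: nP; lia.
Qed.

Definition csum : complex :=
  @Complex csum_obj csum_diff csum_shape csum_sq csum_bounded.
End ComplexSum.

Section Stalk.
Variable M : fgModule A.

Definition stalk_obj (i : int) : fgModule A := if i == 0 then M else fg_zero A.
Definition stalk_diff i j : {linear stalk_obj i -> stalk_obj j} := \0.

Lemma stalk_bounded : exists m : nat, forall i : int, (m < `|i|)%N ->
  trivial_module (stalk_obj i).
Proof.
exists 0%N => i; rewrite absz_gt0 /stalk_obj => /negPf -> x.
by rewrite [x]thinmx0 [RHS]thinmx0.
Qed.

Definition stalk : complex :=
  @Complex stalk_obj stalk_diff (fun _ _ _ _ => erefl) (fun _ _ _ _ => erefl)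
    stalk_bounded.
End Stalk.

(* Morphisms X -> Y of the derived category are classes, for roof_eq, of
   fractions X <- Z -> Y with a quasi-isomorphism as denominator Z -> X. Their
   operations are given as relations between representatives. *)
Record roof (X Y : complex) := Roof {
  apex : complex;
  den : cmap apex X;
  den_qis : quasi_iso den;
  num : cmap apex Y
}.

Lemma quasi_iso_id (X : complex) : quasi_iso (cmap_id X).
Proof.
move=> i; split=> // y cy; exists y => //=.
by rewrite subrr; exists 0; rewrite linear0.
Qed.

Lemma coboundaryB (X : complex) i (x y : X i) :
  coboundary x -> coboundary y -> coboundary (x - y).
Proof. by move=> [u ->] [v ->]; exists (u - v); rewrite linearB. Qed.

Lemma coboundary_cmap (X Y : complex) (f : cmap X Y) i (x : X i) :
  coboundary x -> coboundary (f i x).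
Proof. by move=> [u ->]; exists (f _ u); rewrite cfun_comm. Qed.

Lemma cocycle_cmap (X Y : complex) (f : cmap X Y) i (x : X i) :
  cocycle x -> cocycle (f i x).
Proof. by rewrite /cocycle => e; rewrite -cfun_comm e linear0. Qed.

Lemma quasi_iso_comp (X Y Z : complex) (g : cmap Y Z) (f : cmap X Y) :
  quasi_iso g -> quasi_iso f -> quasi_iso (cmap_comp g f).
Proof.
move=> qg qf i; have [gi gs] := qg i; have [fi fs] := qf i; split=> [x cx bx|z cz].
  by apply: fi => //; apply: gi => //; apply: cocycle_cmap.
have [y cy [u eu]] := gs z cz; have [x cx bx] := fs y cy; exists x => //=.
have [v ev] := coboundary_cmap g bx; exists (v + u).
by rewrite linearD -ev -eu linearB addrA subrK.
Qed.

Definition roof_of_cmap (X Y : complex) (f : cmap X Y) : roof X Y :=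
  Roof (@quasi_iso_id X) f.

Definition roof_eq (X Y : complex) (p q : roof X Y) : Prop :=
  exists (W : complex) (s : cmap W (apex p)) (t : cmap W (apex q)),
    [/\ quasi_iso (cmap_comp (den p) s),
        homotopic (cmap_comp (den p) s) (cmap_comp (den q) t) &
        homotopic (cmap_comp (num p) s) (cmap_comp (num q) t)].

(* h represents the composite q \o p. *)
Definition roof_comp (X Y Z : complex)
    (q : roof Y Z) (p : roof X Y) (h : roof X Z) : Prop :=
  exists (W : complex) (s : cmap W (apex p)) (qs : quasi_iso s)
         (t : cmap W (apex q)),
    homotopic (cmap_comp (num p) s) (cmap_comp (den q) t) /\
    roof_eq h (Roof (quasi_iso_comp (den_qis p) qs) (cmap_comp (num q) t)).

(* h represents the sum p + q: reduce to a common denominator. *)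
Definition roof_add (X Y : complex) (p q h : roof X Y) : Prop :=
  exists (W : complex) (s : cmap W X) (qs : quasi_iso s) (f g l : cmap W Y),
    [/\ roof_eq p (Roof qs f), roof_eq q (Roof qs g), roof_eq h (Roof qs l) &
        forall i x, l i x = f i x + g i x].

(* h represents the multiple of p by a central element a of A. *)
Definition roof_scale (X Y : complex) (a : A) (p h : roof X Y) : Prop :=
  exists (W : complex) (s : cmap W X) (qs : quasi_iso s) (f l : cmap W Y),
    [/\ roof_eq p (Roof qs f), roof_eq h (Roof qs l) &
        forall i x, l i x = a *: f i x].

Definition derived_iso (X Y : complex) : Prop :=
  exists (p : roof X Y) (q : roof Y X),
    roof_comp q p (roof_of_cmap (cmap_id X)) /\
    roof_comp p q (roof_of_cmap (cmap_id Y)).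

(* A class of objects closed under isomorphism in the derived category, shifts,
   cones and direct summands. Every distinguished triangle is isomorphic to that
   of the cone of a morphism of complexes. *)
Definition thick_subcategory (P : complex -> Prop) : Prop :=
  [/\ forall X Y, derived_iso X Y -> P X -> P Y,
      forall n X, P X -> P (shift n X),
      forall X Y (f : cmap X Y), P X -> P Y -> P (cone f) &
      forall X Y, P (csum X Y) -> P X].

Definition thickly_generates (T : complex) : Prop :=
  forall P, thick_subcategory P -> P T -> forall X, P X.

Definition tilting (T : complex) : Prop :=
  (forall n : int, n != 0 ->
     forall p : roof T (shift n T), roof_eq p (roof_of_cmap (cmap_zero _ _))) /\
  thickly_generates T.

End DerivedCategory.

(* The isomorphism is induced by a map phi on representatives. The field acts on
   morphisms of A-modules through scalar * 1 in A. *)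
Definition endomorphism_algebra_iso (k : fieldType)
    (V : finType) (adj : rel V) (rels : pathalg k adj -> Prop)
    (T : complex (bqa rels))
    (V' : finType) (adj' : rel V') (rels' : pathalg k adj' -> Prop) : Prop :=
  exists phi : bqa rels' -> roof T T,
    [/\ roof_eq (phi 1) (roof_of_cmap (cmap_id T)),
        forall b c, roof_comp (phi b) (phi c) (phi (b * c)),
        forall b c, roof_add (phi b) (phi c) (phi (b + c)) &
        forall (l : k) b, roof_scale (l *: (1 : bqa rels)) (phi b) (phi (l *: b))] /\
    (forall b c, roof_eq (phi b) (phi c) -> b = c) /\
    (forall p : roof T T, exists b, roof_eq (phi b) p).

(* Vertex i + 1 of the quiver 1 <- 2 <- ... <- n is the ordinal i. *)
Definition nakayama_adj (n : nat) : rel 'I_n := fun x y => x == y.+1 :> nat.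

Definition nakayama_rels (k : fieldType) (n r : nat)
    (f : pathalg k (@nakayama_adj n)) : Prop :=
  exists2 p, qlength p = r & f = << p >>.

Definition nakayama (k : fieldType) (n r : nat) : pzRingType :=
  bqa (@nakayama_rels k n r).

Section NakayamaModules.
Variables (k : fieldType) (n r : nat).
Local Notation N := (nakayama k n r).

Definition simple_at (x : 'I_n) (S : fgModule N) : Prop :=
  simple_module S /\ exists m : S, (vertex_idem (@nakayama_rels k n r) x : N) *: m != 0.

Definition indec_injective_at (x : 'I_n) (M : fgModule N) : Prop :=
  [/\ indecomposable M, injective_module M &
      exists (S : fgModule N) (f : {linear S -> M}), simple_at x S /\ injective f].

Definition indec_of_length_at (x : 'I_n) (l : nat) (M : fgModule N) : Prop :=
  [/\ indecomposable M, has_length M l &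
      exists S : fgModule N, simple_at x S /\ has_top M S].

End NakayamaModules.

(* The vertices t_1, ..., t_u, b_1, ..., b_u, c_1, ..., c_v are numbered from 0. *)
Section OneBranchExtension.
Variables (k : fieldType) (v u : nat).

Definition branch_vertex : finType := ('I_u + 'I_u + 'I_v)%type.
Definition vt (i : 'I_u) : branch_vertex := inl (inl i).
Definition vb (i : 'I_u) : branch_vertex := inl (inr i).
Definition vc (i : 'I_v) : branch_vertex := inr i.

Definition branch_adj : rel branch_vertex := fun x y =>
  match x, y with
  | inl (inl i), inl (inl j) => j == i.+1 :> nat
  | inl (inr i), inl (inr j) => j == i.+1 :> nat
  | inl (inl i), inl (inr j) => j == i
  | inr i, inr j => j == i.+1 :> nat
  | inr i, inl (inr j) => (i.+1 == v) && (j == 0%N :> nat)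
  | _, _ => false
  end.

Definition branch_rels (f : pathalg k branch_adj) : Prop :=
  exists (i j : 'I_u) (p q : qpath branch_adj),
    [/\ j = i.+1 :> nat, val p = (vt i, [:: vt j; vb j]),
        val q = (vt i, [:: vb i; vb j]) & f = << p >> - << q >>].

End OneBranchExtension.

(* I and S are indexed as in I_i and S_i^(j), by integers starting at 1. *)
Definition branch_tilting_module (k : fieldType) (u v : nat)
    (I : nat -> fgModule (nakayama k (2 * u + v) (u + v + 1)))
    (S : nat -> nat -> fgModule (nakayama k (2 * u + v) (u + v + 1))) :
    fgModule (nakayama k (2 * u + v) (u + v + 1)) :=
  fg_pair (fg_dsum (fun i : 'I_(u + 1) => I i.+1))
          (fg_dsum (fun j : 'I_(u + v - 1) => S (u + j.+1)%N j.+1)).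

(* Main.v *)
Require Import Defs.
From HB Require Import structures.
From mathcomp Require Import all_boot all_order all_algebra.
From mathcomp Require Import finmap boolp zify.
From mathcomp.multinomials Require Import monalg.

Set Implicit Arguments.
Unset Strict Implicit.
Unset Printing Implicit Defensive.

Import Order.TTheory GRing.Theory Num.Theory.
Local Open Scope ring_scope.

(** Number the vertices from 0, put n = 2u + v and r = u + v + 1, and write K c d
for the module of functions on the interval [c, d) of vertices, where every
path of length less than r inside the interval acts as an isomorphism; its top
is at d - 1 and its socle at c. All summands of T are of this form. An
indecomposable injective module that contains the simple module at x is the
injective hull K x n ([injective_hull_interval]), and a module of length l with
simple top at x is cyclic, hence uniserial, hence K (x + 1 - l) (x + 1)
([length_top_interval]). So T is the sum of t_i = K i (i + r) and
b_i = K u (u + v + i + 1) for i < u, and of c_i = K u (u + i + 1) for i < v.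

Endomorphisms. A map K c d -> K c' d' is determined by the image of a generator,
which lies at vertex d - 1; it is a multiple of the restriction of functions
from [c, d) to [c', d'), and it is zero unless c <= c' and d <= d'
([hom_scalar]). Restrictions compose to restrictions, so End(T) is the
incidence algebra of the summands, ordered by both ends of their intervals.
The branch extension algebra is the same incidence algebra: its quiver has a
path from s to t exactly when s <= t in this order ([branch_connect]), and
parallel paths agree modulo the commutative squares ([branch_uniq]).

Self-extensions. With truncated subtraction,
  0 -> K 0 (d - r) -> K 0 c -> K (d - r) d -> K c d -> 0
is a projective resolution of each summand K c d. Its terms of nonzero degree
live on the vertices below u, where the b_i and c_i vanish, so that only maps
into the t_i matter, and these extend because t_i is injective
([interval_ext]). A fraction that starts at T can be computed on the resolution
of T, since maps from a bounded complex of projectives lift through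
quasi-isomorphisms up to homotopy ([lift_cmap]); this gives the vanishing of
Hom(T, T[k]) for nonzero k and identifies the endomorphisms of T in the derived
category with those of the module T.

Generation. Consecutive modules K u (u + j) have simple quotients, so a thick
subcategory that contains T contains the simple modules at the vertices from u
on. Going down from u, each t_i has its socle at i and all other composition
factors at larger vertices, which gives the other simple modules
([thick_from_intervals]). Every finitely generated module is filtered by simple
modules ([thick_all_modules]), and every bounded complex by stalk complexes
([thick_of_stalks]). *)

(** * Quasi-isomorphisms, cones and thick subcategories *)

Section Complexes.
Variable A : pzRingType.
Implicit Types X Y Z : complex A.

(** Degrees of the form j + 1 make the objects of a cone and of a shift
literally equal to objects of the given complexes, which avoids transports. *)
Lemma int_predP (Q : int -> Prop) : (forall j, Q (j + 1)) -> forall i, Q i.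
Proof. by move=> H i; rewrite -(subrK 1 i). Qed.

(** Allows an arbitrary source degree j: the differential vanishes unless i = j
+ 1. *)
Lemma coboundary_diff X i j (y : X j) : coboundary (cdiff X j i y).
Proof.
have [e|ne] := eqVneq i (j + 1).
  have ej : j = i - 1 by rewrite e addrK.
  by move: y; rewrite ej => y; exists y.
by rewrite cdiff_shape //; exists 0; rewrite linear0.
Qed.

Lemma coboundary_succ X j (x : X (j + 1)) :
  coboundary x -> exists y, x = cdiff X j (j + 1) y.
Proof. by case; rewrite addrK => y; exists y. Qed.

Lemma coboundaryD X i (x y : X i) :
  coboundary x -> coboundary y -> coboundary (x + y).
Proof. by move=> [a ->] [b ->]; exists (a + b); rewrite linearD. Qed.

Lemma homotopic_pointwise X Y (f g : cmap X Y) :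
  (forall i x, f i x = g i x) -> homotopic f g.
Proof.
move=> e; exists (fun i j => \0 : {linear X i -> Y j}) => i x.
by rewrite e subrr /= linear0 addr0.
Qed.

Lemma homotopic_sym X Y (f g : cmap X Y) : homotopic f g -> homotopic g f.
Proof.
case=> s sE; exists (fun i j => \- (s i j) : {linear X i -> Y j}) => i x.
by rewrite -opprB sE /= opprD linearN.
Qed.

Lemma homotopic_cocycle X Y (f g : cmap X Y) i (x : X i) :
  homotopic f g -> cocycle x -> coboundary (f i x - g i x).
Proof.
case=> s sE cx; rewrite sE cx linear0 addr0.
exact: coboundary_diff.
Qed.

Lemma quasi_iso_homotopic X Y (f g : cmap X Y) :
  homotopic f g -> quasi_iso f -> quasi_iso g.
Proof.
move=> h qf i; have [fi fs] := qf i; split=> [x cx bx|y cy].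
  apply: (fi) => //; rewrite -[f i x](subrK (g i x)).
  by apply: coboundaryD => //; apply: homotopic_cocycle.
have [x cx bx] := fs y cy; exists x => //.
rewrite -[g i x](subKr (f i x)) addrAC.
exact: coboundaryB bx (homotopic_cocycle h cx).
Qed.

Lemma quasi_iso_bij X Y (f : cmap X Y) :
  (forall i x, f i x = 0 -> x = 0) -> (forall i y, exists x, f i x = y) ->
  quasi_iso f.
Proof.
move=> fi fs i; split=> [x cx [y ey]|y cy].
  have [z ez] := fs _ y; exists z; apply/eqP; rewrite -subr_eq0; apply/eqP.
  by apply: fi; rewrite linearB cfun_comm ez ey subrr.
have [x ex] := fs _ y; exists x.
  by apply: fi; rewrite cfun_comm ex.
by rewrite ex subrr; exists 0; rewrite linear0.
Qed.

Lemma derived_iso_sym X Y : derived_iso X Y -> derived_iso Y X.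
Proof. by case=> p [q [h1 h2]]; exists q, p. Qed.

(** The inverse is the fraction with f as denominator and the identity as
numerator. *)
Lemma derived_iso_qis X Y (f : cmap X Y) : quasi_iso f -> derived_iso X Y.
Proof.
move=> qf; exists (roof_of_cmap f), (Roof qf (cmap_id X)); split.
  exists X, (cmap_id X), (quasi_iso_id X), (cmap_id X); split.
    exact: homotopic_pointwise.
  exists X, (cmap_id X), (cmap_id X); split; try exact: homotopic_pointwise.
  by apply: quasi_iso_comp; apply: quasi_iso_id.
exists X, (cmap_id X), (quasi_iso_id X), (cmap_id X); split.
  exact: homotopic_pointwise.
exists X, f, (cmap_id X); split; try exact: homotopic_pointwise.
by apply: quasi_iso_comp => //; apply: quasi_iso_id.
Qed.

Lemma transport_diff X i j l (x : X i) : i = j ->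
  cdiff X j l (transport j x) = cdiff X i l x.
Proof. by case: _ /; rewrite transport_id. Qed.

Lemma diff_transport X i j l (x : X i) : j = l ->
  transport l (cdiff X i j x) = cdiff X i l x.
Proof. by case: _ /; rewrite transport_id. Qed.

Lemma transport_inj (M : int -> fgModule A) i j (x : M i) :
  i = j -> transport j x = 0 -> x = 0.
Proof. by case: _ /; rewrite transport_id. Qed.

Lemma transport_surj (M : int -> fgModule A) i j (y : M j) :
  i = j -> exists x : M i, transport j x = y.
Proof. by move=> e; move: y; case: _ / e => y; exists y; rewrite transport_id. Qed.

Lemma cfun_transport X Y (f : cmap X Y) i j (x : X i) :
  f j (transport j x) = transport j (f i x).
Proof.
have [<-|ne] := eqVneq i j; first by rewrite !transport_id.
by rewrite !transport_neq // linear0.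
Qed.

Definition transport_lin (M : int -> fgModule A) i j : {linear M i -> M j} :=
  mk_linear (@transport_linear A _ M i j).

Section Unshift.
Variable X : complex A.

Lemma unshift_subproof i j (x : shift (-1) (shift 1 X) i) :
  transport_lin X (j + (-1) + 1) j (cdiff (shift (-1) (shift 1 X)) i j x) =
  cdiff X i j (transport_lin X (i + (-1) + 1) i x).
Proof.
rewrite /= !expr1 !scaleN1r opprK transport_diff ?subrK //.
by rewrite diff_transport ?subrK.
Qed.

(** The two signs of the shifted differentials cancel, and the degrees i - 1 +
1 and i differ only by a transport. *)
Definition unshift : cmap (shift (-1) (shift 1 X)) X := CMap unshift_subproof.

Lemma unshift_qis : quasi_iso unshift.
Proof.
apply: quasi_iso_bij => i.
  by move=> x; exact: (@transport_inj X _ _ x (subrK 1 i)).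
by move=> y; exact: (@transport_surj X _ _ y (subrK 1 i)).
Qed.
End Unshift.

Definition short_exact X Y Z (f : cmap X Y) (g : cmap Y Z) : Prop :=
  [/\ forall i x, f i x = 0 -> x = 0, forall i z, exists y, g i y = z,
      forall i x, g i (f i x) = 0 &
      forall i y, g i y = 0 -> exists x, y = f i x].

Section ConeOfSes.
Variables (X Y Z : complex A) (f : cmap X Y) (g : cmap Y Z).
Hypothesis fg : short_exact f g.

Lemma cone_to_coker_linear i : linear (fun p : cone f i => g i p.2).
Proof. by move=> a p q; rewrite /= linearP. Qed.

Lemma cone_to_coker_comm i j (p : cone f i) :
  mk_linear (@cone_to_coker_linear j) (cdiff (cone f) i j p) =
  cdiff Z i j (mk_linear (@cone_to_coker_linear i) p).
Proof.
case: fg => _ _ gf _; rewrite /= linearD cfun_transport gf.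
by rewrite transport0 add0r cfun_comm.
Qed.

Definition cone_to_coker : cmap (cone f) Z := CMap cone_to_coker_comm.

(** The cone of an injective chain map is a model of its cokernel. *)
Lemma cone_to_coker_qis : quasi_iso cone_to_coker.
Proof.
case: fg => fi gs gf ex; apply: int_predP => j; split=> [[x y] cxy|z cz].
  move=> /coboundary_succ[z' /= ez'].
  have [y' ey'] := gs _ z'.
  have [x' ex'] : exists x', y - cdiff Y j (j + 1) y' = f _ x'.
    by apply: ex; rewrite linearB cfun_comm ey' ez' subrr.
  have eq2 := congr1 snd cxy; rewrite /= transport_id in eq2.
  have exd : x = - cdiff X _ (j + 1 + 1) x'.
    apply/eqP; rewrite -subr_eq0 opprK; apply/eqP/fi.
    by rewrite linearD cfun_comm -ex' linearB cdiff_sq subr0.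
  suff -> : (x, y) = cdiff (cone f) j (j + 1) (x', y').
    exact: coboundary_diff.
  apply: injective_projections => //=.
  by rewrite transport_id -ex' subrK.
have [y ey] := gs _ z.
have [x ex'] : exists x, cdiff Y (j + 1) (j + 1 + 1) y = f _ x.
  by apply: ex; rewrite cfun_comm ey.
exists (- x, y).
  apply: injective_projections => /=.
    rewrite linearN opprK; apply: fi.
    by rewrite cfun_comm -ex' cdiff_sq.
  by rewrite transport_id linearN -ex' addNr.
by rewrite /= ey subrr; exists 0; rewrite linear0.
Qed.

Lemma ker_to_cone_linear i : linear (fun x : shift 1 X i => (f (i + 1) x, 0) : cone g i).
Proof.
by move=> a p q; apply: injective_projections => /=; rewrite ?linearP // scaler0 addr0.
Qed.

Lemma ker_to_cone_comm i j (x : shift 1 X i) :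
  mk_linear (@ker_to_cone_linear j) (cdiff (shift 1 X) i j x) =
  cdiff (cone g) i j (mk_linear (@ker_to_cone_linear i) x).
Proof.
case: fg => _ _ gf _; apply: injective_projections => /=.
  by rewrite expr1 scaleN1r linearN cfun_comm.
by rewrite gf transport0 linear0 addr0.
Qed.

Definition ker_to_cone : cmap (shift 1 X) (cone g) := CMap ker_to_cone_comm.

(** The cone of a surjective chain map is a model of its shifted kernel. *)
Lemma ker_to_cone_qis : quasi_iso ker_to_cone.
Proof.
case: fg => fi gs gf ex; apply: int_predP => j; split=> [x cx|[y z] cyz].
  move=> /coboundary_succ[[y z] e].
  have e1 := congr1 fst e; have e2 := congr1 snd e.
  rewrite /= in e1 e2; rewrite transport_id in e2.
  have [y' ey'] := gs _ z.
  have [x' ex'] : exists x', y + cdiff Y j (j + 1) y' = f _ x'.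
    by apply: ex; rewrite linearD cfun_comm ey' -e2.
  suff -> : x = cdiff (shift 1 X) j (j + 1) x' by apply: coboundary_diff.
  apply/eqP; rewrite -subr_eq0; apply/eqP/fi.
  rewrite /= expr1 scaleN1r opprK linearD cfun_comm -ex' linearD cdiff_sq.
  by rewrite e1 addr0 addNr.
have e1 := congr1 fst cyz; have e2 := congr1 snd cyz.
rewrite /= in e1 e2; rewrite transport_id in e2.
have [y' ey'] := gs _ z.
have [x ex'] : exists x, y + cdiff Y (j + 1) (j + 1 + 1) y' = f _ x.
  by apply: ex; rewrite linearD cfun_comm ey' e2.
exists x.
  apply: fi; rewrite /= expr1 scaleN1r linearN cfun_comm -ex' linearD cdiff_sq.
  by rewrite addr0 e1.
suff -> : ker_to_cone (j + 1) x - (y, z) = cdiff (cone g) j (j + 1) (- y', 0).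
  exact: coboundary_diff.
apply: injective_projections => /=.
  by rewrite linearN opprK -ex' [y + _]addrC addrK.
by rewrite transport_id linear0 addr0 linearN ey' sub0r.
Qed.

End ConeOfSes.

Section ConeTriangle.
Variables (X Y : complex A) (f : cmap X Y).

Lemma cone_in_linear i : linear (fun y : Y i => (0, y) : cone f i).
Proof.
by move=> a p q; apply: injective_projections => //=; rewrite scaler0 addr0.
Qed.

Lemma cone_in_comm i j (y : Y i) :
  mk_linear (@cone_in_linear j) (cdiff Y i j y) =
  cdiff (cone f) i j (mk_linear (@cone_in_linear i) y).
Proof.
by apply: injective_projections; rewrite /= !linear0 ?oppr0 // transport0 add0r.
Qed.

Definition cone_in : cmap Y (cone f) := CMap cone_in_comm.

Lemma cone_out_linear i : linear (fun p : cone f i => p.1 : shift 1 X i).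
Proof. by []. Qed.

Lemma cone_out_comm i j (p : cone f i) :
  mk_linear (@cone_out_linear j) (cdiff (cone f) i j p) =
  cdiff (shift 1 X) i j (mk_linear (@cone_out_linear i) p).
Proof. by rewrite /= expr1 scaleN1r. Qed.

Definition cone_out : cmap (cone f) (shift 1 X) := CMap cone_out_comm.

Lemma cone_ses : short_exact cone_in cone_out.
Proof.
split=> [i y /(congr1 snd) //|i x|//|i [x y] /= ->]; last by exists y.
by exists (x, 0).
Qed.
End ConeTriangle.

Section Thick.
Variable P : complex A -> Prop.
Hypothesis thP : thick_subcategory P.

Lemma thick_qis X Y (f : cmap X Y) : quasi_iso f -> (P X <-> P Y).
Proof.
case: thP => Pi _ _ _ /derived_iso_qis d.
by split; apply: Pi => //; apply: derived_iso_sym.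
Qed.

Lemma thick_ses_coker X Y Z (f : cmap X Y) (g : cmap Y Z) :
  short_exact f g -> P X -> P Y -> P Z.
Proof.
case: thP => _ _ Pc _ fg PX PY.
by apply/(thick_qis (cone_to_coker_qis fg)); apply: Pc.
Qed.

Lemma thick_ses_ker X Y Z (f : cmap X Y) (g : cmap Y Z) :
  short_exact f g -> P Y -> P Z -> P X.
Proof.
case: thP => _ Ps Pc _ fg PY PZ.
apply/(thick_qis (@unshift_qis X)); apply: Ps.
by apply/(thick_qis (ker_to_cone_qis fg)); apply: Pc.
Qed.

(** The rotated triangle: Y is the kernel of the projection of the cone of f
onto X[1], and the cone of f is quasi-isomorphic to Z. *)
Lemma thick_ses_mid X Y Z (f : cmap X Y) (g : cmap Y Z) :
  short_exact f g -> P X -> P Z -> P Y.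
Proof.
case: (thP) => _ Ps _ _ fg PX PZ.
apply: (thick_ses_ker (cone_ses f)); last exact: Ps.
exact/(thick_qis (cone_to_coker_qis fg)).
Qed.
End Thick.

Section FgIf.
Implicit Types M N : fgModule A.

(** For modules that vanish under a condition on the degree. Stalk complexes
and truncations are handled through the two maps below and their lemmas,
without further matching on dependent types. *)
Definition fg_if (b : bool) M : fgModule A := if b then M else fg_zero A.

Definition if_in b M : {linear M -> fg_if b M} :=
  if b as b0 return {linear M -> fg_if b0 M} then idfun else \0.

Definition if_out b M : {linear fg_if b M -> M} :=
  if b as b0 return {linear fg_if b0 M -> M} then idfun else \0.

Lemma if_inK b M x : if_out b M (if_in b M x) = if b then x else 0.
Proof. by case: b. Qed.

Lemma if_outK b M (y : fg_if b M) : if_in b M (if_out b M y) = y.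
Proof. by case: b y => //= y; rewrite [y]thinmx0 [LHS]thinmx0. Qed.

Lemma if_out_inj b M (y : fg_if b M) : if_out b M y = 0 -> y = 0.
Proof. by move=> e; rewrite -[y]if_outK e linear0. Qed.

Lemma if_false b M (y : fg_if b M) : ~~ b -> y = 0.
Proof. by case: b y => //= y _; rewrite [LHS]thinmx0 [RHS]thinmx0. Qed.

Definition stalk_in M i : {linear M -> stalk M i} := if_in (i == 0) M.
Definition stalk_out M i : {linear stalk M i -> M} := if_out (i == 0) M.

Lemma stalk_map_comm M N (f : {linear M -> N}) i j (x : stalk M i) :
  (stalk_in N j \o f \o stalk_out M j : {linear _ -> _}) (cdiff (stalk M) i j x) =
  cdiff (stalk N) i j ((stalk_in N i \o f \o stalk_out M i : {linear _ -> _}) x).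
Proof. by rewrite /= !linear0. Qed.

Definition stalk_map M N (f : {linear M -> N}) : cmap (stalk M) (stalk N) :=
  CMap (stalk_map_comm f).

Lemma stalk_mapE M N (f : {linear M -> N}) i x :
  stalk_map f i x = stalk_in N i (f (stalk_out M i x)).
Proof. by []. Qed.

Lemma stalk_inK M i x : stalk_out M i (stalk_in M i x) = if i == 0 then x else 0.
Proof. exact: if_inK. Qed.

Lemma stalk_outK M i (y : stalk M i) : stalk_in M i (stalk_out M i y) = y.
Proof. exact: if_outK. Qed.

Lemma stalk_out_inj M i (y : stalk M i) : stalk_out M i y = 0 -> y = 0.
Proof. exact: if_out_inj. Qed.

Lemma stalk_neq0 M i (y : stalk M i) : i != 0 -> y = 0.
Proof. exact: if_false. Qed.

Lemma stalk_ses (L M N : fgModule A) (f : {linear L -> M}) (g : {linear M -> N}) :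
  injective f -> (forall z, exists y, g y = z) -> (forall x, g (f x) = 0) ->
  (forall y, g y = 0 -> exists x, y = f x) ->
  short_exact (stalk_map f) (stalk_map g).
Proof.
move=> fi gs gf ex; split=> i.
- move=> x; rewrite stalk_mapE => e; apply: stalk_out_inj.
  have [i0|ne] := boolP (i == 0); last by rewrite (stalk_neq0 x) ?linear0.
  apply: fi; move/(congr1 (stalk_out M i)): e.
  by rewrite stalk_inK i0 !linear0.
- move=> z; have [y ey] := gs (stalk_out N i z); exists (stalk_in M i y).
  rewrite stalk_mapE stalk_inK; case: eqP => [_|/eqP ne].
    by rewrite ey stalk_outK.
  by rewrite !linear0 [RHS]stalk_neq0.
- move=> x; rewrite !stalk_mapE stalk_inK; case: eqP => _; last by rewrite !linear0.
  by rewrite gf linear0.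
move=> y; rewrite stalk_mapE => e; have [i0|ne] := boolP (i == 0); last first.
  by exists 0; rewrite linear0; apply: stalk_neq0.
have /ex[x ex'] : g (stalk_out M i y) = 0.
  by move/(congr1 (stalk_out N i)): e; rewrite stalk_inK i0 linear0.
by exists (stalk_in L i x); rewrite stalk_mapE stalk_inK i0 -ex' stalk_outK.
Qed.

Lemma stalk_map_bij_qis M N (f : {linear M -> N}) :
  bijective f -> quasi_iso (stalk_map f).
Proof.
case=> g fK gK; apply: quasi_iso_bij => i.
  move=> x; rewrite stalk_mapE => e; apply: stalk_out_inj.
  have [i0|ne] := boolP (i == 0); last by rewrite (stalk_neq0 x) ?linear0.
  apply: (can_inj fK); move/(congr1 (stalk_out N i)): e.
  by rewrite stalk_inK i0 !linear0.
move=> y; exists (stalk_in M i (g (stalk_out N i y))).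
rewrite stalk_mapE stalk_inK; case: eqP => [_|/eqP ne].
  by rewrite gK stalk_outK.
by rewrite !linear0 [RHS]stalk_neq0.
Qed.
End FgIf.

End Complexes.

(** * Thick subcategories that contain all stalk complexes *)

Section Truncation.
Variables (A : pzRingType) (X : complex A) (a : int).

(** The stupid truncation of X to the degrees larger than a. *)
Definition above_obj i : fgModule A := fg_if (a < i) (X i).

Definition above_in i : {linear X i -> above_obj i} := if_in (a < i) (X i).
Definition above_out i : {linear above_obj i -> X i} := if_out (a < i) (X i).

Definition above_diff i j : {linear above_obj i -> above_obj j} :=
  above_in j \o cdiff X i j \o above_out i.

Lemma above_outD i j (x : above_obj i) :
  above_out j (above_diff i j x) = cdiff X i j (above_out i x).
Proof.
rewrite /above_diff /= /above_out if_inK; case: ifP => // /negbT nj.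
have [e|ne] := eqVneq j (i + 1); last by rewrite cdiff_shape.
have ni : ~~ (a < i) by lia.
by rewrite (if_false x ni) !linear0.
Qed.

Lemma above_shape i j x : j != i + 1 -> above_diff i j x = 0.
Proof. by move=> ne; rewrite /above_diff /= cdiff_shape // linear0. Qed.

Lemma above_sq i j l x : above_diff j l (above_diff i j x) = 0.
Proof. by apply: if_out_inj; rewrite !above_outD cdiff_sq. Qed.

Lemma above_bounded : exists m : nat, forall i : int, (m < `|i|)%N ->
  trivial_module (above_obj i).
Proof.
have [m mP] := cbounded X; exists m => i /mP tX x.
by apply: if_out_inj; apply: tX.
Qed.

Definition above : complex A :=
  Complex above_shape above_sq above_bounded.

Lemma above_incl_comm i j (x : above i) :
  above_out j (cdiff above i j x) = cdiff X i j (above_out i x).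
Proof. exact: above_outD. Qed.

Definition above_incl : cmap above X := CMap above_incl_comm.

Hypothesis Xa : forall i, i < a -> trivial_module (X i).

Definition bottom_fun i : {linear X i -> shift (- a) (stalk (X a)) i} :=
  stalk_in (X a) (i - a) \o transport_lin X i a.

Lemma bottom_comm i j (x : X i) :
  bottom_fun j (cdiff X i j x) =
  cdiff (shift (- a) (stalk (X a))) i j (bottom_fun i x).
Proof.
rewrite /bottom_fun /= scaler0.
have [e|ne] := eqVneq j (i + 1); last by rewrite cdiff_shape // transport0 linear0.
have [ja|nja] := eqVneq j a; last by rewrite transport_neq // linear0.
have -> : x = 0 by apply: Xa; lia.
by rewrite linear0 transport0 linear0.
Qed.

Definition bottom : cmap X (shift (- a) (stalk (X a))) := CMap bottom_comm.

(** If X vanishes below degree a, the quotient of X by its truncation above a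
is concentrated in degree a. *)
Lemma above_ses : short_exact above_incl bottom.
Proof.
split=> i.
- by move=> x; apply: if_out_inj.
- move=> y; have [ia|nia] := eqVneq i a; last first.
    by exists 0; rewrite linear0 [RHS]stalk_neq0 // subr_eq0.
  have [x ex] := transport_surj (M := X) (stalk_out (X a) (i - a) y) ia.
  by exists x; rewrite /= ex stalk_outK.
- move=> x /=; have [ia|nia] := eqVneq i a; last by rewrite transport_neq // linear0.
  have ni : ~~ (a < i) by lia.
  by rewrite (if_false x ni) linear0 transport0 linear0.
move=> y e; have [lt|gt|ia] := ltgtP i a; last 1 first.
- exists 0; rewrite linear0; apply: (transport_inj ia).
  move/(congr1 (stalk_out (X a) (i - a))): e.
  by rewrite /= stalk_inK subr_eq0 (introT eqP ia) linear0.
- by exists 0; rewrite linear0; apply: Xa.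
by exists (above_in i y); rewrite /= /above_out if_inK gt.
Qed.
End Truncation.

Section ThickStalks.
Variables (A : pzRingType) (P : complex A -> Prop).
Hypotheses (thP : thick_subcategory P) (Pst : forall M, P (stalk M)).

Lemma thick_trivial (X Y : complex A) : P X -> (forall i, trivial_module (Y i)) -> P Y.
Proof.
move=> PX tY; pose f := cmap_id X; pose g := cmap_zero X Y.
apply: (thick_ses_coker thP (f := f) (g := g)) => //; split=> //= i.
  by move=> z; exists 0; rewrite (tY i z).
by move=> y _; exists y.
Qed.

(** Peel off the lowest degree, by induction on the number of degrees where Y
may be nonzero. *)
Lemma thick_of_stalks X : P X.
Proof.
have [m mP] := cbounded X.
have H : forall l (Y : complex A) (a : int),
    (forall i, i < a -> trivial_module (Y i)) ->
    (forall i, a + l%:Z <= i -> trivial_module (Y i)) -> P Y.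
  elim=> [|l IH] Y a Ya Yl.
    apply: (thick_trivial (Pst (fg_zero A))) => i.
    by have [lt|ge] := ltP i a; [apply: Ya | apply: Yl; rewrite addr0].
  apply: (thick_ses_mid thP (above_ses Ya)).
    apply: (IH _ (a + 1)) => i lt x.
      by apply: if_false; lia.
    by apply: if_out_inj; apply: Yl; lia.
  by case: thP => _ Ps _ _; apply: Ps.
by apply: (H m.+1.*2 _ (- (m.+1)%:Z)) => i h; apply: mP; lia.
Qed.
End ThickStalks.

(** * Lifting through quasi-isomorphisms *)

Section Lifting.
Variable A : pzRingType.

(** A submodule of the product of U and V. *)
Definition linear_rel (U V : lmodType A) (R : U -> V -> Prop) : Prop :=
  forall (a : A) x y x' y', R x y -> R x' y' -> R (a *: x + x') (a *: y + y').

(** Projectivity in terms of relations: every total linear relation contains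
the graph of a linear map. This is lifting along the surjection from the
relation, a submodule of the product, onto Q; stated in this way it applies
without building kernels and pullbacks as modules. *)
Definition rel_projective (Q : lmodType A) : Prop :=
  forall (Z : lmodType A) (R : Q -> Z -> Prop), linear_rel R ->
    (forall x, exists z, R x z) ->
    exists phi : {linear Q -> Z}, forall x, R x (phi x).

Section Update.
Variables (Q : int -> fgModule A) (Z : int -> fgModule A).
Variables (i0 : int) (new : {linear Q i0 -> Z i0}) (phi : forall i, {linear Q i -> Z i}).

Definition update i : {linear Q i -> Z i} :=
  if i0 =P i is ReflectT e then ecast i {linear Q i -> Z i} e new else phi i.

Lemma update_id : update i0 = new.
Proof. by rewrite /update; case: eqP => // e; rewrite (eq_axiomK e). Qed.

Lemma update_neq i : i0 != i -> update i = phi i.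
Proof. by rewrite /update; case: eqP. Qed.
End Update.

Section Update2.
Variables (Q : int -> fgModule A) (X : int -> fgModule A).
Variables (i0 : int) (new : {linear Q i0 -> X (i0 - 1)}).
Variable (h : forall i j, {linear Q i -> X j}).

Definition update2 i j : {linear Q i -> X j} :=
  if i0 =P i is ReflectT e then
    ecast i {linear Q i -> X j} e (transport_lin X (i0 - 1) j \o new) else h i j.

Lemma update2_id x : update2 i0 (i0 - 1) x = new x.
Proof.
rewrite /update2; case: eqP => // e; rewrite (eq_axiomK e) /=.
by rewrite transport_id.
Qed.

Lemma update2_neq i j : i0 != i -> update2 i j = h i j.
Proof. by rewrite /update2; case: eqP. Qed.
End Update2.

Variables (Q X Z : complex A) (g : cmap Z X) (f : cmap Q X).
Hypotheses (Qproj : forall i, rel_projective (Q i)) (gq : quasi_iso g).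

(** A partial lift of f through g, up to the homotopy h, in degrees at least
i0. *)
Definition lift_from (i0 : int) (phi : forall i, {linear Q i -> Z i})
    (h : forall i j, {linear Q i -> X j}) : Prop :=
  forall i, i0 <= i -> forall x,
    cdiff Z i (i + 1) (phi i x) = phi (i + 1) (cdiff Q i (i + 1) x) /\
    f i x - g i (phi i x) =
      cdiff X (i - 1) i (h i (i - 1) x) + h (i + 1) i (cdiff Q i (i + 1) x).

(** At degree i0, the pairs (z, w) that extend the partial lift at x form a
linear relation. It is total: the cocycle to be bounded by z is mapped by g to
a coboundary, so it is one, and surjectivity of g on cohomology corrects the
remaining difference. *)
Lemma lift_step i0 phi h : lift_from (i0 + 1) phi h ->
  exists phi' h', lift_from i0 phi' h'.
Proof.
move=> L.
pose R (x : Q i0) (p : (Z i0 * X (i0 - 1))%type) :=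
  cdiff Z i0 (i0 + 1) p.1 = phi (i0 + 1) (cdiff Q i0 (i0 + 1) x) /\
  f i0 x - g i0 p.1 =
    cdiff X (i0 - 1) i0 p.2 + h (i0 + 1) i0 (cdiff Q i0 (i0 + 1) x).
have linR : linear_rel R.
  move=> a x [z w] x' [z' w'] [/= e1 e2] [/= e1' e2']; split=> /=.
    by rewrite !linearP e1 e1'.
  rewrite !linearP addrACA -scalerDr e2 e2' scalerDr.
  by rewrite addrACA.
have totR x : exists p, R x p.
  have [L1 L2] := L _ (lexx _) (cdiff Q i0 (i0 + 1) x).
  rewrite !cdiff_sq !linear0 addr0 in L1 L2.
  have [gi gs] := gq (i0 + 1).
  have /coboundary_succ[z1 ez1] : coboundary (phi (i0 + 1) (cdiff Q i0 (i0 + 1) x)).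
    apply: gi => //; rewrite -[g _ _](subKr (f (i0 + 1) (cdiff Q i0 (i0 + 1) x))).
    apply: coboundaryB; last by rewrite L2; apply: coboundary_diff.
    by rewrite cfun_comm; apply: coboundary_diff.
  set y := f i0 x - g i0 z1 - h (i0 + 1) i0 (cdiff Q i0 (i0 + 1) x).
  have cy : cocycle y.
    rewrite /cocycle /y !linearB -!cfun_comm -ez1 L2.
    by rewrite [in X in X - _]addrK subrr.
  have [z2 cz2 [w ew]] := (gq i0).2 y cy.
  (* z1 bounds the required cocycle, and z2 corrects f x - g z1 up to the
  boundary of w. *)
  exists (z1 + z2, - w); split=> /=; first by rewrite linearD cz2 addr0.
  by rewrite linearN -ew opprB linearD /y [RHS]addrAC subrK opprD addrA.
have [psi psiP] := Qproj linR totR.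
pose new1 : {linear Q i0 -> Z i0} := fst \o psi.
pose new2 : {linear Q i0 -> X (i0 - 1)} := snd \o psi.
exists (update new1 phi), (update2 new2 h) => i.
rewrite le_eqVlt => /orP[/eqP<-|lt] x.
  have ne : i0 != i0 + 1 by lia.
  rewrite update_id (update_neq _ _ ne) update2_id (update2_neq _ _ _ ne).
  exact: psiP.
have ne : i0 != i by lia.
have ne' : i0 != i + 1 by lia.
rewrite !(update_neq _ _ ne) !(update_neq _ _ ne') !(update2_neq _ _ _ ne).
rewrite !(update2_neq _ _ _ ne').
by apply: L; lia.
Qed.

Lemma lift_cmap : exists phi : cmap Q Z, homotopic f (cmap_comp g phi).
Proof.
have [m mP] := cbounded Q.
have [phi [h L]] : exists phi h, lift_from (- m.+1%:Z) phi h.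
  have : forall l : nat, exists phi h, lift_from (m.+1%:Z - l%:Z) phi h.
    elim=> [|l [phi [h IH]]]; last first.
      by apply: (lift_step (phi := phi) (h := h)); rewrite (_ : _ + 1 = m.+1%:Z - l%:Z) //;
        lia.
    exists (fun i => \0), (fun i j => \0) => i le x.
    have -> : x = 0 by apply: mP; lia.
    by rewrite !linear0 !addr0.
  by move=> /(_ m.+1.*2); rewrite (_ : _ - _ = - m.+1%:Z) //; lia.
have Q0 i : ~~ (- m.+1%:Z <= i) -> trivial_module (Q i).
  by move=> lt; apply: mP; lia.
have comm i j x : phi j (cdiff Q i j x) = cdiff Z i j (phi i x).
  have [le|/Q0 tQ] := boolP (- m.+1%:Z <= i); last by rewrite (tQ x) !linear0.
  have [->|ne] := eqVneq j (i + 1); first by have [-> _] := L i le x.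
  by rewrite !cdiff_shape // linear0.
exists (CMap comm), h => i x /=.
have [le|/Q0 tQ] := boolP (- m.+1%:Z <= i); first by have [] := L i le x.
by rewrite (tQ x) !linear0 !addr0.
Qed.
End Lifting.

(** * Morphisms between stalk complexes in the derived category *)

Section Roofs.
Variable A : pzRingType.

Lemma roof_eq_sym (X Y : complex A) (p q : roof X Y) : roof_eq p q -> roof_eq q p.
Proof.
case=> W [s [t [qs h1 h2]]]; exists W, t, s; split.
- exact: quasi_iso_homotopic h1 qs.
- exact: homotopic_sym.
- exact: homotopic_sym.
Qed.

Lemma roof_eq_refl (X Y : complex A) (p : roof X Y) : roof_eq p p.
Proof.
exists (apex p), (cmap_id _), (cmap_id _); split; try exact: homotopic_pointwise.
by apply: quasi_iso_comp; [apply: den_qis | apply: quasi_iso_id].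
Qed.

Lemma roof_eq_pointwise (X Y : complex A) (f g : cmap X Y) :
  (forall i x, f i x = g i x) -> roof_eq (roof_of_cmap f) (roof_of_cmap g).
Proof.
move=> e; exists X, (cmap_id _), (cmap_id _); split; try exact: homotopic_pointwise.
by apply: quasi_iso_comp; apply: quasi_iso_id.
Qed.

Lemma roof_comp_cmap (X Y Z : complex A) (g : cmap Y Z) (f : cmap X Y)
    (h : cmap X Z) :
  (forall i x, h i x = g i (f i x)) ->
  roof_comp (roof_of_cmap g) (roof_of_cmap f) (roof_of_cmap h).
Proof.
move=> e; exists X, (cmap_id X), (quasi_iso_id X), f; split.
  exact: homotopic_pointwise.
exists X, (cmap_id _), (cmap_id _); split; try exact: homotopic_pointwise.
by apply: quasi_iso_comp; apply: quasi_iso_id.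
Qed.

Lemma roof_add_cmap (X Y : complex A) (f g h : cmap X Y) :
  (forall i x, h i x = f i x + g i x) ->
  roof_add (roof_of_cmap f) (roof_of_cmap g) (roof_of_cmap h).
Proof.
move=> e; exists X, (cmap_id X), (quasi_iso_id X), f, g, h.
by split=> //; apply: roof_eq_refl.
Qed.

Lemma roof_scale_cmap (X Y : complex A) (a : A) (f h : cmap X Y) :
  (forall i x, h i x = a *: f i x) ->
  roof_scale a (roof_of_cmap f) (roof_of_cmap h).
Proof.
move=> e; exists X, (cmap_id X), (quasi_iso_id X), f, h.
by split=> //; apply: roof_eq_refl.
Qed.

Lemma linear_factor (U V W : lmodType A) (q : {linear U -> V}) (c : {linear U -> W}) :
  (forall y, exists x, q x = y) -> (forall x, q x = 0 -> c x = 0) ->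
  exists f : {linear V -> W}, forall x, f (q x) = c x.
Proof.
move=> qs qc; have [r rK] := choice qs.
have cr x y : q x = y -> c (r y) = c x.
  move=> e; apply/eqP; rewrite -subr_eq0 -linearB; apply/eqP/qc.
  by rewrite linearB rK e subrr.
have lin : linear (c \o r).
  by move=> a x y /=; rewrite (cr (a *: r x + r y)) ?linearP // !rK.
by exists (mk_linear lin) => x /=; apply: cr.
Qed.

(** Homotopic maps into a stalk complex agree on cocycles, and every element of
M lifts to a cocycle of the common denominator. *)
Lemma stalk_map_faithful (M N : fgModule A) (f g : {linear M -> N}) :
  roof_eq (roof_of_cmap (stalk_map f)) (roof_of_cmap (stalk_map g)) ->
  forall x, f x = g x.
Proof.
case=> W [s [t [qs h1 h2]]] x /=.
have [w cw [y ey]] := (qs 0).2 (x : stalk M 0) erefl.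
have ew : s 0 w = x by move: ey; rewrite /= => /eqP; rewrite subr_eq0 => /eqP.
have [y1] := homotopic_cocycle h1 cw.
rewrite /= => /eqP; rewrite subr_eq0 => /eqP et.
have [y2] := homotopic_cocycle h2 cw.
by rewrite /= => /eqP; rewrite subr_eq0 -et ew => /eqP.
Qed.

Section Resolution.
Variables (T : fgModule A) (Q : complex A) (q : cmap Q (stalk T)).
Hypotheses (Qproj : forall i, rel_projective (Q i)) (qq : quasi_iso q)
  (Q1 : trivial_module (Q 1)).

(** Two fractions that start at T are equal when they agree, up to homotopy, on
the resolution. *)
Lemma roof_eq_lift Y (p : roof (stalk T) Y) (phi : cmap Q (apex p))
    (c : cmap (stalk T) Y) :
  homotopic q (cmap_comp (den p) phi) ->
  homotopic (cmap_comp (num p) phi) (cmap_comp c q) ->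
  roof_eq p (roof_of_cmap c).
Proof.
move=> h1 h2; exists Q, phi, q; split => //.
  exact: quasi_iso_homotopic h1 qq.
by apply: homotopic_sym; case: h1 => s sE; exists s.
Qed.

(** On the resolution, the fraction becomes a map from Q 0 that kills the
boundaries, so it factors through T. *)
Lemma stalk_roof_full (U : fgModule A) (p : roof (stalk T) (stalk U)) :
  exists f : {linear T -> U}, forall g : {linear T -> U}, (forall x, g x = f x) ->
    roof_eq (roof_of_cmap (stalk_map g)) p.
Proof.
have [phi h] := lift_cmap q Qproj (den_qis p).
have [||f fE] := @linear_factor (Q 0) T U (q 0) (num p 0 \o phi 0).
- move=> y; have [x cx [z]] := (qq 0).2 (y : stalk T 0) erefl.
  by move/eqP; rewrite subr_eq0 => /eqP e; exists x.
- move=> x /= e; have c0 : cocycle x by apply: Q1.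
  have [|y ->] := (qq 0).1 x c0; first by exists 0; rewrite linear0.
  by rewrite !cfun_comm.
exists f => f' f'E; apply: roof_eq_sym; apply: roof_eq_lift h _.
apply: homotopic_pointwise => i x.
have [i0|ne] := eqVneq i 0; last by rewrite [LHS]stalk_neq0 // [RHS]stalk_neq0.
by move: x; rewrite i0 => x; rewrite /= -[LHS]/((num p 0 \o phi 0) x) -fE.
Qed.

(** The hypothesis says that Hom(Q, T) has no cohomology in nonzero degrees; an
extension of the only nonzero component along the differential is the
null-homotopy. *)
Lemma stalk_ext_vanish :
  (forall m, m != 0 -> forall c : {linear Q m -> T},
     (forall j x, c (cdiff Q j m x) = 0) ->
     exists g : {linear Q (m + 1) -> T}, forall x, c x = g (cdiff Q m (m + 1) x)) ->
  forall n : int, n != 0 -> forall p : roof (stalk T) (shift n (stalk T)),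
    roof_eq p (roof_of_cmap (cmap_zero _ _)).
Proof.
move=> H n n0 p; have [phi h] := lift_cmap q Qproj (den_qis p).
apply: roof_eq_lift h _; pose c := cmap_comp (num p) phi.
have mn : - n + n = 0 by rewrite addNr.
have [||g gE] := H (- n) _ (stalk_out T (- n + n) \o c (- n)).
- by rewrite oppr_eq0.
- by move=> j x; rewrite /= !cfun_comm /= scaler0 linear0.
exists (fun i j => stalk_in T (j + n) \o g \o transport_lin Q i (- n + 1)) => i x.
rewrite /= subr0 scaler0 add0r.
have [e|ne] := eqVneq i (- n); last first.
  have ne' : i + n != 0 by rewrite addr_eq0.
  by rewrite [LHS]stalk_neq0 // [RHS]stalk_neq0.
move: x; rewrite e => x; rewrite transport_id -gE /=.
by rewrite stalk_outK.
Qed.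

End Resolution.
End Roofs.

(** Reduces endomorphisms in the derived category to endomorphisms of the
module T, as soon as T has a bounded projective resolution. *)
Lemma endomorphism_algebra_isoI (k : fieldType)
    (V : finType) (adj : rel V) (rels : pathalg k adj -> Prop)
    (V' : finType) (adj' : rel V') (rels' : pathalg k adj' -> Prop)
    (T : fgModule (bqa rels)) (F : bqa rels' -> {linear T -> T})
    (Q : complex (bqa rels)) (q : cmap Q (stalk T)) :
  (forall i, rel_projective (Q i)) -> quasi_iso q -> trivial_module (Q 1) ->
  (forall x, F 1 x = x) ->
  (forall b c x, F (b * c) x = F b (F c x)) ->
  (forall b c x, F (b + c) x = F b x + F c x) ->
  (forall (l : k) b x, F (l *: b) x = (l *: (1 : bqa rels)) *: F b x) ->
  (forall b c, (forall x, F b x = F c x) -> b = c) ->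
  (forall f : {linear T -> T}, exists b, forall x, F b x = f x) ->
  endomorphism_algebra_iso (stalk T) rels'.
Proof.
move=> Qp qq Q1 F1 FM FD FZ Fi Fs.
exists (fun b => roof_of_cmap (stalk_map (F b))); split; last split.
- split.
  + by apply: roof_eq_pointwise => i x; rewrite stalk_mapE F1 stalk_outK.
  + move=> b c; apply: roof_comp_cmap => i x; rewrite !stalk_mapE stalk_inK FM.
    by case: eqP => // /eqP ne; rewrite [LHS]stalk_neq0 // [RHS]stalk_neq0.
  + by move=> b c; apply: roof_add_cmap => i x; rewrite !stalk_mapE FD linearD.
  + by move=> l b; apply: roof_scale_cmap => i x; rewrite !stalk_mapE FZ linearZ.
- by move=> b c /stalk_map_faithful/Fi.
move=> p; have [f fE] := stalk_roof_full Qp qq Q1 p.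
by have [b bE] := Fs f; exists b; apply: fE.
Qed.

(** * Kernels and direct sums *)

Section Kernel.
Variables (A : pzRingType) (M N : lmodType A) (g : {linear M -> N}).

Definition in_ker : {pred M} := fun x => g x == 0.

Lemma in_ker_closed : submod_closed in_ker.
Proof.
split=> [|a x y]; rewrite !unfold_in ?linear0 //.
by move=> /eqP ex /eqP ey; rewrite linearP ex ey scaler0 addr0.
Qed.
HB.instance Definition _ := GRing.isSubmodClosed.Build A M in_ker in_ker_closed.

Record kermod := KerMod { ker_val : M; ker_valP : ker_val \in in_ker }.
HB.instance Definition _ := [isSub for ker_val].
HB.instance Definition _ := [Choice of kermod by <:].
HB.instance Definition _ := [SubChoice_isSubLmodule of kermod by <:].

Lemma kermodP (x : M) : g x = 0 -> exists y : kermod, val y = x.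
Proof. by move=> /eqP e; exists (KerMod e). Qed.

Lemma kermod0 (y : kermod) : g (val y) = 0.
Proof. exact/eqP/(valP y). Qed.

Lemma ker_incl_linear : linear (val : kermod -> M).
Proof. by move=> a x y; rewrite !linearP. Qed.
Definition ker_incl : {linear kermod -> M} := mk_linear ker_incl_linear.
End Kernel.

Section DirectSums.
Variable A : pzRingType.

Section Maps.
Variables (I : finType) (M : I -> fgModule A).

Lemma dproj_linear i : linear (fun x : fg_dsum M => x i).
Proof. by move=> a x y; rewrite !ffunE. Qed.
Definition dproj i : {linear fg_dsum M -> M i} := mk_linear (@dproj_linear i).

Lemma dinj_linear i : linear (fun x : M i => dsum_inj x : fg_dsum M).
Proof. by move=> a x y; apply/ffunP => j; rewrite !ffunE transport_linear. Qed.
Definition dinj i : {linear M i -> fg_dsum M} := mk_linear (@dinj_linear i).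

Lemma dprojP (x y : fg_dsum M) : (forall i, dproj i x = dproj i y) -> x = y.
Proof. by move=> e; apply/ffunP => i; apply: e. Qed.

Lemma dprojK i x : dproj i (dinj i x) = x.
Proof. exact: dsum_injE. Qed.

Lemma dproj_neq i j x : i != j -> dproj j (dinj i x) = 0.
Proof. exact: dsum_inj_neq. Qed.

Lemma dproj_sum_inj (y : forall i, M i) j : dproj j (\sum_i dinj i (y i)) = y j.
Proof.
rewrite linear_sum (bigD1 j) // dprojK big1 => [|i ne].
  exact: addr0.
exact: dproj_neq.
Qed.

Lemma dsumE (x : fg_dsum M) : x = \sum_i dinj i (dproj i x).
Proof. by apply: dprojP => i; rewrite dproj_sum_inj. Qed.

Section IntoOut.
Variable N : lmodType A.

Lemma into_dsum_linear (f : forall i, {linear N -> M i}) :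
  linear (fun x => finfun (fun i => f i x) : fg_dsum M).
Proof. by move=> a x y; apply/ffunP => i; rewrite !ffunE linearP. Qed.
Definition into_dsum (f : forall i, {linear N -> M i}) : {linear N -> fg_dsum M} :=
  mk_linear (into_dsum_linear f).

Lemma dproj_into f i x : dproj i (into_dsum f x) = f i x.
Proof. by rewrite /= ffunE. Qed.
End IntoOut.
End Maps.

Section MapDsum.
Variables (I : finType) (M N : I -> fgModule A) (f : forall i, {linear M i -> N i}).
Definition dsum_map : {linear fg_dsum M -> fg_dsum N} :=
  into_dsum (fun i => f i \o dproj M i : {linear _ -> _}).
Lemma dproj_map i x : dproj N i (dsum_map x) = f i (dproj M i x).
Proof. exact: dproj_into. Qed.
End MapDsum.

(** Choose sections on the summands and add them. *)
Lemma rel_projective_dsum (I : finType) (M : I -> fgModule A) :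
  (forall i, rel_projective (M i)) -> rel_projective (fg_dsum M).
Proof.
move=> H Z R linR totR.
have R0 : R 0 0.
  by have [z Rz] := totR 0; have := linR (-1) _ _ _ _ Rz Rz; rewrite !scaleN1r !addNr.
have RD x y x' y' : R x y -> R x' y' -> R (x + x') (y + y').
  by move=> h h'; have := linR 1 _ _ _ _ h h'; rewrite !scale1r.
have phiP i : {phi : {linear M i -> Z} | forall x, R (dinj M i x) (phi x)}.
  apply: cid; apply: (H i Z (fun x z => R (dinj M i x) z)) => [a x y x' y' h h'|x];
    last exact: totR.
  by rewrite linearP; apply: linR.
have lin : linear (fun x : fg_dsum M => \sum_i sval (phiP i) (dproj M i x)).
  move=> a x y; rewrite scaler_sumr -big_split; apply: eq_bigr => i _.
  by rewrite !linearP.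
exists (mk_linear lin) => x /=; rewrite {1}[x]dsumE.
by elim/big_rec2: _ => // i y1 y2 _ h; apply: RD => //; apply: (svalP (phiP i)).
Qed.

Section Rest.
Variables (I : finType) (M : I -> fgModule A) (i0 : I).
Let I' := {i : I | i != i0}.
Definition rest_dsum : fgModule A := fg_dsum (fun t : I' => M (val t)).
Definition to_rest : {linear fg_dsum M -> rest_dsum} :=
  into_dsum (fun t : I' => dproj M (val t)).

Lemma rest_ex (y : rest_dsum) : exists x : fg_dsum M, dproj M i0 x = 0 /\ to_rest x = y.
Proof.
exists (\sum_(t : I') dinj M (val t) (dproj _ t y)); split.
  by rewrite linear_sum big1 // => t _; apply: dproj_neq; apply: (valP t).
apply: dprojP => t; rewrite dproj_into linear_sum (bigD1 t) // dprojK big1 => [|t' ne].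
  exact: addr0.
by apply: dproj_neq; rewrite val_eqE.
Qed.

Lemma to_rest0 x : to_rest x = 0 -> dproj M i0 x = 0 -> x = 0.
Proof.
move=> e1 e2; apply: dprojP => i; have [->|ne] := eqVneq i i0; first by rewrite e2 linear0.
have := congr1 (dproj _ (Sub i ne : I')) e1.
by rewrite dproj_into /= => ->; rewrite !ffunE.
Qed.
End Rest.

Section ThickSums.
Variable P : complex A -> Prop.
Hypothesis thP : thick_subcategory P.

(** The hypotheses say that f and g together identify L with the product of M
and N. *)
Lemma thick_stalk_pair (L M N : fgModule A) (f : {linear L -> M}) (g : {linear L -> N}) :
  (forall x, f x = 0 -> g x = 0 -> x = 0) ->
  (forall y z, exists x, f x = y /\ g x = z) ->
  P (stalk L) -> P (stalk M).
Proof.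
move=> inj surj PL; case: thP => Pi _ _ Ps.
apply: (Ps _ (stalk N)).
have lin i : linear (fun x : stalk L i =>
    (stalk_map f i x, stalk_map g i x) : csum (stalk M) (stalk N) i).
  by move=> a x y; apply: injective_projections; rewrite /= !linearP.
have comm i j (x : stalk L i) : mk_linear (@lin j) (cdiff (stalk L) i j x) =
    cdiff (csum (stalk M) (stalk N)) i j (mk_linear (@lin i) x).
  by apply: injective_projections; rewrite /= !linear0.
apply/(thick_qis thP (f := CMap comm)) => //; apply: quasi_iso_bij => i.
  move=> x /= [e1 e2]; apply: stalk_out_inj.
  have [i0|ne] := boolP (i == 0); last by rewrite (stalk_neq0 x) ?linear0.
  apply: inj.
    by move/(congr1 (stalk_out M i)): e1; rewrite stalk_inK i0 linear0.
  by move/(congr1 (stalk_out N i)): e2; rewrite stalk_inK i0 linear0.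
move=> [y z]; have [x [ey ez]] := surj (stalk_out M i y) (stalk_out N i z).
exists (stalk_in L i x); apply: injective_projections => /=;
  rewrite stalk_inK; case: ifP => [_|/negbT ne].
- by rewrite ey stalk_outK.
- by rewrite [LHS]stalk_neq0 // [RHS]stalk_neq0.
- by rewrite ez stalk_outK.
- by rewrite [LHS]stalk_neq0 // [RHS]stalk_neq0.
Qed.

Lemma thick_stalk_summand (I : finType) (M : I -> fgModule A) i :
  P (stalk (fg_dsum M)) -> P (stalk (M i)).
Proof.
apply: (thick_stalk_pair (f := dproj M i) (g := to_rest M i)).
  by move=> x e1 e2; apply: to_rest0 e2 e1.
move=> y z; have [x [ex1 ex2]] := rest_ex z.
exists (dinj M i y + x); split; first by rewrite linearD dprojK ex1 addr0.
rewrite linearD ex2 -[RHS]add0r; congr (_ + _); apply: dprojP => t.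
by rewrite dproj_into linear0; apply: dproj_neq; rewrite eq_sym (valP t).
Qed.

Lemma thick_iso (M N : fgModule A) (f : {linear M -> N}) :
  bijective f -> P (stalk M) <-> P (stalk N).
Proof. by move/stalk_map_bij_qis/(thick_qis thP). Qed.

Lemma thick_stalk_trivial X (M : fgModule A) : P X -> trivial_module M -> P (stalk M).
Proof.
move=> PX tM; apply: (thick_trivial thP PX) => i x; apply: stalk_out_inj.
exact: tM.
Qed.

(** Induction on the number of summands, splitting off one of them. X only
provides some object of the subcategory, for the empty sum. *)
Lemma thick_dsum X (I : finType) (M : I -> fgModule A) :
  P X -> (forall i, P (stalk (M i))) -> P (stalk (fg_dsum M)).
Proof.
move=> PX; move e: #|I| => m; elim: m I e M => [|m IH] I cI M PM.
  apply: (thick_stalk_trivial PX) => x; apply: dprojP => i.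
  by have := fintype0 i; rewrite cI.
have /card_gt0P[i0 _] : (0 < #|I|)%N by rewrite cI.
have Prest : P (stalk (rest_dsum M i0)).
  by apply: IH => [|t] //; rewrite card_sig -[m]/(m.+1.-1) -cI -(cardC1 i0); apply: eq_card.
have [r rP] := choice (@rest_ex I M i0).
have rlin : linear r.
  move=> a x y; apply/eqP; rewrite -subr_eq0; apply/eqP.
  have [ex1 ex2] := rP x; have [ey1 ey2] := rP y.
  have [e1 e2] := rP (a *: x + y); apply: (@to_rest0 _ _ i0).
    by rewrite linearB e2 linearP ex2 ey2 subrr.
  by rewrite linearB e1 linearP ex1 ey1 scaler0 addr0 subrr.
apply: (thick_ses_mid thP (f := stalk_map (mk_linear rlin)) (g :=
  stalk_map (dproj M i0))) => //.
apply: stalk_ses => /=.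
- by move=> x y e; have [_ <-] := rP x; have [_ <-] := rP y; rewrite e.
- by move=> z; exists (dinj M i0 z); apply: dprojK.
- by move=> x; have [] := rP x.
move=> y e; exists (to_rest M i0 y); apply/eqP; rewrite -subr_eq0; apply/eqP.
have [e1 e2] := rP (to_rest M i0 y).
by apply: (@to_rest0 _ _ i0); rewrite linearB ?e1 ?e2 ?subrr ?subr0.
Qed.
End ThickSums.
End DirectSums.

(** * Coefficients in a bound quiver algebra *)

Section PathMatrix.
Variables (k : fieldType) (V : finType) (adj : rel V).
Local Notation kQ := (pathalg k adj).

(** The entry at (z, w) of a matrix attached to f, such that products go to
products of matrices. *)
Definition path_coef (f : kQ) (z w : V) : k :=
  \sum_(p <- msupp f) f@_p *+ ((qend p == z) && (qstart p == w)).

Lemma path_coef_wide (d : {fset qpath adj}) (f : kQ) z w : (msupp f `<=` d)%fset ->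
  path_coef f z w = \sum_(p <- d) f@_p *+ ((qend p == z) && (qstart p == w)).
Proof.
move=> le; rewrite /path_coef (big_fset_incl _ le) //= => p _ /mcoeff_outdom ->.
by rewrite mul0rn.
Qed.

Lemma path_coefU p z w : path_coef << p >> z w = ((qend p == z) && (qstart p == w))%:R.
Proof. by rewrite (path_coef_wide _ _ msuppU_le) big_seq_fset1 mcoeffUU. Qed.

Lemma path_coefD f g z w : path_coef (f + g) z w = path_coef f z w + path_coef g z w.
Proof.
pose d := (msupp f `|` msupp g)%fset.
rewrite (@path_coef_wide d (f + g)) ?msuppD_le // (@path_coef_wide d f) ?fsubsetUl //.
rewrite (@path_coef_wide d g) ?fsubsetUr // -big_split; apply: eq_bigr => p _.
by rewrite mcoeffD mulrnDl.
Qed.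

Lemma path_coef0 z w : path_coef 0 z w = 0.
Proof. by rewrite /path_coef msupp0 big_seq_fset0. Qed.

Lemma path_coefZ c f z w : path_coef (c *: f) z w = c * path_coef f z w.
Proof.
rewrite (path_coef_wide _ _ (msuppZ_le _ _)) mulr_sumr; apply: eq_bigr => p _.
by rewrite mcoeffZ mulrnAr.
Qed.

Lemma path_coefB f g z w : path_coef (f - g) z w = path_coef f z w - path_coef g z w.
Proof. by rewrite path_coefD -scaleN1r path_coefZ mulN1r. Qed.

Lemma path_coef_sum (I : Type) (s : seq I) (F : I -> kQ) z w :
  path_coef (\sum_(i <- s) F i) z w = \sum_(i <- s) path_coef (F i) z w.
Proof. by apply: (big_morph (fun f => path_coef f z w)) => [? ?|];
  rewrite ?path_coefD ?path_coef0. Qed.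

Lemma path_coefM f g z w : path_coef (f * g) z w = \sum_y path_coef f z y * path_coef g y w.
Proof.
rewrite -[f * g]/(pa_mul f g).
elim/pathalg_ind: f => [|f f' Hf Hf'|c f Hf|q].
- by rewrite pa_mul0l path_coef0 big1 // => y _; rewrite path_coef0 mul0r.
- rewrite pa_mulDl [LHS]path_coefD;
  transitivity (\sum_y (path_coef f z y * path_coef g y w + path_coef f' z y * path_coef g
    y w)).
    by rewrite big_split; exact: f_equal2 Hf Hf'.
  by apply: eq_bigr => y _; rewrite path_coefD mulrDl.
- rewrite pa_mulZl [LHS]path_coefZ;
  transitivity (c * \sum_y path_coef f z y * path_coef g y w).
    exact: congr1 Hf.
  by rewrite mulr_sumr; apply: eq_bigr => y _; rewrite path_coefZ mulrA.
elim/pathalg_ind: g => [|f f' Hf Hf'|c f Hf|p].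
- by rewrite pa_mul0r path_coef0 big1 // => y _; rewrite path_coef0 mulr0.
- rewrite pa_mulDr [LHS]path_coefD.
  transitivity (\sum_y (path_coef << q >> z y * path_coef f y w + path_coef << q >> z y *
    path_coef f' y w)).
    by rewrite big_split; exact: f_equal2 Hf Hf'.
  by apply: eq_bigr => y _; rewrite path_coefD mulrDr.
- rewrite pa_mulZr [LHS]path_coefZ;
  transitivity (c * \sum_y path_coef << q >> z y * path_coef f y w).
    exact: congr1 Hf.
  by rewrite mulr_sumr; apply: eq_bigr => y _; rewrite path_coefZ mulrCA.
(* The two basis elements are generalized before any rewriting, because
comparing them unfolds the path algebra. *)
rewrite pa_mulUU; have Uqp := path_coefU (qcomp q p) z w.
have : path_coef (path_mul k q p) z w = ((qend p == qstart q) && (qend q == z)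
    && (qstart p == w))%:R.
  rewrite /path_mul; case: eqP => [e|_]; last exact: path_coef0.
  by rewrite Uqp qend_comp // qstart_comp.
move: (path_mul k q p) (mkmalgU q (1 : k)) (mkmalgU p (1 :
  k)) (path_coefU q) (path_coefU p).
move=> h fq fp Uq Up ->; rewrite (bigD1 (qstart q)) //= big1 => [|y ne].
  by rewrite addr0 Uq Up eqxx andbT -natrM mulnb andbCA andbA.
by rewrite Uq [_ == y]eq_sym (negPf ne) andbF mul0r.
Qed.

Lemma path_coef1 z w : path_coef 1 z w = (z == w)%:R.
Proof.
rewrite -[1]/(pa_one k adj) /pa_one path_coef_sum (bigD1 z) //= big1 => [|y ne].
  by rewrite addr0 path_coefU /qend /= eqxx.
by rewrite path_coefU /qend /= (negPf ne).
Qed.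

Lemma connect_qpath z w :
  reflect (exists p : qpath adj, qstart p = w /\ qend p = z) (connect adj w z).
Proof.
apply: (iffP connectP) => [[s sP e]|[[[x s] sP] [/= <- <-]]]; last by exists s.
by exists (exist (fun s => path adj s.1 s.2) (w, s) sP).
Qed.

Lemma path_coef_connect f z w : ~~ connect adj w z -> path_coef f z w = 0.
Proof.
move=> nc; rewrite /path_coef big1 // => p _; case: andP => // -[/eqP e1 /eqP e2].
by case/connect_qpath: nc; exists p.
Qed.

End PathMatrix.

Section Coefficients.
Variables (k : fieldType) (V : finType) (adj : rel V).
Variables (rels : pathalg k adj -> Prop) (good : rel V).
Local Notation B := (bqa rels).
Local Notation bpi := (bqa_pi rels).

(** The relations vanish on the entries selected by good. These are closed under
factorization of paths, so that they multiply like matrices. *)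
Hypothesis goodP : forall z y w, connect adj w y -> connect adj y z ->
  good z w -> good z y && good y w.
Hypothesis rels0 : forall g z w, rels g -> good z w -> path_coef g z w = 0.

(** Setting the other entries to 0 makes the value independent of the
representative of a. *)
Definition bqa_coef (a : B) z w : k := if good z w then path_coef (repr a) z w else 0.

(** The elements whose good entries vanish form an ideal that contains the
relations. *)
Lemma path_coef_ideal f z w : f \in ideal_gen rels -> good z w -> path_coef f z w = 0.
Proof.
move/ideal_genP=> /(_ (fun f => forall z w, good z w -> path_coef f z w = 0)) H gzw.
apply: H => // {f z w gzw}; last by move=> g rg z w; apply: rels0.
split=> [z w _|f g Hf Hg z w gzw|f g Hg]; first exact: path_coef0.
  by rewrite path_coefB Hf // Hg // subrr.
split=> z w gzw; rewrite path_coefM big1 // => y _.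
  have [c1|/(path_coef_connect f) ->] := boolP (connect adj y z); last by rewrite mul0r.
  have [c2|/(path_coef_connect g) ->] := boolP (connect adj w y); last by rewrite mulr0.
  by have /andP[_ g2] := goodP c2 c1 gzw; rewrite Hg ?mulr0.
have [c1|/(path_coef_connect g) ->] := boolP (connect adj y z); last by rewrite mul0r.
have [c2|/(path_coef_connect f) ->] := boolP (connect adj w y); last by rewrite mulr0.
by have /andP[g1 _] := goodP c2 c1 gzw; rewrite Hg ?mul0r.
Qed.

Lemma bqa_coef_pi f z w : bqa_coef (bpi f) z w = if good z w then path_coef f z w else 0.
Proof.
rewrite /bqa_coef; case: ifP => // gzw; apply/eqP; rewrite -subr_eq0 -path_coefB.
by apply/eqP/path_coef_ideal => //; apply/bqa_piP; rewrite bqa_repr.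
Qed.

Lemma bqa_coefD a b z w : bqa_coef (a + b) z w = bqa_coef a z w + bqa_coef b z w.
Proof.
rewrite -[a]bqa_repr -[b]bqa_repr -raddfD !bqa_coef_pi path_coefD.
by case: ifP; rewrite ?addr0.
Qed.

Lemma bqa_coefZ c a z w : bqa_coef (c *: a) z w = c * bqa_coef a z w.
Proof.
rewrite -[c *: a]/(bqa_scale c a) -[a]bqa_repr bqa_piZ !bqa_coef_pi path_coefZ.
by case: ifP; rewrite ?mulr0.
Qed.

Lemma bqa_coef1 z w : good z w -> bqa_coef 1 z w = (z == w)%:R.
Proof. by move=> gzw; rewrite -[1]/(bpi 1) bqa_coef_pi gzw path_coef1. Qed.

Lemma bqa_coef_connect a z w : ~~ connect adj w z -> bqa_coef a z w = 0.
Proof. by move=> nc; rewrite /bqa_coef path_coef_connect ?if_same. Qed.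

Lemma bqa_coefM a b z w : good z w ->
  bqa_coef (a * b) z w = \sum_y bqa_coef a z y * bqa_coef b y w.
Proof.
move=> gzw; rewrite -[a * b]/(bpi (repr a * repr b)) bqa_coef_pi gzw path_coefM.
apply: eq_bigr => y _.
have [c1|nc] := boolP (connect adj y z); last by rewrite path_coef_connect //
  bqa_coef_connect ?mul0r.
have [c2|nc] := boolP (connect adj w y); last first.
  by rewrite (path_coef_connect (repr b)) // (@bqa_coef_connect b) ?mulr0.
by have /andP[g1 g2] := goodP c2 c1 gzw; rewrite /bqa_coef g1 g2.
Qed.

Hypothesis uniq_path : forall p q : qpath adj, qstart p = qstart q ->
  qend p = qend q -> bpi << p >> = bpi << q >>.

(** The class of a path from w to z, all of which are equal here; 0 if there is
none. *)
Definition path_class z w : B :=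
  if pselect (exists p : qpath adj, qstart p = w /\ qend p = z) is left e
  then bpi << projT1 (cid e) >> else 0.

Lemma class_of_path p : bpi << p >> = path_class (qend p) (qstart p).
Proof.
rewrite /path_class; case: pselect => [e|[]]; last by exists p.
by case: cid => q [/= e1 e2]; apply: uniq_path.
Qed.

Lemma path_class_nconnect z w : ~~ connect adj w z -> path_class z w = 0.
Proof. by rewrite /path_class => nc; case: pselect => // e; case/negP: nc;
  exact/connect_qpath. Qed.

Lemma path_classM z y w : connect adj w y -> connect adj y z ->
  path_class z y * path_class y w = path_class z w.
Proof.
move=> /connect_qpath[p [ep1 ep2]] /connect_qpath[q [eq1 eq2]].
have e : qend p = qstart q by rewrite ep2 eq1.
subst w z y; rewrite -{1}eq1 -!class_of_path.
rewrite -[LHS]/(bqa_mul _ _) bqa_piM -[_ * _]/(pa_mul _ _) pa_mulUU.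
by rewrite /path_mul e eqxx class_of_path qend_comp // qstart_comp.
Qed.

Lemma path_class_neq z y y' w : y != y' -> path_class z y * path_class y' w = 0.
Proof.
move=> ne; have [c1|/path_class_nconnect->] := boolP (connect adj y z);
  last by rewrite mul0r.
have [c2|/path_class_nconnect->] := boolP (connect adj w y'); last by rewrite mulr0.
case/connect_qpath: c1 => q [eq1 eq2]; case/connect_qpath: c2 => p [ep1 ep2].
subst y z w y'; rewrite -!class_of_path.
rewrite -[LHS]/(bqa_mul _ _) bqa_piM -[_ * _]/(pa_mul _ _) pa_mulUU.
by rewrite /path_mul eq_sym (negPf ne) raddf0.
Qed.

Lemma bqa_piE f : bpi f = \sum_z \sum_w path_coef f z w *: path_class z w.
Proof.
elim/pathalg_ind: f => [|f g Hf Hg|c f Hf|p].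
- rewrite raddf0 big1 // => z _; rewrite big1 // => w _.
  by rewrite path_coef0 scale0r.
- rewrite raddfD /= Hf Hg -big_split; apply: eq_bigr => z _; rewrite -big_split.
  by apply: eq_bigr => w _; rewrite path_coefD scalerDl.
- rewrite -bqa_piZ -[bqa_scale _ _]/(c *: bpi f) Hf scaler_sumr.
  apply: eq_bigr => z _; rewrite scaler_sumr; apply: eq_bigr => w _.
  by rewrite path_coefZ scalerA.
rewrite class_of_path (bigD1 (qend p)) //= [X in _ + X]big1 => [|z ne]; last first.
  by rewrite big1 // => w _; rewrite path_coefU eq_sym (negPf ne) scale0r.
rewrite addr0 (bigD1 (qstart p)) //= big1 => [|w ne]; last first.
  by rewrite path_coefU [_ == w]eq_sym (negPf ne) andbF scale0r.
by rewrite addr0 path_coefU !eqxx scale1r.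
Qed.

(** The class of an element depends only on its good entries when the other
paths are zero. *)
Lemma bqaE a : (forall z w, ~~ good z w -> path_class z w = 0) ->
  a = \sum_z \sum_w bqa_coef a z w *: path_class z w.
Proof.
move=> ng; rewrite -[LHS]bqa_repr bqa_piE; apply: eq_bigr => z _.
apply: eq_bigr => w _; rewrite /bqa_coef; have [_|/ng ->] := boolP (good z w); first by [].
by rewrite !scaler0.
Qed.

Lemma path_class_id z : path_class z z = vertex_idem rels z.
Proof. by rewrite /vertex_idem class_of_path. Qed.

Lemma sum_path_class_id : \sum_z path_class z z = 1.
Proof.
rewrite -[1]/(bpi 1) -[1 in RHS]/(pa_one k adj) /pa_one raddf_sum.
by apply: eq_bigr => z _; apply: path_class_id.
Qed.

Lemma bqa_coef_class z' w' z w : good z' w' -> connect adj w z ->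
  bqa_coef (path_class z w) z' w' = ((z == z') && (w == w'))%:R.
Proof.
move=> g /connect_qpath[p [<- <-]].
by rewrite -class_of_path bqa_coef_pi g path_coefU.
Qed.

End Coefficients.

(** * The Nakayama algebra as an algebra of banded matrices *)

Section Band.
Variables (k : fieldType) (n r : nat).

Definition band_rel : rel 'I_n := fun z w => (w < z + r)%N.

(** The properties of the Nakayama algebra on which the theory of interval modules
rests: matrix units for the pairs z <= w < z + r, an entry function that is
multiplicative in the band, and scalars. The abstraction also keeps quotients of
path algebras from being unfolded in that theory. *)
Record band_algebra := BandAlgebra {
  band_ring :> pzRingType;
  band_coef : band_ring -> 'I_n -> 'I_n -> k;
  band_unit : 'I_n -> 'I_n -> band_ring;
  band_scal : k -> band_ring;
  band_coefD : forall a b z w, band_coef (a + b) z w = band_coef a z w + band_coef b z w;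
  band_coefM : forall a b z w, band_rel z w ->
    band_coef (a * b) z w = \sum_y band_coef a z y * band_coef b y w;
  band_coef1 : forall z w, band_rel z w -> band_coef 1 z w = (z == w)%:R;
  band_coef_scal : forall c z w, band_rel z w ->
    band_coef (band_scal c) z w = c * (z == w)%:R;
  band_coef_gt : forall a (z w : 'I_n), (w < z)%N -> band_coef a z w = 0;
  band_coef_unit : forall z' w' z w : 'I_n, band_rel z' w' -> (z <= w)%N ->
    band_coef (band_unit z w) z' w' = ((z == z') && (w == w'))%:R;
  band_unitM : forall z y w : 'I_n, (y <= w)%N -> (z <= y)%N ->
    band_unit z y * band_unit y w = band_unit z w;
  band_unit_gt : forall z w : 'I_n, (w < z)%N -> band_unit z w = 0;
  band_unit_neq : forall z y y' w, y != y' -> band_unit z y * band_unit y' w = 0;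
  band_unit_far : forall z w, ~~ band_rel z w -> band_unit z w = 0;
  band_sum_unit : \sum_z band_unit z z = 1;
  band_scalD : forall c d, band_scal (c + d) = band_scal c + band_scal d;
  band_scalM : forall c d, band_scal c * band_scal d = band_scal (c * d);
  band_scal1 : band_scal 1 = 1;
  band_scal_comm : forall c a, a * band_scal c = band_scal c * a;
  bandE : forall a, a = \sum_z \sum_w band_scal (band_coef a z w) * band_unit z w
}.
End Band.

Section NakayamaPaths.
Variable n : nat.

Lemma nak_path_size (w : 'I_n) s : path (@nakayama_adj n) w s ->
  (last w s + size s = w)%N.
Proof.
elim: s w => [|y s IH] w /=; first by rewrite addn0.
by case/andP=> /eqP e /IH h; rewrite addnS h e.
Qed.

Lemma nak_path_inj (w : 'I_n) s s' :
  path (@nakayama_adj n) w s -> path (@nakayama_adj n) w s' ->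
  size s = size s' -> s = s'.
Proof.
elim: s s' w => [|y s IH] [|y' s'] w //= /andP[/eqP e ps] /andP[/eqP e' ps'] [es].
have ey : y = y' by apply: val_inj => /=; lia.
by subst y'; rewrite (IH s' y).
Qed.

Lemma nak_connect (w z : 'I_n) : connect (@nakayama_adj n) w z = (z <= w)%N.
Proof.
apply/connectP/idP => [[s /nak_path_size h e]|].
  by rewrite e -h leq_addr.
move=> le; have [m] := ubnP (w - z); elim: m w le => // m IH w le lt.
have [e|ne] := eqVneq (w : nat) z; first by exists [::] => //; apply: val_inj.
have lt' : (w.-1 < n)%N by have := ltn_ord w; lia.
have [||s ps es] := IH (Ordinal lt'); rewrite /=; try lia.
exists (Ordinal lt' :: s) => //=; rewrite ps andbT /nakayama_adj /=.
by apply/eqP; lia.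
Qed.

Lemma nak_qlength (p : qpath (@nakayama_adj n)) :
  (qend p + qlength p = qstart p)%N.
Proof. exact: nak_path_size (valP p). Qed.

Lemma nak_qpath_inj (p q : qpath (@nakayama_adj n)) :
  qstart p = qstart q -> qend p = qend q -> p = q.
Proof.
case: p q => [[x s] ps] [[y s'] ps'] /= ; rewrite /qstart /qend /= => e1 e2.
apply: val_inj => /=; rewrite -e1 in ps' e2 *; congr (_, _).
apply: (nak_path_inj ps ps').
by have := nak_path_size ps; have := nak_path_size ps'; rewrite /= e2; lia.
Qed.
End NakayamaPaths.

Section Nakayama.
Variables (k : fieldType) (n r : nat).
Local Notation N := (nakayama k n r).
Local Notation rels := (@nakayama_rels k n r).

Local Notation in_band := (@band_rel n r).

Definition nak_coef (a : N) (z w : 'I_n) : k := bqa_coef in_band (a : bqa rels) z w.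
Definition nak_unit (z w : 'I_n) : N := path_class rels z w.
Definition nak_scal (c : k) : N := c *: (1 : bqa rels).

Lemma band_relP z y w : connect (@nakayama_adj n) w y -> connect (@nakayama_adj n) y z ->
  in_band z w -> in_band z y && in_band y w.
Proof. by rewrite !nak_connect /in_band => ? ? ?; apply/andP; split; lia. Qed.

Lemma nak_rels0 g z w : rels g -> in_band z w -> path_coef g z w = 0.
Proof.
case=> p es -> lt; rewrite path_coefU; case: eqP => //= e1; case: eqP => //= e2.
by have := nak_qlength p; move: lt; rewrite /in_band es e1 e2; lia.
Qed.

Lemma nak_uniq (p q : qpath (@nakayama_adj n)) : qstart p = qstart q ->
  qend p = qend q -> bqa_pi rels << p >> = bqa_pi rels << q >>.
Proof. by move=> e1 e2; rewrite (nak_qpath_inj e1 e2). Qed.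

Lemma nak_coefD a b z w : nak_coef (a + b) z w = nak_coef a z w + nak_coef b z w.
Proof. exact: (bqa_coefD (@band_relP) (@nak_rels0) a b z w). Qed.

Lemma nak_coefM a b z w : in_band z w ->
  nak_coef (a * b) z w = \sum_y nak_coef a z y * nak_coef b y w.
Proof. exact: (bqa_coefM (@band_relP) (@nak_rels0) a b). Qed.

Lemma nak_coef1 z w : in_band z w -> nak_coef 1 z w = (z == w)%:R.
Proof. exact: (bqa_coef1 (@band_relP) (@nak_rels0)). Qed.

Lemma nak_coef_scal c z w : in_band z w -> nak_coef (nak_scal c) z w = c * (z == w)%:R.
Proof. by move=> g; rewrite -nak_coef1 //; apply:
  (bqa_coefZ (@band_relP) (@nak_rels0)). Qed.

Lemma nak_coef_gt a (z w : 'I_n) : (w < z)%N -> nak_coef a z w = 0.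
Proof. by move=> lt; apply: bqa_coef_connect; rewrite nak_connect -ltnNge. Qed.

Lemma nak_unit_gt (z w : 'I_n) : (w < z)%N -> nak_unit z w = 0.
Proof. by move=> lt; apply: path_class_nconnect; rewrite nak_connect -ltnNge. Qed.

Lemma nak_coef_unit (z' w' z w : 'I_n) : in_band z' w' -> (z <= w)%N ->
  nak_coef (nak_unit z w) z' w' = ((z == z') && (w == w'))%:R.
Proof.
by move=> g le; apply: (bqa_coef_class (@band_relP) (@nak_rels0) (@nak_uniq)) => //;
  rewrite nak_connect.
Qed.

Lemma nak_unitM (z y w : 'I_n) : (y <= w)%N -> (z <= y)%N ->
  nak_unit z y * nak_unit y w = nak_unit z w.
Proof. by move=> h1 h2; apply: (path_classM (@nak_uniq)); rewrite nak_connect. Qed.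

Lemma nak_unit_neq z y y' w : y != y' -> nak_unit z y * nak_unit y' w = 0.
Proof. exact: (path_class_neq (@nak_uniq)). Qed.

(** A path of length at least r factors through one of length exactly r, which
is a relation. *)
Lemma nak_unit_far z w : ~~ in_band z w -> nak_unit z w = 0.
Proof.
rewrite /in_band -leqNgt => ge.
have lt : (w - r < n)%N by have := ltn_ord w; lia.
pose y := Ordinal lt.
have ey : (y + r = w)%N by rewrite /=; lia.
rewrite -(@nak_unitM z y w) /=; try lia.
suff -> : nak_unit y w = 0 by rewrite mulr0.
have /connect_qpath[p [ep1 ep2]] : connect (@nakayama_adj n) w y.
  by rewrite nak_connect /=; lia.
rewrite /nak_unit -ep1 -ep2 -(class_of_path (@nak_uniq)) -[RHS](raddf0 (bqa_pi rels)).
apply/bqa_piP; rewrite subr0; apply/ideal_genP => J _; apply.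
by exists p => //; have := nak_qlength p; rewrite ep1 ep2; lia.
Qed.

Lemma nak_sum_unit : \sum_z nak_unit z z = 1.
Proof. exact: (sum_path_class_id (@nak_uniq)). Qed.

Lemma nak_unit_idem z : nak_unit z z = vertex_idem rels z.
Proof. exact: (path_class_id (@nak_uniq)). Qed.

Lemma nak_scalM_l c (a : N) : nak_scal c * a = c *: (a : bqa rels).
Proof. by rewrite -[nak_scal c * a]/((c *: (1 : bqa rels) :
  bqa rels) * a) -bqa_scalerAl mul1r. Qed.

Lemma nak_scal_comm c (a : N) : a * nak_scal c = nak_scal c * a.
Proof. by rewrite nak_scalM_l -[a * nak_scal c]/((a : bqa rels) * (c *: (1 : bqa rels) :
  bqa rels)) -bqa_scalerAr mulr1. Qed.

Lemma nak_scalM c d : nak_scal c * nak_scal d = nak_scal (c * d).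
Proof. by rewrite nak_scalM_l /nak_scal scalerA. Qed.

Lemma nak_scalD c d : nak_scal (c + d) = nak_scal c + nak_scal d.
Proof. by rewrite /nak_scal scalerDl. Qed.

Lemma nak_scal1 : nak_scal 1 = 1.
Proof. by rewrite /nak_scal scale1r. Qed.

Lemma nak_decomp (a : N) : a = \sum_z \sum_w nak_scal (nak_coef a z w) * nak_unit z w.
Proof.
rewrite [LHS](bqaE (@nak_uniq) (good := in_band)); last exact: nak_unit_far.
by apply: eq_bigr => z _; apply: eq_bigr => w _; rewrite nak_scalM_l.
Qed.


Definition nakayama_band : band_algebra k n r :=
  BandAlgebra nak_coefD nak_coefM nak_coef1 nak_coef_scal nak_coef_gt nak_coef_unit
    nak_unitM nak_unit_gt nak_unit_neq nak_unit_far nak_sum_unit nak_scalD nak_scalM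
      nak_scal1
    nak_scal_comm nak_decomp.
End Nakayama.

(** * Interval modules *)

Section BandTheory.
Variables (k : fieldType) (n r : nat) (N : band_algebra k n r).
Local Notation nco := (@band_coef k n r N).
Local Notation E := (@band_unit k n r N).
Local Notation sc := (@band_scal k n r N).
Local Notation in_band := (@band_rel n r).

Lemma band_scal0 : sc 0 = 0.
Proof. by apply: (@addrI _ (sc 0)); rewrite -band_scalD !addr0. Qed.

Lemma band_scalN c : sc (- c) = - sc c.
Proof. by apply: (@addrI _ (sc c)); rewrite -band_scalD !subrr band_scal0. Qed.

Lemma band_scal_sum (I : finType) (P : pred I) (F : I -> k) :
  sc (\sum_(i | P i) F i) = \sum_(i | P i) sc (F i).
Proof. by apply: (big_morph sc (band_scalD N) band_scal0). Qed.

Lemma mul_band_unitr a (w x : 'I_n) : (w <= x)%N ->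
  a * E w x = \sum_z sc (nco a z w) * E z x.
Proof.
move=> le; rewrite {1}[a]bandE mulr_suml; apply: eq_bigr => z _.
rewrite mulr_suml (bigD1 w) //= big1 => [|w' ne].
  rewrite addr0 -mulrA; have [lezw|lt] := leqP z w; first by rewrite band_unitM.
  by rewrite band_coef_gt // band_scal0 !mul0r.
by rewrite -mulrA band_unit_neq // mulr0.
Qed.

Lemma mul_band_unitl a (x z : 'I_n) : (x <= z)%N ->
  E x z * a = \sum_w sc (nco a z w) * E x w.
Proof.
move=> le; rewrite {1}[a]bandE mulr_sumr (bigD1 z) //= [X in _ + X]big1 => [|z' ne].
  rewrite addr0 mulr_sumr; apply: eq_bigr => w _.
  rewrite mulrA band_scal_comm -mulrA; have [lezw|lt] := leqP z w;
    first by rewrite band_unitM.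
  by rewrite band_coef_gt // band_scal0 !mul0r.
rewrite mulr_sumr big1 // => w _;
  rewrite mulrA band_scal_comm -mulrA band_unit_neq ?mulr0 //.
by rewrite eq_sym.
Qed.

Section Interval.
Variables c d : nat.

(** The interval [c, d), cut to length r: with this cut, there is a module for
all c and d. *)
Definition in_interval (z : 'I_n) : bool := [&& c <= z, z < d & z < c + r]%N.

Definition isupport : {pred {ffun 'I_n -> k}} :=
  fun f => [forall z, (f z != 0) ==> in_interval z].

Lemma isupportP (f : {ffun 'I_n -> k}) : reflect (forall z, ~~ in_interval z ->
  f z = 0) (f \in isupport).
Proof.
apply: (iffP forallP) => h z.
  by move=> nz; apply/eqP; have := h z; rewrite (negPf nz) implybF negbK.
by apply/implyP; apply: contra_neqT => /h.
Qed.

Lemma isupport_closed : zmod_closed isupport.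
Proof.
split=> [|f g /isupportP hf /isupportP hg]; apply/isupportP => z nz; rewrite !ffunE //.
by rewrite hf // hg // subr0.
Qed.
HB.instance Definition _ := GRing.isZmodClosed.Build {ffun 'I_n ->
  k} isupport isupport_closed.

(** A function on the interval is stored as a function on all vertices that
vanishes outside, so that modules for different intervals can be compared
pointwise. *)
Record interval_mod := IntervalMod { ival : {ffun 'I_n -> k}; ivalP : ival \in isupport }.
HB.instance Definition _ := [isSub for ival].
HB.instance Definition _ := [Choice of interval_mod by <:].
HB.instance Definition _ := [SubChoice_isSubZmodule of interval_mod by <:].

Definition icoord (x : interval_mod) (z : 'I_n) : k := ival x z.

Lemma icoord_out x z : ~~ in_interval z -> icoord x z = 0.
Proof. by move=> nz; apply: (isupportP _ (ivalP x)). Qed.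

Lemma icoordP x y : (forall z, icoord x z = icoord y z) -> x = y.
Proof. by move=> e; apply: val_inj; apply/ffunP. Qed.

Lemma ibuild_subproof (f : 'I_n -> k) : [ffun z =>
  if in_interval z then f z else 0] \in isupport.
Proof. by apply/isupportP => z nz; rewrite ffunE (negPf nz). Qed.
Definition ibuild f : interval_mod := IntervalMod (ibuild_subproof f).

Lemma icoord_build f z : icoord (ibuild f) z = if in_interval z then f z else 0.
Proof. by rewrite /icoord ffunE. Qed.

Lemma icoordD x y z : icoord (x + y) z = icoord x z + icoord y z.
Proof. by rewrite /icoord ffunE. Qed.
Lemma icoord0 z : icoord 0 z = 0.
Proof. by rewrite /icoord ffunE. Qed.

Definition iscale (a : N) (x : interval_mod) : interval_mod :=
  ibuild (fun z => \sum_w nco a z w * icoord x w).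

Lemma in_interval_band z w : in_interval z -> in_interval w -> in_band z w.
Proof. by rewrite /in_interval /in_band => /and3P[? ? ?] /and3P[? ? ?]; lia. Qed.

(** A path between two vertices of the interval only meets vertices of the
interval. *)
Lemma iscaleA a b x : iscale a (iscale b x) = iscale (a * b) x.
Proof.
apply: icoordP => z; rewrite !icoord_build; case: ifP => // Cz.
transitivity (\sum_w \sum_y nco a z y * nco b y w * icoord x w); last first.
  apply: eq_bigr => w _; rewrite -mulr_suml; have [Cw|nw] := boolP (in_interval w).
    by rewrite band_coefM ?in_interval_band.
  by rewrite icoord_out // !mulr0.
rewrite exchange_big; apply: eq_bigr => y _; rewrite icoord_build.
under eq_bigr do rewrite -mulrA; rewrite -mulr_sumr.
case: ifP => // /negbT ny; rewrite mulr0 mulr_sumr big1 // => w _.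
have [Cw|nw] := boolP (in_interval w); last by rewrite icoord_out // !mulr0.
have [ly|?] := leqP z y; last by rewrite band_coef_gt ?mul0r.
have [lw|lt] := leqP y w; last by rewrite [nco b y w]band_coef_gt // mul0r mulr0.
case/negP: ny; move: Cz Cw; rewrite /in_interval => /and3P[? ? ?] /and3P[? ? ?].
by apply/and3P; split; lia.
Qed.

Lemma iscale1 : left_id 1 iscale.
Proof.
move=> x; apply: icoordP => z; rewrite icoord_build; case: ifP => [Cz|/negbT nz].
  rewrite (bigD1 z) //= big1 => [|w ne];
    first by rewrite addr0 band_coef1 ?in_interval_band // eqxx mul1r.
  have [Cw|nw] := boolP (in_interval w); last by rewrite icoord_out // mulr0.
  by rewrite band_coef1 ?in_interval_band // eq_sym (negPf ne) mul0r.
by rewrite icoord_out.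
Qed.

Lemma iscaleDr : right_distributive iscale +%R.
Proof.
move=> a x y; apply: icoordP => z; rewrite icoordD !icoord_build; case: ifP => _;
  last by rewrite addr0.
by rewrite -big_split; apply: eq_bigr => w _; rewrite icoordD mulrDr.
Qed.

Lemma iscaleDl x : {morph iscale^~ x : a b / a + b}.
Proof.
move=> a b; apply: icoordP => z; rewrite icoordD !icoord_build; case: ifP => _;
  last by rewrite addr0.
by rewrite -big_split; apply: eq_bigr => w _; rewrite band_coefD mulrDl.
Qed.

HB.instance Definition _ := GRing.Zmodule_isLmodule.Build N interval_mod
  iscaleA iscale1 iscaleDr iscaleDl.

Lemma icoordZ a x z : icoord (a *:
  x) z = if in_interval z then \sum_w nco a z w * icoord x w else 0.
Proof. exact: icoord_build. Qed.

Lemma icoord_scal e x z : icoord (sc e *: x) z = e * icoord x z.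
Proof.
rewrite icoordZ; case: ifP => [Cz|/negbT nz]; last by rewrite icoord_out ?mulr0.
rewrite (bigD1 z) //= big1 => [|w ne];
  first by rewrite addr0 band_coef_scal ?in_interval_band // eqxx mulr1.
have [Cw|nw] := boolP (in_interval w); last by rewrite icoord_out // mulr0.
by rewrite band_coef_scal ?in_interval_band // eq_sym (negPf ne) mulr0 mul0r.
Qed.

Lemma icoord_unit z w x y : icoord (E z w *: x) y = if [&& y == z,
  in_interval z & z <= w]%N then icoord x w else 0.
Proof.
rewrite icoordZ; have [le|lt] := leqP z w; last first.
  rewrite band_unit_gt // !andbF big1 ?if_same // => v _.
  have [Cv|nv] := boolP (in_interval v); last by rewrite icoord_out ?mulr0.
  have -> : nco 0 y v = 0; last by rewrite mul0r.
  by apply: (@addrI _ (nco 0 y v)); rewrite -band_coefD !addr0.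
rewrite andbT; case: eqP => [->|ne] /=.
  case: ifP => // Cz; rewrite (bigD1 w) //= big1 => [|v ne].
    rewrite addr0; have [Cw|nw] := boolP (in_interval w); last by rewrite icoord_out ?mulr0.
    by rewrite band_coef_unit ?in_interval_band // !eqxx mul1r.
  have [Cv|nv] := boolP (in_interval v); last by rewrite icoord_out ?mulr0.
  by rewrite band_coef_unit ?in_interval_band // eqxx eq_sym (negPf ne) mul0r.
case: ifP => // Cy; rewrite big1 // => v _.
have [Cv|nv] := boolP (in_interval v); last by rewrite icoord_out ?mulr0.
by rewrite band_coef_unit ?in_interval_band // eq_sym; case: eqP ne => //=; rewrite mul0r.
Qed.

Definition idelta (z : 'I_n) : interval_mod := ibuild (fun y => (y == z)%:R).

Lemma icoord_delta z y : icoord (idelta z) y = if in_interval z then (y == z)%:R else 0.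
Proof. by rewrite icoord_build; case: eqP => [->|_] //; rewrite !if_same. Qed.

Lemma icoord_sum (I : finType) (P : pred I) (F : I -> interval_mod) z :
  icoord (\sum_(i | P i) F i) z = \sum_(i | P i) icoord (F i) z.
Proof. by apply: (big_morph (icoord^~ z)) => [x y|]; rewrite ?icoordD ?icoord0. Qed.

Lemma interval_fg : finitely_generated interval_mod.
Proof.
exists 'I_n, idelta => x; exists (fun z => sc (icoord x z)); apply: icoordP => y.
rewrite icoord_sum (bigD1 y) //= big1 => [|z ne].
  by rewrite addr0 icoord_scal icoord_delta eqxx; case: ifP => [_|/negbT/icoord_out->];
    rewrite ?mulr1 ?mulr0.
by rewrite icoord_scal icoord_delta eq_sym (negPf ne) if_same mulr0.
Qed.

Definition interval_module : fgModule N := FgModule interval_fg.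
End Interval.
End BandTheory.

(** * Homomorphisms of interval modules *)

Section LinearRelations.
Variables (A : pzRingType) (U V : lmodType A) (R : U -> V -> Prop).
Hypotheses (linR : linear_rel R) (R0 : R 0 0).

Lemma rel_add x y x' y' : R x y -> R x' y' -> R (x + x') (y + y').
Proof. by move=> h h'; have := linR 1 h h'; rewrite !scale1r. Qed.

Lemma rel_scale a x y : R x y -> R (a *: x) (a *: y).
Proof. by move=> h; have := linR a h R0; rewrite !addr0. Qed.

Lemma rel_sum (I : Type) (s : seq I) (F : I -> U) (G : I -> V) :
  (forall i, R (F i) (G i)) -> R (\sum_(i <- s) F i) (\sum_(i <- s) G i).
Proof. by move=> h; elim/big_rec2: _ => // i y1 y2 _; apply: rel_add. Qed.
End LinearRelations.

Section Homs.
Variables (k : fieldType) (n r : nat) (N : band_algebra k n r).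
Local Notation nco := (@band_coef k n r N).
Local Notation E := (@band_unit k n r N).
Local Notation sc := (@band_scal k n r N).
Local Notation in_band := (@band_rel n r).
Local Notation K := (interval_module N).

Definition sub_interval c d c' d' := (c <= c')%N && (d <= d')%N.

(** The restriction of functions. It is linear when both ends move up, because
submodules are closed downwards; otherwise the zero map stands in, so that it
is linear in all cases. *)
Definition interval_map_fun c d c' d' (x : K c d) : K c' d' :=
  ibuild r c' d' (fun z => if sub_interval c d c' d' then icoord x z else 0).

Lemma interval_map_linear c d c' d' : linear (@interval_map_fun c d c' d').
Proof.
move=> a x y; apply: icoordP => z; rewrite icoordD icoordZ !icoord_build icoordD icoordZ.
have [Cz'|nz'] := boolP (in_interval r c' d' z); last by rewrite addr0.
rewrite /interval_map_fun /sub_interval; case: andP => [[le1 le2]|_]; last first.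
  by rewrite addr0 big1 // => w _; rewrite icoord_build if_same mulr0.
congr (_ + _); have [Cz|nz] := boolP (in_interval r c d z).
  apply: eq_bigr => w _; rewrite icoord_build; have [|nw'] :=
    boolP (in_interval r c' d' w) => //.
  have [Cw|nw] := boolP (in_interval r c d w); last by rewrite icoord_out // !mulr0.
  have [lw|lt] := leqP z w; last by rewrite band_coef_gt // !mul0r.
  by case/negP: nw'; move: Cz' Cw; rewrite /in_interval => /and3P[? ? ?] /and3P[? ? ?];
    apply/and3P; split; lia.
rewrite big1 // => w _; rewrite icoord_build; case: ifP => [Cw'|]; last by rewrite mulr0.
have [Cw|nw] := boolP (in_interval r c d w); last by rewrite icoord_out // !mulr0.
have [lw|lt] := leqP z w; last by rewrite band_coef_gt // !mul0r.
by case/negP: nz; move: Cz' Cw; rewrite /in_interval => /and3P[? ? ?] /and3P[? ? ?];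
  apply/and3P; split; lia.
Qed.

Definition interval_map c d c' d' : {linear K c d -> K c' d'} :=
  mk_linear (@interval_map_linear c d c' d').

Lemma icoord_map c d c' d' x z : icoord (interval_map c d c' d' x) z =
  if sub_interval c d c' d' && in_interval r c' d' z then icoord x z else 0.
Proof. by rewrite icoord_build; case: (sub_interval _ _ _ _) => /=; rewrite ?if_same. Qed.

Section Generator.
Variables (c d : nat) (x : 'I_n).
Hypotheses (dx : d = x.+1) (dcr : (d <= c + r)%N).

(** The delta function at the top vertex generates the interval module. *)
Lemma interval_generated (f : K c d) : f = \sum_z sc (icoord f z) *: (E z x *:
  idelta k r c d x).
Proof.
apply: icoordP => y; rewrite icoord_sum (bigD1 y) //= big1 => [|z ne].
  rewrite addr0 icoord_scal icoord_unit icoord_delta !eqxx.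
  have [Cy|ny] := boolP (in_interval r c d y); last by rewrite icoord_out // mul0r.
  have -> : (y <= x)%N by move: Cy => /and3P[]; lia.
  have -> : in_interval r c d x by move: Cy => /and3P[? ? ?]; apply/and3P; split; lia.
  by rewrite mulr1.
by rewrite icoord_scal icoord_unit eq_sym (negPf ne) mulr0.
Qed.

(** The module is presented by its generator at x and the vanishing of the
paths from x to the vertices below c. *)
Lemma hom_of_elt (M : lmodType N) (m : M) :
  (forall z : 'I_n, (z < c)%N -> E z x *: m = 0) ->
  exists phi : {linear K c d -> M}, forall f, phi f = \sum_z sc (icoord f z) *: (E z x *:
    m).
Proof.
move=> mc.
have Em z : ~~ in_interval r c d z -> E z x *: m = 0.
  rewrite /in_interval => nz; have [lt|ge] := ltnP z c; first exact: mc.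
  by rewrite band_unit_gt ?scale0r //; move: nz; rewrite ge /=; lia.
have lin : linear (fun f : K c d => \sum_z sc (icoord f z) *: (E z x *: m)).
  move=> a f g; under eq_bigr do rewrite icoordD band_scalD scalerDl.
  rewrite big_split; congr (_ + _); rewrite scaler_sumr.
  transitivity (\sum_w \sum_z (sc (icoord f w) * sc (nco a z w) * E z x) *: m); last first.
    apply: eq_bigr => w _; have [Cw|nw] := boolP (in_interval r c d w); last first.
      rewrite icoord_out // band_scal0 scale0r scaler0 big1 // => z _.
      by rewrite !mul0r scale0r.
    have le : (w <= x)%N by move: Cw => /and3P[]; lia.
    rewrite !scalerA band_scal_comm -mulrA mul_band_unitr // mulr_sumr scaler_suml.
    by apply: eq_bigr => z _; rewrite mulrA.
  rewrite exchange_big; apply: eq_bigr => z _.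
  have [Cz|nz] := boolP (in_interval r c d z); last first.
    rewrite icoord_out // band_scal0 scale0r big1 // => w _.
    by rewrite -scalerA Em ?scaler0.
  rewrite icoordZ Cz band_scal_sum scaler_suml; apply: eq_bigr => w _.
  by rewrite band_scalM scalerA mulrC.
by exists (mk_linear lin).
Qed.
End Generator.

Lemma interval_module_trivial c d : (d <= c)%N -> trivial_module (K c d).
Proof.
move=> le x; apply: icoordP => z; rewrite icoord0 icoord_out //.
by apply/negP => /and3P[]; lia.
Qed.

(** Here the only relation on the generator is that paths of length r vanish.
*)
Lemma interval_module_projective c d : c = (d - r)%N -> (d <= n)%N ->
  rel_projective (K c d).
Proof.
case: d => [|x] cd le Z R linR totR.
  have R0 : R 0 0 by have [z Rz] := totR 0; have := linR (-1) _ _ _ _ Rz Rz;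
    rewrite !scaleN1r !addNr.
  exists \0 => y; rewrite (@interval_module_trivial c 0 _ y) // linear0 //.
have R0 : R 0 0 by have [z Rz] := totR 0; have := linR (-1) _ _ _ _ Rz Rz;
  rewrite !scaleN1r !addNr.
pose o := Ordinal le; have [m Rm] := totR (idelta k r c x.+1 o).
have dcr : (x.+1 <= c + r)%N by lia.
have [z lt|phi phiE] := @hom_of_elt c x.+1 o erefl dcr Z m.
  by rewrite band_unit_far ?scale0r // /in_band /=; lia.
exists phi => f; rewrite phiE {1}(@interval_generated c x.+1 o erefl dcr f).
by apply: rel_sum => // z; do 2!apply: rel_scale => //.
Qed.

(** The image of the generator lies at vertex x = d - 1, so it is a multiple of
a delta function. If d > d', the target vanishes at x. If c' < c, a path from x
to c - 1 kills the generator but not a nonzero image of it. *)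
Lemma hom_scalar c d c' d' (f : {linear K c d -> K c' d'}) :
  (c < d <= n)%N -> (d <= c + r)%N ->
  exists l : k, forall h, f h = sc l *: interval_map c d c' d' h.
Proof.
case: d f => [|x] f; first by rewrite ltn0.
move=> /andP[lt le] dcr; pose o : 'I_n := Ordinal le.
set D := f (idelta k r c x.+1 o); exists (icoord D o) => h.
have fh y : icoord (f h) y = if in_interval r c' d' y then icoord D o * icoord h y else 0.
  rewrite {1}(@interval_generated c x.+1 o erefl dcr h) linear_sum icoord_sum (bigD1 y) //=
    big1 => [|z ne].
    rewrite addr0 !linearZ /= -/D icoord_scal icoord_unit eqxx /=.
    have [Cy|ny] := boolP (in_interval r c x.+1 y); last first.
      by rewrite [icoord h y]icoord_out // mul0r mulr0 if_same.
    have -> : (y <= x)%N by move: Cy => /and3P[].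
    by rewrite andbT; case: ifP; rewrite ?mulr0 // mulrC.
  by rewrite !linearZ /= icoord_scal icoord_unit eq_sym (negPf ne) mulr0.
apply: icoordP => y; rewrite fh icoord_scal icoord_map.
have [le'|nle] /= := boolP (sub_interval c x.+1 c' d'); first by case: ifP; rewrite ?mulr0.
suff -> : icoord D o = 0 by rewrite !mul0r if_same.
have [Co|no] := boolP (in_interval r c' d' o); last by rewrite icoord_out.
have lt' : (c' < c)%N by move: nle Co; rewrite /sub_interval /in_interval /=; lia.
have ltn : (c.-1 < n)%N by lia.
pose t := Ordinal ltn.
have : icoord (E t o *: D) t = 0.
  rewrite /D -linearZ /=; have -> : E t o *: idelta k r c x.+1 o = 0.
    apply: icoordP => z; rewrite icoord_unit icoord0.
    by have -> : in_interval r c x.+1 t = false; rewrite ?andbF // /in_interval /=; lia.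
  by rewrite linear0 icoord0.
rewrite icoord_unit eqxx /=; have -> : in_interval r c' d' t.
  by move: Co; rewrite /in_interval /=; lia.
by have -> : (c.-1 <= x)%N by lia.
Qed.
End Homs.

(** * Injectivity and length of interval modules *)

(** The dual of [rel_projective]: every linear relation that is single-valued
at 0 extends to a linear map. *)
Definition rel_injective (A : pzRingType) (J : lmodType A) : Prop :=
  forall (Y : fgModule A) (R : Y -> J -> Prop), linear_rel R -> R 0 0 ->
    (forall c, R 0 c -> c = 0) ->
    exists h : {linear Y -> J}, forall y c, R y c -> h y = c.

Section Functionals.
Variables (k : fieldType) (n r : nat) (N : band_algebra k n r).
Local Notation nco := (@band_coef k n r N).
Local Notation E := (@band_unit k n r N).
Local Notation sc := (@band_scal k n r N).
Variable Y : fgModule N.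

(** The graph of a linear functional on a subspace of Y. *)
Definition partial_functional (S : Y -> k -> Prop) : Prop :=
  [/\ S 0 0, forall c, S 0 c -> c = 0 &
      forall a y y' c c', S y c -> S y' c' -> S (sc a *: y + y') (a * c + c')].

Lemma functional_step (S : Y -> k -> Prop) (y0 : Y) : partial_functional S ->
  exists S', [/\ partial_functional S', forall y c, S y c -> S' y c & exists c, S' y0 c].
Proof.
move=> fS; have [S0 Sf Sl] := fS; have [|nS] := EM (exists c, S y0 c).
  by exists S.
exists (fun y c => exists a y1, S y1 c /\ y = sc a *: y0 + y1); split.
- split.
  + by exists 0, 0; rewrite band_scal0 scale0r addr0.
  + move=> c [a [y1 [S1 e]]]; have [a0|a0] := eqVneq a 0.
      by apply: Sf; rewrite e a0 band_scal0 scale0r add0r.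
    case: nS; exists (- a^-1 * c + 0).
    have -> : y0 = sc (- a^-1) *: y1 + 0; last exact: Sl.
    have -> : y1 = - (sc a *: y0) by apply/eqP; rewrite -addr_eq0 addrC -e.
    by rewrite addr0 scalerN scalerA band_scalM mulNr mulVf //
      band_scalN band_scal1 scaleN1r opprK.
  + move=> b y y' c c' [a [y1 [S1 ->]]] [a' [y1' [S1' ->]]].
    exists (b * a + a'), (sc b *: y1 + y1'); split; first exact: Sl.
    by rewrite scalerDr band_scalD scalerDl scalerA band_scalM addrACA.
- by move=> y c Sy; exists 0, y; rewrite band_scal0 scale0r add0r.
by exists 0, 1, 0; rewrite band_scal1 scale1r addr0.
Qed.

Lemma functional_seq (S : Y -> k -> Prop) (l : seq Y) : partial_functional S ->
  exists S', [/\ partial_functional S', forall y c, S y c -> S' y c &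
    forall y, List.In y l -> exists c, S' y c].
Proof.
move=> fS; elim: l => [|y l [S1 [f1 S1S S1l]]]; first by exists S.
have [S2 [f2 S2S S2y]] := functional_step y f1.
exists S2; split=> // [y' c /S1S/S2S //|y' [<-//|/S1l[c /S2S]]].
by exists c.
Qed.

(** Y is finite-dimensional, so extending by one vector at a time suffices. *)
Lemma functional_extend (S : Y -> k -> Prop) : partial_functional S ->
  exists l : Y -> k, (forall a y y', l (sc a *: y + y') = a * l y + l y') /\
    forall y c, S y c -> l y = c.
Proof.
move=> fS; have [J [g gP]] := fgP Y.
pose s := [seq E t.1.1 t.1.2 *: g t.2 | t <- enum {: 'I_n * 'I_n * J}].
have [S' [fS' S'S S's]] := functional_seq s fS; have [S0 Sf Sl] := fS'.
have sP z w j : exists c, S' (E z w *: g j) c.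
  apply: S's; rewrite /s; have : (z, w, j) \in enum {: 'I_n * 'I_n * J} by rewrite mem_enum.
  elim: (enum _) => //= t l IH; rewrite inE => /orP[/eqP<-|/IH]; [by left|by right].
have Sadd y y' : (exists c, S' y c) -> (exists c, S' y' c) -> exists c, S' (y + y') c.
  move=> [c h] [c' h']; exists (1 * c + c'); rewrite -[y]scale1r -(band_scal1 N).
  exact: Sl.
have Ssum (I : finType) (F : I -> Y) : (forall i, exists c, S' (F i) c) ->
    exists c, S' (\sum_i F i) c.
  by move=> h; elim/big_rec: _ => [|i y _ hy]; [exists 0 | apply: Sadd].
have tot y : exists c, S' y c.
  have [a ->] := gP y; apply: (Ssum) => j; rewrite [a j]bandE scaler_suml.
  apply: (Ssum) => z; rewrite scaler_suml; apply: (Ssum) => w; rewrite -scalerA.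
  have [c h] := sP z w j; exists (nco (a j) z w * c + 0).
  by rewrite -[_ *: _]addr0; apply: Sl.
have [l lP] := choice tot.
have fun1 y c : S' y c -> l y = c.
  move=> h; have := Sl (-1) _ _ _ _ h (lP y).
  rewrite band_scalN band_scal1 scaleN1r addNr mulN1r => /Sf/eqP.
  by rewrite addrC subr_eq0 => /eqP.
exists l; split=> [a y y'|y c /S'S]; last exact: fun1.
by apply: fun1; apply: Sl.
Qed.
End Functionals.

Section Intervals.
Variables (k : fieldType) (n r : nat) (N : band_algebra k n r).
Local Notation E := (@band_unit k n r N).
Local Notation sc := (@band_scal k n r N).
Local Notation in_band := (@band_rel n r).
Local Notation K := (interval_module N).

(** When the interval ends only because of the length r or the end n of the
quiver, the maps Y -> K c d correspond to the functionals on the space of Y at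
the vertex c, by evaluation at c. Such functionals extend. *)
Lemma interval_module_injective c d : (minn n (c + r) <= d)%N -> rel_injective (K c d).
Proof.
move=> led Y R linR R0 Rf.
have [cn|nc] := ltnP c n; last first.
  have t : trivial_module (K c d).
    by move=> x; apply: icoordP => z; have lz := ltn_ord z; rewrite icoord0 icoord_out //
      /in_interval; lia.
  by exists \0 => y x _; rewrite [RHS]t.
pose x := Ordinal cn.
have [|l [ll lR]] := @functional_extend k n r N Y (fun y e => exists2 j,
  R y j & icoord j x = e).
  split; first by exists 0; rewrite ?icoord0.
    by move=> e [j /Rf -> <-]; rewrite icoord0.
  move=> a y y' e e' [j Rj <-] [j' Rj' <-]; exists (sc a *: j + j'); first exact: linR.
  by rewrite icoordD icoord_scal.
have l0 : l 0 = 0 by apply: lR; exists 0; rewrite ?icoord0.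
have lD y y' : l (y + y') = l y + l y'.
  by have := ll 1 y y'; rewrite band_scal1 scale1r mul1r.
have lZ a y : l (sc a *: y) = a * l y by have := ll a y 0; rewrite l0 !addr0.
have lS (I : finType) (F : I -> Y) : l (\sum_i F i) = \sum_i l (F i).
  by apply: (big_morph l) => //.
have lin : linear (fun y : Y => ibuild r c d (fun z => l (E x z *: y)) : K c d).
  move=> a y y'; apply: icoordP => z; rewrite icoordD icoordZ !icoord_build.
  have [Cz|nz] := boolP (in_interval r c d z); last by rewrite addr0.
  have le : (x <= z)%N by move: Cz => /and3P[].
  rewrite scalerDr lD; congr (_ + _).
  rewrite scalerA mul_band_unitl // scaler_suml lS; apply: eq_bigr => w _.
  rewrite -scalerA lZ icoord_build; have [//|nw] := boolP (in_interval r c d w).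
  have [lw|lt] := leqP z w; last by rewrite band_coef_gt // !mul0r.
  rewrite band_unit_far ?scale0r ?l0 //; move: Cz nw; rewrite /in_interval /in_band /=.
  by have := ltn_ord w; lia.
exists (mk_linear lin) => y j Rj; apply: icoordP => z; rewrite icoord_build.
case: ifP => [Cz|/negbT nz]; last by rewrite icoord_out.
apply: lR; exists (E x z *: j); first exact: rel_scale.
rewrite icoord_unit eqxx /=; have -> : in_interval r c d x by move: Cz;
  rewrite /in_interval /=; lia.
by have -> : (c <= z)%N by move: Cz => /and3P[].
Qed.

Section Submodules.
Variables (c d : nat).
Hypotheses (dn : (d <= n)%N) (dcr : (d <= c + r)%N) (cd : (c <= d)%N).

(** These are all the submodules of the interval module, which is uniserial. *)
Definition vanish_from (t : nat) : {pred K c d} := fun f => [forall z : 'I_n,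
  (t <= z)%N ==> (icoord f z == 0)].

Lemma vanish_fromP t (f : K c d) : reflect (forall z : 'I_n, (t <= z)%N ->
  icoord f z = 0) (f \in vanish_from t).
Proof.
apply: (iffP forallP) => h z; first by move=> le; apply/eqP; have := h z; rewrite le.
by apply/implyP => le; rewrite h.
Qed.

Lemma vanish_from_closed t : submod_closed (vanish_from t).
Proof.
split=> [|a f g /vanish_fromP hf /vanish_fromP hg]; apply/vanish_fromP => z le;
  first exact: icoord0.
rewrite icoordD hg // addr0 icoordZ; case: ifP => // _; rewrite big1 // => w _.
have [lw|lt] := leqP z w; last by rewrite band_coef_gt // mul0r.
by rewrite hf ?mulr0 //; apply: leq_trans lw.
Qed.

(** An element of U with a nonzero value at z generates all functions that are
supported at vertices up to z. *)
Lemma submodule_vanish_from (U : {pred K c d}) : submod_closed U ->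
  exists2 t, (c <= t <= d)%N & U =i vanish_from t.
Proof.
move=> [U0 Ul].
have UD f g : f \in U -> g \in U -> f + g \in U.
  by move=> Uf Ug; rewrite -[f]scale1r; apply: Ul.
have UZ a f : f \in U -> a *: f \in U by move=> Uf; rewrite -[_ *: _]addr0; apply: Ul.
pose P t := (c <= t)%N && `[< forall f, f \in U -> f \in vanish_from t >].
have exP : exists t, P t.
  exists d; rewrite /P cd; apply/asboolP => f _; apply/vanish_fromP => z le.
  by rewrite icoord_out // /in_interval; lia.
case: (ex_minnP exP) => t /andP[ct /asboolP tU] tmin; exists t.
  rewrite ct; apply: tmin; rewrite /P cd; apply/asboolP => f _; apply/vanish_fromP => z le.
  by rewrite icoord_out // /in_interval; lia.
move=> f; apply/idP/idP => [|/vanish_fromP ft]; first exact: tU.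
have [tc|lt] := leqP t c.
  suff -> : f = 0 by [].
  apply: icoordP => z; rewrite icoord0; have [cz|zc] := leqP c z;
    last by rewrite icoord_out // /in_interval; lia.
  by rewrite ft //; lia.
have : ~~ P t.-1 by apply/negP => /tmin; lia.
rewrite /P negb_and => /orP[|/asboolP nU]; first by lia.
have [g Ug [z tz gz]] : exists2 g, g \in U & exists2 z : 'I_n,
  (t.-1 <= z)%N & icoord g z <> 0.
  apply: contrapT => h; apply: nU => g Ug; apply/vanish_fromP => z lz.
  by apply: contrapT => gz; apply: h; exists g => //; exists z.
have zt : z = t.-1 :> nat.
  apply/eqP; rewrite eqn_leq tz andbT; case: leqP => // lt'.
  by case: gz; apply: (vanish_fromP _ _ (tU g Ug)); lia.
have Cz : in_interval r c d z by apply/negP => /negP nz; apply: gz; rewrite icoord_out.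
have -> : f = \sum_(y : 'I_n) sc (icoord f y / icoord g z) *: (E y z *: g).
  apply: icoordP => y; rewrite icoord_sum (bigD1 y) //= big1 => [|y' ne]; last first.
    by rewrite icoord_scal icoord_unit eq_sym (negPf ne) mulr0.
  rewrite addr0 icoord_scal icoord_unit eqxx /=.
  have [Cy|ny] := boolP (in_interval r c d y);
    last by rewrite [icoord f y]icoord_out ?mulr0.
  have gz' : icoord g z != 0 by apply/eqP.
  have [le|gt] /= := leqP y z; first by rewrite divfK.
  by rewrite ft ?mul0r //; lia.
by elim/big_rec: _ => // y h _ Uh; apply: UD => //; do 2!apply: (UZ).
Qed.

(** The submodules form a chain, so the i-th term of a composition series
consists of the functions supported on [c, c + i). *)
Lemma interval_module_length l : has_length (K c d) l -> l = (d - c)%N.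
Proof.
case=> F [Fsub F0 Fl Fstep].
have delta_level i : (c + i < d)%N -> exists f : K c d,
    f \in vanish_from (c + i).+1 /\ f \notin vanish_from (c + i).
  move=> lt; have lt' : (c + i < n)%N by lia.
  have Cz : in_interval r c d (Ordinal lt') by rewrite /in_interval /=; lia.
  exists (idelta k r c d (Ordinal lt')); split.
    apply/vanish_fromP => z le; rewrite icoord_delta Cz -val_eqE /=.
    by case: eqP => // e; move: le; rewrite e; lia.
  apply/negP => /vanish_fromP /(_ (Ordinal lt') (leqnn _)).
  by rewrite icoord_delta Cz eqxx => /eqP; rewrite oner_eq0.
have H i : (i <= l)%N -> F i =i vanish_from (c + i) /\ (c + i <= d)%N.
  elim: i => [_|i IH lt].
    rewrite addn0; split=> // f; rewrite F0 inE; apply/eqP/vanish_fromP => [-> z _|h].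
      exact: icoord0.
    apply: icoordP => z; rewrite icoord0; have [cz|zc] := leqP c z; first exact: h.
    by rewrite icoord_out // /in_interval; lia.
  have [Fi ci] := IH (ltnW lt).
  have [t /andP[ct td] Ft] := submodule_vanish_from (Fsub i.+1 lt).
  have [sub [f ff nf] mid] := Fstep i lt.
  have lt2 : (c + i < t)%N.
    rewrite ltnNge; apply/negP => le; move: nf; rewrite Fi; case/negP.
    apply/vanish_fromP => z lz; move: ff; rewrite Ft => /vanish_fromP; apply.
    exact: leq_trans lz.
  have [|g [gl ng]] := delta_level i; first exact: leq_trans lt2 td.
  case: (mid (vanish_from (c + i).+1)).
  - exact: vanish_from_closed.
  - move=> h; rewrite Fi => /vanish_fromP hl; apply/vanish_fromP => z lz; apply: hl.
    by apply: leq_trans lz.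
  - move=> h /vanish_fromP hl; rewrite Ft; apply/vanish_fromP => z lz; apply: hl.
    exact: leq_trans lz.
  - by move=> /(_ g); rewrite Fi gl (negPf ng).
  by move=> e; rewrite addnS; split=> [h|]; [rewrite e | apply: leq_trans td].
have [Hl cl] := H l (leqnn _).
apply/eqP; rewrite eqn_leq leq_subRL ?leq_subLR // cl /= leqNgt; apply/negP => lt.
have [g [_]] := delta_level l lt.
by rewrite -Hl Fl.
Qed.
End Submodules.

Lemma has_length_iso (M L : lmodType N) (f : {linear L -> M}) l :
  bijective f -> has_length M l -> has_length L l.
Proof.
case=> g fK gK [F [Fsub F0 Fl Fstep]].
have glin : linear g by move=> a x y; apply: (can_inj fK); rewrite linearP !gK.
pose F' i : {pred L} := fun x => f x \in F i.
have F'E i x : (x \in F' i) = (f x \in F i) by [].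
exists F'; split.
- move=> i le; have [h0 hl] := Fsub i le; split=> [|a x y]; rewrite !F'E ?linear0 //.
  by rewrite linearP; apply: hl.
- by move=> x; rewrite F'E F0 !inE -[0 in LHS](linear0 f) (can_eq fK).
- by move=> x; rewrite F'E Fl.
move=> i lt; have [sub [x xW xU] mid] := Fstep i lt; split.
- by move=> y; rewrite !F'E; apply: sub.
- by exists (g x); rewrite !F'E gK.
move=> U' [u0 ul] UU' U'W.
pose G : {pred M} := fun y => g y \in U'.
have GE y : (y \in G) = (g y \in U') by [].
case: (mid G).
- split=> [|a y z]; rewrite !GE.
    by rewrite -(linear0 f) fK.
  by rewrite glin; apply: ul.
- by move=> y yU; rewrite GE; apply: UU'; rewrite F'E gK.
- by move=> y; rewrite GE => /U'W; rewrite F'E gK.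
- by move=> e; left=> y; rewrite F'E -(e (f y)) GE fK.
by move=> e; right=> y; rewrite F'E -(e (f y)) GE fK.
Qed.
End Intervals.

(** * Recognition of interval modules *)

Section Tops.
Variables (A : pzRingType) (M : lmodType A).

Lemma submod_closedD (U : {pred M}) x y : submod_closed U -> x \in U -> y \in U ->
  x + y \in U.
Proof. by case=> _ h hx hy; rewrite -[x]scale1r; apply: h. Qed.

Lemma submod_closedZ (U : {pred M}) a x : submod_closed U -> x \in U -> a *: x \in U.
Proof. by case=> h0 h hx; rewrite -[_ *: _]addr0; apply: h. Qed.

Lemma submod_closedB (U : {pred M}) x y : submod_closed U -> x \in U -> y \in U ->
  x - y \in U.
Proof.
move=> h hx hy; apply: submod_closedD => //.
by rewrite -scaleN1r; apply: submod_closedZ.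
Qed.

(** For a composition series F, take the largest i such that W + F i is proper:
a module between W + F i and the whole module is determined by its intersection
with F (i + 1). *)
Lemma maximal_above l (W : {pred M}) : has_length M l -> submod_closed W ->
  (exists x, x \notin W) -> exists2 U, maximal_submodule U & {subset W <= U}.
Proof.
case=> F [Fsub F0 Fl Fstep] Wsub [x0 x0W]; have [W0 Wl] := Wsub.
pose G i : {pred M} := fun x => `[< exists2 w, w \in W & x - w \in F i >].
have GP i x : reflect (exists2 w, w \in W & x - w \in F i) (x \in G i) by apply: asboolP.
have G_ex : exists i, (i < l)%N /\ (exists x, x \notin G i) /\ forall x, x \in G i.+1.
  apply: contrapT => nex.
  have H i : (i <= l)%N -> exists x, x \notin G i.
    elim: i => [_|i IH lt].
      exists x0; apply: contra x0W => /GP[w wW]; rewrite F0 inE subr_eq0.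
      by move/eqP->.
    apply: contrapT => nx; apply: nex; exists i; split=> //; split; first exact/IH/ltnW.
    by move=> x; apply: contrapT => /negP nG; apply: nx; exists x.
  have [x /GP[]] := H l (leqnn _); exists 0 => //; rewrite subr0 Fl //.
case: G_ex => i [lt [[x1 nx1] Gi1]]; have Fi := Fsub i (ltnW lt).
exists (G i); last by move=> w wW; apply/GP; exists w; rewrite ?subrr //; case: Fi.
have [sub _ mid] := Fstep i lt; split; last split=> //; last 1 first.
- move=> U Usub GU _.
  have Fi1 := Fsub i.+1 lt.
  have WU w : w \in W -> w \in U.
    by move=> wW; apply: GU; apply/GP; exists w; rewrite ?subrr //; case: Fi.
  pose V : {pred M} := fun x => (x \in U) && (x \in F i.+1).
  have VE x : (x \in V) = (x \in U) && (x \in F i.+1) by [].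
  case: (mid V).
  + split=> [|a x y]; rewrite !VE.
      by case: Usub => -> _; case: Fi1 => -> _.
    by case/andP=> ? ? /andP[? ?]; rewrite (Usub.2) ?(Fi1.2).
  + move=> x xF; rewrite VE sub // andbT; apply: GU; apply/GP; exists 0 => //.
    by rewrite subr0.
  + by move=> x; rewrite VE => /andP[].
  + move=> VF; left=> x; apply/idP/idP => [xU|]; last exact: GU.
    have /GP[w wW h] := Gi1 x; apply/GP; exists w => //; rewrite -VF VE h andbT.
    by apply: submod_closedB => //; apply: WU.
  + move=> VF; right=> x; rewrite [RHS]inE; have /GP[w wW] := Gi1 x.
    rewrite -VF VE => /andP[h _]; rewrite -(subrK w x).
    by apply: submod_closedD => //; apply: WU.
- split; first by apply/GP; exists 0 => //; rewrite subr0; case: Fi.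
  move=> a x y /GP[w wW h] /GP[w' wW' h']; apply/GP; exists (a *: w + w'); first exact: Wl.
  by rewrite opprD addrACA -scalerBr; case: Fi => _; apply.
- by exists x1.
Qed.

(** The radical is itself a maximal submodule, so it is the only one, and W is
not contained in it. *)
Lemma top_generates l (S : lmodType A) (f : {linear M -> S}) (W : {pred M}) (m : M) :
  has_length M l -> simple_module S -> (forall y, exists x, f x = y) ->
  (forall x, f x = 0 <-> module_radical x) ->
  submod_closed W -> m \in W -> f m != 0 -> forall x, x \in W.
Proof.
move=> hl [_ Ssimple] fs frad Wsub mW fm x; apply: contrapT => /negP nx.
have [|U Umax WU] := maximal_above hl Wsub; first by exists x.
have [Usub [_ [y _ ny] _]] := Umax.
have radU z : f z = 0 -> z \in U by move=> fz; apply: (frad z).1.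
pose V : {pred S} := fun s => `[< exists2 u, u \in U & f u = s >].
have VP s : reflect (exists2 u, u \in U & f u = s) (s \in V) by apply: asboolP.
case: (Ssimple V).
- split; first by apply/VP; exists 0; [case: Usub | rewrite linear0].
  move=> a s t /VP[u uU <-] /VP[u' uU' <-]; apply/VP; exists (a *: u + u').
    by case: Usub => _; apply.
  by rewrite linearP.
- move=> /(_ (f m)); rewrite inE (negPf fm) => /negP; apply; apply/VP.
  by exists m => //; apply: WU.
move=> /(_ (f y)); rewrite [RHS]inE => /VP[u uU e]; case/negP: ny.
rewrite -(subrK u y); apply: submod_closedD => //; apply: radU.
by rewrite linearB e subrr.
Qed.
End Tops.

Section Uniqueness.
Variables (k : fieldType) (n r : nat) (N : band_algebra k n r).
Local Notation nco := (@band_coef k n r N).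
Local Notation E := (@band_unit k n r N).
Local Notation sc := (@band_scal k n r N).
Local Notation in_band := (@band_rel n r).
Local Notation K := (interval_module N).

Lemma band_unit_split (M : lmodType N) (m : M) : m = \sum_z E z z *: m.
Proof. by rewrite -scaler_suml band_sum_unit scale1r. Qed.

Lemma band_unit_idr (M : lmodType N) (m : M) (z x : 'I_n) : E z x *: (E x x *:
  m) = E z x *: m.
Proof.
rewrite scalerA; have [le|lt] := leqP z x; first by rewrite band_unitM.
by rewrite band_unit_gt // mul0r.
Qed.

Lemma band_unit_idl (M : lmodType N) (m : M) (z x y : 'I_n) :
  E y y *: (E z x *: m) = if y == z then E z x *: m else 0.
Proof.
rewrite scalerA; case: eqVneq => [->|ne]; last by rewrite band_unit_neq // scale0r.
have [le|lt] := leqP z x; first by rewrite band_unitM.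
by rewrite [E z x]band_unit_gt // mulr0.
Qed.

Lemma band_scal_eq0 (M : lmodType N) c (m : M) : sc c *: m = 0 -> m != 0 -> c = 0.
Proof.
move=> e m0; apply/eqP; apply: contraNT m0 => c0; apply/eqP.
by rewrite -[m]scale1r -(band_scal1 N) -(mulVf c0) -band_scalM -scalerA e scaler0.
Qed.

(** The elements E z x m that are nonzero form an upper segment of the vertices
up to x and are a basis of M. *)
Lemma cyclic_interval (M : lmodType N) (x : 'I_n) l (m : M) :
  E x x *: m = m -> (forall y, exists a : N, y = a *: m) -> has_length M l ->
  (l <= x.+1)%N /\ exists phi : {linear K (x.+1 - l) x.+1 -> M}, bijective phi.
Proof.
move=> Em gen hl.
pose P c := (c <= x.+1)%N && [forall z : 'I_n, (c <= z <= x)%N ==> (E z x *: m != 0)].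
have exP : exists c, P c.
  by exists x.+1; rewrite /P leqnn; apply/forallP => z; apply/implyP; lia.
case: (ex_minnP exP) => c /andP[cx /forallP cz] cmin.
have mc (z : 'I_n) : (z < c)%N -> E z x *: m = 0.
  move=> zc; have c0 : (0 < c)%N by lia.
  have : ~~ P c.-1 by apply/negP => /cmin; lia.
  rewrite /P negb_and => /orP[|]; first by lia.
  rewrite negb_forall => /existsP[t]; rewrite negb_imply negbK =>
    /andP[/andP[t1 t2] /eqP et].
  have tc : t = c.-1 :> nat.
    apply/eqP; rewrite eqn_leq t1 andbT leqNgt; apply/negP => lt.
    by have := cz t; rewrite et eqxx t2 andbT; case: leqP => //=; lia.
  by rewrite -(@band_unitM _ _ _ _ z t x) ?t2 //; [rewrite -scalerA et scaler0 | lia].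
have dcr : (x.+1 <= c + r)%N.
  rewrite ltnNge; apply/negP => ge; have lt : (c < n)%N by have := ltn_ord x; lia.
  have := cz (Ordinal lt); rewrite leqnn /= band_unit_far ?scale0r ?eqxx;
    last by rewrite /in_band /=; lia.
  by have -> : (c <= x)%N by lia.
have [phi phiE] := @hom_of_elt k n r N c x.+1 x erefl dcr M m mc.
have phi_bij : bijective phi.
  have inj f : phi f = 0 -> f = 0.
    move=> e; apply: icoordP => z; rewrite icoord0.
    have [Cz|nz] := boolP (in_interval r c x.+1 z); last by rewrite icoord_out.
    have : E z z *: phi f = 0 by rewrite e scaler0.
    rewrite phiE scaler_sumr (bigD1 z) //= big1 => [|y ne].
      rewrite addr0 scalerA band_scal_comm -scalerA band_unit_idl eqxx => /band_scal_eq0;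
        apply.
      by have := cz z; move: Cz => /and3P[-> ? ?]; rewrite /= -ltnS => /implyP; apply.
    by rewrite scalerA band_scal_comm -scalerA band_unit_idl eq_sym (negPf ne) scaler0.
  have surj y : exists f, phi f = y.
    have [a ->] := gen y; exists (ibuild r c x.+1 (fun z => nco a z x)).
    rewrite phiE -[in RHS]Em scalerA mul_band_unitr // scaler_suml; apply: eq_bigr => z _.
    rewrite icoord_build -scalerA; have [//|nz] := boolP (in_interval r c x.+1 z).
    rewrite band_scal0 scale0r; have [lt|ge] := ltnP z c; first by rewrite mc // scaler0.
    by rewrite band_unit_gt ?scale0r ?scaler0 //; move: nz; rewrite /in_interval ge /=; lia.
  have [g gK] := choice surj; exists g => // f.
  by apply/eqP; rewrite -subr_eq0; apply/eqP/inj; rewrite linearB gK subrr.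
have lE : l = (x.+1 - c)%N.
  exact: (@interval_module_length k n r N c x.+1 (ltn_ord x) dcr cx l (has_length_iso
    phi_bij hl)).
split; first by rewrite lE leq_subr.
have -> : (x.+1 - l)%N = c by rewrite lE subKn.
by exists phi.
Qed.

Lemma length_top_interval (M S : lmodType N) (x : 'I_n) l :
  has_length M l -> simple_module S -> (exists s : S, E x x *: s != 0) -> has_top M S ->
  (l <= x.+1)%N /\ exists phi : {linear K (x.+1 - l) x.+1 -> M}, bijective phi.
Proof.
move=> hl Ss [s s0] [f [fs frad]]; have [m0 em0] := fs s.
pose m := E x x *: m0.
apply: (@cyclic_interval M x l m) => //; first by rewrite /m band_unit_idr.
pose W : {pred M} := fun y => `[< exists a : N, y = a *: m >].
have Wsub : submod_closed W.
  split; first by apply/asboolP; exists 0; rewrite scale0r.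
  move=> a y y' /asboolP[b ->] /asboolP[b' ->]; apply/asboolP; exists (a * b + b').
  by rewrite scalerDl scalerA.
move=> y; apply/asboolP; apply: (top_generates hl Ss fs frad Wsub (m := m)).
  by apply/asboolP; exists 1; rewrite scale1r.
by rewrite linearZ /= em0.
Qed.

Section Hull.
Variables (M : fgModule N) (x : 'I_n).
Hypotheses (r0 : (0 < r)%N) (Mind : indecomposable M) (Minj : injective_module M).
Variables (S : lmodType N) (f : {linear S -> M}).
Hypotheses (Ss : simple_module S) (Sx : exists s : S, E x x *: s != 0) (finj : injective f).

(** A generator of the image of the simple module S. Paths that leave x
annihilate it, because the elements of S that are supported below x form a
proper submodule. *)
Lemma hull_socle : exists m : M, [/\ E x x *: m = m, m != 0 &
  forall z : 'I_n, (z < x)%N -> E z x *: m = 0].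
Proof.
have [s s0] := Sx; exists (f (E x x *: s)); split.
- by rewrite -linearZ /= band_unit_idr.
- by rewrite -(linear0 f) (inj_eq finj).
move=> z lt; rewrite -linearZ /= band_unit_idr.
suff -> : E z x *: s = 0 by rewrite linear0.
pose U : {pred S} := fun t => `[< forall y : 'I_n, (x <= y)%N -> E y y *: t = 0 >].
have [|U0|UT] := Ss.2 U.
- split; first by apply/asboolP => y _; rewrite scaler0.
  move=> a t t' /asboolP ht /asboolP ht'; apply/asboolP => y le.
  rewrite scalerDr ht' // addr0 scalerA mul_band_unitl // scaler_suml big1 // => w _.
  have [lw|lt'] := leqP y w; last by rewrite band_coef_gt // band_scal0 mul0r scale0r.
  by rewrite -scalerA -band_unit_idr ht ?scaler0 //; apply: leq_trans lw.
- apply/eqP; rewrite -[_ == 0]/(_ \in pred1 0) -U0; apply/asboolP => y le.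
  by rewrite band_unit_idl; case: eqP => // e; move: lt; rewrite -e; lia.
have /asboolP/(_ x (leqnn _))/eqP : s \in U by rewrite UT.
by rewrite (negPf s0).
Qed.

(** Both M and K x n are injective and contain the simple module at x. The
inclusion of this socle extends to K x n -> M, which is injective because every
nonzero submodule of K x n contains the socle. It splits because K x n is
injective, and M is indecomposable. *)
Lemma injective_hull_interval : exists phi : {linear K x n -> M}, bijective phi.
Proof.
have [m [Em m0 mz]] := hull_socle.
have xr : (x.+1 <= x + r)%N by lia.
have [g gE] := @hom_of_elt k n r N x x.+1 x erefl xr M m mz.
have lexn : sub_interval x x.+1 x n by rewrite /sub_interval leqnn ltn_ord.
have sub (y : 'I_n) : in_interval r x x.+1 y -> in_interval r x n y.
  by move=> /and3P[a _ b]; apply/and3P; split.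
have [|h hE] := Minj (f := interval_map N x x.+1 x n) g.
  move=> a b e; apply: icoordP => z.
  have [Cz|nz] := boolP (in_interval r x x.+1 z); last by rewrite !icoord_out.
  by have := congr1 (fun t => icoord t z) e; rewrite !icoord_map lexn sub.
have Cx : in_interval r x x.+1 x by rewrite /in_interval leqnn leqnn; lia.
have hd : h (idelta k r x n x) = m.
  have -> : idelta k r x n x = interval_map N x x.+1 x n (idelta k r x x.+1 x).
    apply: icoordP => z; rewrite icoord_map !icoord_delta lexn Cx (sub _ Cx) /=.
    by case: eqP => [->|]; rewrite ?(sub _ Cx) ?if_same.
  rewrite hE gE (bigD1 x) //= big1 => [|z ne].
    by rewrite icoord_delta Cx eqxx band_scal1 scale1r Em addr0.
  by rewrite icoord_delta (negPf ne) if_same band_scal0 scale0r.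
have hinj j : h j = 0 -> j = 0.
  move=> e; apply: icoordP => z; rewrite icoord0.
  have [Cz|nz] := boolP (in_interval r x n z); last by rewrite icoord_out.
  have : E x z *: h j = 0 by rewrite e scaler0.
  rewrite -linearZ /=; have -> : E x z *: j = sc (icoord j z) *: idelta k r x n x.
    apply: icoordP => y; rewrite icoord_scal icoord_unit icoord_delta (sub _ Cx) /=.
    have -> : (x <= z)%N by move: Cz => /and3P[].
    by rewrite andbT; case: eqP; rewrite ?mulr1 ?mulr0.
  by rewrite linearZ /= hd => /band_scal_eq0; apply.
have [||||p pE] := @interval_module_injective k n r N x n _ M (fun y j => h j = y).
- exact: geq_minl.
- by move=> a j y j' y' <- <-; rewrite linearP.
- exact: linear0.
- by move=> j; apply: hinj.
have pK j : p (h j) = j by apply: pE.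
have tP y : exists t : kermod p, val t = y - h (p y).
  by apply: kermodP; rewrite linearB pK subrr.
have [t tE] := choice tP.
have split_lin : linear (fun y => (p y, t y) : K x n * kermod p).
  move=> a y y'; apply: injective_projections => /=; first exact: linearP.
  apply: val_inj; rewrite -[RHS]/(ker_incl p (a *: t y + t y')) linearP /= !tE.
  by rewrite !linearP addrACA -scalerDr.
have split_bij : bijective (mk_linear split_lin).
  exists (fun q => h q.1 + val q.2) => [y|[j w]] /=.
    by rewrite tE addrC subrK.
  apply: injective_projections => /=; first by rewrite linearD pK (kermod0 w) addr0.
  by apply: val_inj; rewrite tE linearD pK (kermod0 w) addr0 addrC addKr.
case: Mind => _ /(_ _ _ _ split_bij)[tK|tker].
  have := tK (idelta k r x n x) => /(congr1 (fun y => icoord y x)).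
  by rewrite icoord_delta (sub _ Cx) eqxx icoord0 => /eqP; rewrite oner_eq0.
exists h; exists p => // y.
by apply/eqP; rewrite eq_sym -subr_eq0 -tE (tker (t y)).
Qed.
End Hull.
End Uniqueness.

(** * Generation *)

Section Devissage.
Variables (k : fieldType) (n r : nat) (N : band_algebra k n r).
Local Notation nco := (@band_coef k n r N).
Local Notation E := (@band_unit k n r N).
Local Notation sc := (@band_scal k n r N).
Local Notation K := (interval_module N).
Hypothesis r0 : (0 < r)%N.

(** A module supported at the vertices up to o maps onto its space at o, which is
a sum of copies of the simple module there. *)
Section TopVertex.
Variables (M : fgModule N) (o : 'I_n).
Hypothesis Mo : forall (z : 'I_n) (m : M), (o < z)%N -> E z z *: m = 0.

Lemma band_unit_top (a : N) (m : M) : E o o *: (a *: m) = sc (nco a o o) *: (E o o *: m).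
Proof.
rewrite [LHS]scalerA mul_band_unitl // scaler_suml (bigD1 o) //= big1 => [|w ne].
  by rewrite addr0 scalerA.
have [lw|lt] := leqP w o; last by rewrite -scalerA -band_unit_idr Mo // !scaler0.
by rewrite band_coef_gt ?band_scal0 ?mul0r ?scale0r // ltn_neqAle ne lw.
Qed.

Definition spans_vertex (I : finType) (b : I -> M) : Prop :=
  (forall i, E o o *: b i = b i) /\
  forall m, exists e : I -> k, E o o *: m = \sum_i sc (e i) *: b i.

Lemma top_spanned : exists (I : finType) (b : I -> M), spans_vertex b.
Proof.
have [J [g gP]] := fgP M.
exists ('I_n * J)%type, (fun t => E o t.1 *: g t.2); split=> [t|m].
  by rewrite band_unit_idl eqxx.
have [a ->] := gP m; exists (fun t => nco (a t.2) o t.1).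
rewrite scaler_sumr -(pair_bigA _ (fun w j => sc (nco (a j) o w) *: (E o w *: g j))) /=.
rewrite exchange_big; apply: eq_bigr => j _.
rewrite scalerA mul_band_unitl // scaler_suml; apply: eq_bigr => w _.
by rewrite scalerA.
Qed.

(** A spanning family of minimal size is a basis. *)
Lemma top_basis : exists (I : finType) (b : I -> M), spans_vertex b /\
  forall e : I -> k, \sum_i sc (e i) *: b i = 0 -> forall i, e i = 0.
Proof.
pose Q s := `[< exists (I : finType) (b : I -> M), #|I| = s /\ spans_vertex b >].
have exQ : exists s, Q s.
  by have [I [b bs]] := top_spanned; exists #|I|; apply/asboolP; exists I, b.
case: (ex_minnP exQ) => s /asboolP[I [b [cI [bE bs]]]] smin.
exists I, b; split=> // e e0 i0; apply: contrapT => /eqP ei0.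
have : Q #|{: {i in predC1 i0}}|.
  apply/asboolP; exists {i in predC1 i0}, (fun t => b (val t)); split=> //.
  split=> [t|m]; first exact: bE.
  have [f ->] := bs m; pose c := f i0 / e i0.
  exists (fun t => f (val t) - c * e (val t)).
  rewrite -(big_sub (predC1 i0) (fun i => sc (f i - c * e i) *: b i)).
  transitivity (\sum_i sc (f i - c * e i) *: b i).
    under [RHS]eq_bigr do rewrite band_scalD band_scalN -band_scalM scalerDl scaleNr
      -scalerA.
    by rewrite sumrB -scaler_sumr e0 scaler0 subr0.
  rewrite (bigD1 i0) //= /c divfK // subrr band_scal0 scale0r add0r.
  by apply: eq_bigl => i; rewrite inE.
have I0 : (0 < #|I|)%N by apply/card_gt0P; exists i0.
have -> : #|{: {i in predC1 i0}}| = #|I|.-1.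
  by rewrite card_sig -(cardC1 i0); apply: eq_card.
by move/smin; rewrite -cI; lia.
Qed.

Lemma top_quotient : exists (I : finType) (g : {linear M -> fg_dsum (fun _ : I =>
  K o o.+1)}),
  (forall y, exists x, g x = y) /\ (forall m, g m = 0 <-> E o o *: m = 0).
Proof.
have [I [b [[bE bs] bfree]]] := top_basis; exists I.
have [e eE] := choice bs.
have uniq m (f : I -> k) : E o o *: m = \sum_i sc (f i) *: b i -> forall i, e m i = f i.
  move=> h i; apply/eqP; rewrite -subr_eq0; apply/eqP.
  apply: (bfree (fun i => e m i - f i)).
  under eq_bigr do rewrite band_scalD band_scalN scalerDl scaleNr.
  by rewrite sumrB -eE -h subrr.
have Co : in_interval r o o.+1 o by rewrite /in_interval leqnn leqnn; lia.
have Cz z : in_interval r o o.+1 z -> z = o.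
  by move=> /and3P[h1 h2 _]; apply: val_inj => /=; lia.
pose G (m : M) : fg_dsum (fun _ : I => K o o.+1) :=
  finfun (fun i => ibuild r o o.+1 (fun=> e m i)).
have GE m i z : icoord (G m i) z = if in_interval r o o.+1 z then e m i else 0.
  by rewrite ffunE icoord_build.
have Glin : linear G.
  move=> a m m'; apply: dprojP => i; rewrite linearP; apply: icoordP => z /=.
  rewrite icoordD icoordZ !GE; case: ifP => [/Cz->|_]; last by rewrite addr0.
  rewrite (uniq _ (fun i => nco a o o * e m i + e m' i)).
    congr (_ + _); rewrite (bigD1 o) //= GE Co big1 ?addr0 // => w ne.
    by rewrite GE; case: ifP => [/Cz ew|]; rewrite ?mulr0 // ew eqxx in ne *.
  rewrite scalerDr band_unit_top !eE scaler_sumr -big_split; apply: eq_bigr => j _.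
  by rewrite band_scalD -band_scalM scalerDl scalerA.
exists (mk_linear Glin); split.
  move=> y; exists (\sum_i sc (icoord (y i) o) *: b i); apply: dprojP => i /=.
  apply: icoordP => z; rewrite GE; case: ifP => [/Cz->|/negbT nz];
    last by rewrite icoord_out.
  apply: (uniq _ (fun i => icoord (y i) o)); rewrite scaler_sumr; apply: eq_bigr => j _.
  by rewrite scalerA band_scal_comm -scalerA bE.
move=> m; split=> [/= h|h].
  rewrite eE big1 // => i _; have := congr1 (fun y : fg_dsum (fun _ : I => K o o.+1) =>
    icoord (y i) o) h.
  by rewrite GE Co ffunE icoord0 => ->; rewrite band_scal0 scale0r.
apply: dprojP => i; rewrite linear0 /=; apply: icoordP => z; rewrite GE icoord0.
case: ifP => // _; apply: (uniq _ (fun=> 0)).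
by rewrite h big1 // => j _; rewrite band_scal0 scale0r.
Qed.
End TopVertex.

Section ThickModules.
Variable P : complex N -> Prop.
Hypothesis thP : thick_subcategory P.

(** The matrix units that do not end at o, applied to generators of M, generate
the kernel. *)
Lemma ker_fg (M : fgModule N) (o : 'I_n) (L : lmodType N) (g : {linear M -> L}) :
  (forall m, g m = 0 <-> E o o *: m = 0) -> finitely_generated (kermod g).
Proof.
move=> gE; have [J [f fP]] := fgP M.
have tP (t : 'I_n * 'I_n * J) : exists y : kermod g,
    val y = if t.1.1 != o then E t.1.1 t.1.2 *: f t.2 else 0.
  apply: kermodP; case: ifP => [ne|_]; last exact: linear0.
  by apply/gE; rewrite band_unit_idl eq_sym (negPf ne).
have [h hE] := choice tP; exists ('I_n * 'I_n * J)%type, h => y.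
have [a ea] := fP (val y).
exists (fun t => sc (nco (a t.2) t.1.1 t.1.2)); apply: val_inj.
rewrite -[RHS]/(ker_incl g _) linear_sum.
have y0 : E o o *: val y = 0 by apply/gE/kermod0.
rewrite [LHS]band_unit_split; transitivity (\sum_z \sum_w \sum_j
    (if z != o then sc (nco (a j) z w) *: (E z w *: f j) else 0)).
  apply: eq_bigr => z _; have [->|ne] := eqVneq z o.
    by rewrite y0 big1 // => w _; rewrite big1.
  rewrite ea scaler_sumr exchange_big; apply: eq_bigr => j _.
  rewrite scalerA mul_band_unitl // scaler_suml; apply: eq_bigr => w _.
  by rewrite scalerA.
rewrite pair_bigA pair_bigA; apply: eq_bigr => -[[z w] j] _ /=.
by rewrite hE /=; case: ifP; rewrite ?scaler0.
Qed.

Hypothesis simpleP : forall z : 'I_n, P (stalk (K z z.+1)).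

Lemma thick_zero (M : fgModule N) : (0 < n)%N -> trivial_module M -> P (stalk M).
Proof. by move=> n0; apply: thick_stalk_trivial (simpleP (Ordinal n0)). Qed.

(** Peel off the highest vertex of the support. *)
Lemma thick_all_modules (M : fgModule N) : (0 < n)%N -> P (stalk M).
Proof.
move=> n0.
suff H y : (y <= n)%N -> forall L : fgModule N,
    (forall (z : 'I_n) (m : L), (y <= z)%N -> E z z *: m = 0) -> P (stalk L).
  by apply: (H n) => // z m; rewrite leqNgt ltn_ord.
elim: y => [_|y IH lt] L Lz.
  apply: thick_zero => // m; rewrite [m]band_unit_split big1 // => z _.
  exact: Lz.
pose o : 'I_n := Ordinal lt.
have [I [g [gs g0]]] := top_quotient (Lz : forall (z : 'I_n) (m : L), (o < z)%N -> E z z *: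
  m = 0).
pose Lker : fgModule N := FgModule (ker_fg g0).
apply: (thick_ses_mid thP (f := stalk_map (ker_incl g : {linear Lker -> L})) (g :=
  stalk_map g)).
- apply: stalk_ses => //.
  + by move=> a b /= /val_inj.
  + by move=> a; apply: kermod0.
  + by move=> a /kermodP[b <-]; exists b.
- apply: IH => [|z m le]; first exact: ltnW.
  apply: val_inj; rewrite -[LHS]/(ker_incl g (E z z *: m)) linearZ linear0 /=.
  move: le; rewrite leq_eqVlt => /orP[/eqP e|]; last exact: Lz.
  have -> : z = o by apply: val_inj; rewrite /= e.
  exact/g0/kermod0.
by apply: (thick_dsum thP (simpleP o)) => i; apply: simpleP.
Qed.
End ThickModules.

Lemma interval_ses c y d : (c <= y <= d)%N -> (d <= c + r)%N ->
  short_exact (stalk_map (interval_map N c y c d)) (stalk_map (interval_map N c d y d)).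
Proof.
move=> /andP[cy yd] dcr.
have s1 : sub_interval c y c d by rewrite /sub_interval leqnn.
have s2 : sub_interval c d y d by rewrite /sub_interval leqnn cy.
have inKE (z : 'I_n) : [/\ in_interval r c y z = (c <= z < y)%N,
  in_interval r c d z = (c <= z < d)%N &
    in_interval r y d z = (y <= z < d)%N].
  by rewrite /in_interval; split; apply/idP/idP; lia.
apply: stalk_ses.
- move=> f g e; apply: icoordP => z; have [i1 i2 i3] := inKE z.
  have [Cz|nz] := boolP (in_interval r c y z); last by rewrite !icoord_out.
  have := congr1 (fun t => icoord t z) e; rewrite !icoord_map s1 i2.
  by have -> : (c <= z < d)%N by move: Cz; rewrite i1; lia.
- move=> f; exists (ibuild r c d (icoord f)); apply: icoordP => z; have [i1 i2 i3] :=
  inKE z.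
  rewrite icoord_map s2 /= icoord_build i2 i3.
  have [Cz|nz] := boolP (y <= z < d)%N; last by rewrite icoord_out // i3.
  by have -> : (c <= z < d)%N by lia.
- move=> f; apply: icoordP => z; have [i1 i2 i3] := inKE z;
  rewrite !icoord_map s1 s2 /= icoord0 i2 i3.
  case: ifP => // h; case: ifP => // _; rewrite icoord_out // i1; lia.
move=> f e; exists (ibuild r c y (icoord f)); apply: icoordP => z; have [i1 i2 i3] :=
  inKE z.
rewrite icoord_map s1 /= icoord_build i1 i2.
have [Cz|nz] := boolP (c <= z < d)%N; last by rewrite icoord_out ?i2.
have [//|ge] := boolP (c <= z < y)%N.
have := congr1 (fun t => icoord t z) e; rewrite icoord_map s2 i3 icoord0.
by have -> : (y <= z < d)%N by lia.
Qed.

(** Successive intervals [u, u + j) give the simple modules from u on. Below u,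
the simple module at z is the kernel of the map from [z, z + r) to [z + 1, z +
r), and the latter is filtered by simple modules at larger vertices. *)
Lemma thick_from_intervals (P : complex N -> Prop) (u : nat) :
  thick_subcategory P -> (u < n)%N -> (n <= u + r)%N ->
  (forall j, (0 < j <= n - u)%N -> P (stalk (K u (u + j)))) ->
  (forall i, (i < u)%N -> P (stalk (K i (i + r)))) ->
  forall X, P X.
Proof.
move=> thP un nur PX Pt; apply: (thick_of_stalks thP) => M.
apply: (thick_all_modules thP); last by lia.
have PX1 : P (stalk (K u (u + 1))) by apply: PX; lia.
have P0 c d : (d <= c)%N -> P (stalk (K c d)).
  by move=> le; apply: (thick_stalk_trivial thP PX1); apply: interval_module_trivial.
have high j : (u + j < n)%N -> P (stalk (K (u + j) (u + j).+1)).
  move=> lt; apply: (thick_ses_coker thP (@interval_ses u (u + j) (u + j).+1 _ _)); try lia.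
    by case: (j) lt => [|j'] lt; [apply: P0; lia | apply: PX; lia].
  by rewrite -addnS; apply: PX; lia.
have low m : (m <= u)%N -> forall z, (u - m <= z < n)%N -> P (stalk (K z z.+1)).
  elim: m => [_|m IH lt] z /andP[le ltn].
    by have -> : z = (u + (z - u))%N; [lia | apply: high; lia].
  have [ge|lt'] := leqP (u - m) z; first by apply: IH; lia.
  have Pz d : P (stalk (K z.+1 (z.+1 + d))) \/ (z.+1 + r < z.+1 + d)%N.
    elim: d => [|d [IHd|]]; [by left; apply: P0; lia| |by right; lia].
    have [le'|] := leqP d.+1 r; last by right; lia.
    left; have [le2|ge2] := ltnP (z.+1 + d) n.
      apply: (thick_ses_mid thP (@interval_ses z.+1 (z.+1 + d) (z.+1 + d.+1) _ _) IHd);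
        try lia.
      by rewrite addnS; apply: IH; lia.
    apply: (thick_ses_mid thP (@interval_ses z.+1 (z.+1 + d) (z.+1 + d.+1) _ _) IHd);
      try lia.
    apply: (thick_stalk_trivial thP PX1) => x; apply: icoordP => t.
    by have lt2 := ltn_ord t; rewrite icoord0 icoord_out // /in_interval; lia.
  apply: (thick_ses_ker thP (@interval_ses z z.+1 (z + r) _ _)); try lia.
    by apply: Pt; lia.
  by have [|] := Pz r.-1; [rewrite addSnnS prednK | lia].
by move=> z; apply: (low u) => //; rewrite ltn_ord; lia.
Qed.
End Devissage.

(** * Projective resolutions of interval modules *)

Section ThreeTerm.
Variables (A : pzRingType) (T Q0 Q1 Q2 : fgModule A).
Variables (d2 : {linear Q2 -> Q1}) (d1 : {linear Q1 -> Q0}) (q0 : {linear Q0 -> T}).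
Hypotheses (d12 : forall x, d1 (d2 x) = 0) (q01 : forall x, q0 (d1 x) = 0).

Definition three_term_obj (i : int) : fgModule A :=
  match i with
  | Posz 0 => Q0 | Negz 0 => Q1 | Negz 1 => Q2 | _ => fg_zero A
  end.

Definition three_term_diff (i j : int) : {linear three_term_obj i -> three_term_obj j} :=
  match i as i', j as j' return {linear three_term_obj i' -> three_term_obj j'} with
  | Negz 0, Posz 0 => d1
  | Negz 1, Negz 0 => d2
  | _, _ => \0
  end.

Lemma three_term_shape i j x : j != i + 1 -> three_term_diff i j x = 0.
Proof. by case: i x => [[|i]|[|[|i]]] x; case: j => [[|j]|[|[|j]]]. Qed.

Lemma three_term_sq i j l x : three_term_diff j l (three_term_diff i j x) = 0.
Proof.
by case: i x => [[|i]|[|[|i]]] x; case: j => [[|j]|[|[|j]]] => //=;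
  case: l => [[|l]|[|[|l]]] => //=; rewrite ?linear0.
Qed.

Lemma three_term_bounded : exists m : nat, forall i : int, (m < `|i|)%N ->
  trivial_module (three_term_obj i).
Proof.
exists 2%N => -[[|i]|[|[|i]]] //= _ x; by rewrite [x]thinmx0 [RHS]thinmx0.
Qed.

Definition three_term : complex A :=
  Complex three_term_shape three_term_sq three_term_bounded.

Definition aug_fun (i : int) : {linear three_term i -> stalk T i} :=
  match i as i' return {linear three_term_obj i' -> stalk_obj T i'} with
  | Posz 0 => q0
  | _ => \0
  end.

Lemma aug_comm i j (x : three_term i) :
  aug_fun j (cdiff three_term i j x) = cdiff (stalk T) i j (aug_fun i x).
Proof.
rewrite /=; case: i x => [[|i]|[|[|i]]] x; case: j => [[|j]|[|[|j]]] => //=;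
by rewrite ?linear0.
Qed.

Definition augmentation : cmap three_term (stalk T) := CMap aug_comm.

Hypotheses (q0s : forall y, exists x, q0 x = y)
  (ex0 : forall x, q0 x = 0 -> exists y, x = d1 y)
  (ex1 : forall x, d1 x = 0 -> exists y, x = d2 y)
  (ex2 : forall x, d2 x = 0 -> x = 0).

Lemma augmentation_qis : quasi_iso augmentation.
Proof.
have cob0 (X : complex A) i : coboundary (0 : X i).
  by exists 0; rewrite linear0.
have z0 (x : fg_zero A) : x = 0 by rewrite [x]thinmx0 [RHS]thinmx0.
case=> [[|i]|[|[|i]]].
- split=> [x _ [y] /ex0[y' ->]|y _].
    exact: (@coboundary_diff A three_term 0 (Negz 0) y').
  by have [x ex] := q0s y; exists x => //; rewrite /= ex subrr; apply: cob0.
- by split=> [x _ _|y _]; [rewrite (z0 x); apply: cob0 | exists 0;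
  rewrite /cocycle ?linear0 // [_ - _]z0; apply: cob0].
- split=> [x /= cx _|y _].
    have [y ->] := ex1 cx; exact: (@coboundary_diff A three_term (Negz 0) (Negz 1) y).
  by exists 0; rewrite /cocycle ?linear0 // [_ - _]z0; apply: cob0.
- split=> [x /= cx _|y _].
    by rewrite (ex2 cx); apply: cob0.
  by exists 0; rewrite /cocycle ?linear0 // [_ - _]z0; apply: cob0.
by split=> [x _ _|y _]; [rewrite (z0 x); apply: cob0 | exists 0;
  rewrite /cocycle ?linear0 // [_ - _]z0; apply: cob0].
Qed.

Lemma rel_projective_zero : rel_projective (fg_zero A).
Proof.
move=> Z R linR totR; exists \0 => x /=.
have [z Rz] := totR 0; have := linR (-1) _ _ _ _ Rz Rz.
by rewrite !scaleN1r !addNr [x]thinmx0.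
Qed.

Lemma three_term_projective : rel_projective Q0 -> rel_projective Q1 -> rel_projective Q2 ->
  forall i, rel_projective (three_term i).
Proof. by move=> h0 h1 h2 [[|i]|[|[|i]]] //=; apply: rel_projective_zero. Qed.
End ThreeTerm.

(** A map that kills the boundaries of an exact degree is well defined on the
image of the differential, and extends from there. *)
Lemma ext_into_injective (A : pzRingType) (Q : complex A) (T J : fgModule A)
    (q : cmap Q (stalk T)) m (c : {linear Q m -> J}) :
  quasi_iso q -> rel_injective J -> m != 0 ->
  (forall j x, c (cdiff Q j m x) = 0) ->
  exists g : {linear Q (m + 1) -> J}, forall x, c x = g (cdiff Q m (m + 1) x).
Proof.
move=> qq Jinj m0 cd.
have [|||g gE] := Jinj (Q (m + 1)) (fun y j => exists x,
  y = cdiff Q m (m + 1) x /\ j = c x).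
- move=> a y j y' j' [x [-> ->]] [x' [-> ->]]; exists (a *: x + x').
  by rewrite !linearP.
- by exists 0; rewrite !linear0.
- move=> j [x [/esym cx ->]].
  have [|y ->] := (qq m).1 x cx; last exact: cd.
  by exists 0; rewrite linear0; apply: stalk_neq0.
by exists g => x; rewrite (gE _ (c x)) //; exists x.
Qed.

Section IntervalResolution.
Variables (k : fieldType) (n r : nat) (N : band_algebra k n r).
Local Notation E := (@band_unit k n r N).
Local Notation K := (interval_module N).
Variables (V : finType) (cs ds : V -> nat) (u : nat).
(** The summands K (cs s) (ds s) start at or below u and either are injective or
start exactly at u. *)
Hypotheses (csu : forall s, (cs s <= u)%N) (ur : (u <= r)%N)
  (cds : forall s, (cs s <= ds s)%N) (dsn : forall s, (ds s <= n)%N)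
  (dsr : forall s, (ds s <= cs s + r)%N)
  (inj_or : forall s, (minn n (cs s + r) <= ds s)%N \/ cs s = u).
Local Notation D := (fg_dsum (fun s => K (cs s) (ds s))).
Variables (T : fgModule N) (tau : {linear T -> D}) (tau' : {linear D -> T}).
Hypotheses (tauK : cancel tau tau') (tau'K : cancel tau' tau).

Local Notation R0 := (fg_dsum (fun s => K (ds s - r) (ds s))).
Local Notation R1 := (fg_dsum (fun s => K 0 (cs s))).
Local Notation R2 := (fg_dsum (fun s => K 0 (ds s - r))).

Definition res2 : {linear R2 -> R1} :=
  dsum_map (fun s => interval_map N 0 (ds s - r) 0 (cs s)).
Definition res1 : {linear R1 -> R0} :=
  dsum_map (fun s => interval_map N 0 (cs s) (ds s - r) (ds s)).
Definition res0 : {linear R0 -> T} :=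
  tau' \o dsum_map (fun s => interval_map N (ds s - r) (ds s) (cs s) (ds s)).

Lemma res_sub s : [/\ sub_interval 0 (ds s - r) 0 (cs s),
  sub_interval 0 (cs s) (ds s - r) (ds s) &
  sub_interval (ds s - r) (ds s) (cs s) (ds s)].
Proof.
by rewrite /sub_interval; have := csu s; have := cds s; have := dsr s; split; lia.
Qed.

Lemma res_inK s (z : 'I_n) : [/\ in_interval r 0 (ds s - r) z = (z < ds s - r)%N,
  in_interval r 0 (cs s) z = (z < cs s)%N,
  in_interval r (ds s - r) (ds s) z = (ds s - r <= z < ds s)%N &
  in_interval r (cs s) (ds s) z = (cs s <= z < ds s)%N].
Proof.
have := csu s; have := cds s; have := dsr s => h1 h2 h3.
by rewrite /in_interval; split; apply/idP/idP; lia.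
Qed.

Lemma dsum_icoordP (c d : V -> nat) (x y : fg_dsum (fun s => K (c s) (d s))) :
  (forall s z, icoord (dproj _ s x) z = icoord (dproj _ s y) z) -> x = y.
Proof. by move=> h; apply: dprojP => s; apply: icoordP => z; apply: h. Qed.

Lemma res12 x : res1 (res2 x) = 0.
Proof.
apply: dsum_icoordP => s z; rewrite linear0 icoord0 !dproj_map !icoord_map.
have [s1 s2 _] := res_sub s; have [i1 i2 i3 _] := res_inK s z.
rewrite s1 s2 /= i2 i3; do 2![case: ifP => // ?].
by rewrite icoord_out // i1; lia.
Qed.

Lemma res01 x : res0 (res1 x) = 0.
Proof.
rewrite -[RHS](linear0 tau'); apply: (congr1 tau').
apply: dsum_icoordP => s z; rewrite linear0 icoord0 !dproj_map !icoord_map.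
have [_ s2 s3] := res_sub s; have [_ i2 i3 i4] := res_inK s z.
rewrite s2 s3 /= i3 i4; do 2![case: ifP => // ?].
by rewrite icoord_out // i2; lia.
Qed.

Definition dsum_ibuild (c d c' d' : V -> nat) (x : fg_dsum (fun s => K (c s) (d s))) :
    fg_dsum (fun s => K (c' s) (d' s)) :=
  finfun (fun s => ibuild r (c' s) (d' s) (icoord (x s))).

Lemma icoord_dsum_ibuild c d c' d' (x : fg_dsum (fun s => K (c s) (d s))) s z :
  icoord (dproj _ s (dsum_ibuild c' d' x)) z = if in_interval r (c' s) (d' s) z then icoord
    (dproj _ s x) z else 0.
Proof. by rewrite /= ffunE icoord_build. Qed.

Lemma res0_surj y : exists x, res0 x = y.
Proof.
exists (dsum_ibuild (fun s => ds s - r)%N ds (tau y)); rewrite -[RHS]tauK; apply: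
  (congr1 tau').
apply: dsum_icoordP => s z; rewrite dproj_map icoord_map icoord_dsum_ibuild.
have [_ _ s3] := res_sub s; have [_ _ i3 i4] := res_inK s z.
rewrite s3 /= i3 i4; case: ifP => [h|h]; last by rewrite icoord_out // i4 h.
by have -> : (ds s - r <= z < ds s)%N by have := dsr s; lia.
Qed.

Lemma res_ex0 x : res0 x = 0 -> exists y, x = res1 y.
Proof.
move=> e; exists (dsum_ibuild (fun=> 0%N) cs x).
have e' : dsum_map (fun s => interval_map N (ds s - r) (ds s) (cs s) (ds s)) x = 0.
  by apply: (can_inj tau'K); rewrite linear0.
apply: dsum_icoordP => s z; rewrite dproj_map icoord_map icoord_dsum_ibuild.
have [_ s2 s3] := res_sub s; have [_ i2 i3 i4] := res_inK s z.
rewrite s2 /= i2 i3; case: ifP => [h|h]; last by rewrite icoord_out // i3 h.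
case: ifP => // h'.
have := congr1 (fun y : D => icoord (dproj _ s y) z) e'.
rewrite dproj_map icoord_map s3 i4 linear0 icoord0.
by have -> : (cs s <= z < ds s)%N by lia.
Qed.

Lemma res_ex1 x : res1 x = 0 -> exists y, x = res2 y.
Proof.
move=> e; exists (dsum_ibuild (fun=> 0%N) (fun s => ds s - r)%N x).
apply: dsum_icoordP => s z; rewrite dproj_map icoord_map icoord_dsum_ibuild.
have [s1 s2 _] := res_sub s; have [i1 i2 i3 _] := res_inK s z.
rewrite s1 /= i1 i2; case: ifP => [h|h]; last by rewrite icoord_out // i2 h.
case: ifP => // h'.
have := congr1 (fun y : R0 => icoord (dproj _ s y) z) e.
rewrite dproj_map icoord_map s2 i3 linear0 icoord0.
by have -> : (ds s - r <= z < ds s)%N by have := cds s; lia.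
Qed.

Lemma res_ex2 x : res2 x = 0 -> x = 0.
Proof.
move=> e; apply: dsum_icoordP => s z; rewrite linear0 icoord0.
have [s1 _ _] := res_sub s; have [i1 i2 _ _] := res_inK s z.
have [h|h] := boolP (in_interval r 0 (ds s - r) z); last by rewrite icoord_out.
have := congr1 (fun y : R1 => icoord (dproj _ s y) z) e.
rewrite dproj_map icoord_map s1 i2 linear0 icoord0.
by have -> : (z < cs s)%N by have := dsr s; lia.
Qed.

Definition interval_res : complex N := three_term res12.
Definition interval_aug : cmap interval_res (stalk T) := augmentation res12 res01.

Lemma interval_aug_qis : quasi_iso interval_aug.
Proof.
exact: (augmentation_qis res12 res01 res0_surj res_ex0 res_ex1 res_ex2).
Qed.

Lemma interval_res_projective i : rel_projective (interval_res i).
Proof.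
apply: three_term_projective; apply: rel_projective_dsum => s; apply:
  interval_module_projective => //;
by have := csu s; have := cds s; have := dsn s; have := dsr s; lia.
Qed.

(** The syzygies of the summands are supported below u. *)
Lemma interval_res_low m (x : interval_res m) (z : 'I_n) : m != 0 -> (u <= z)%N ->
  E z z *: x = 0.
Proof.
have z0 (y : fg_zero N) : y = 0 by rewrite [y]thinmx0 [RHS]thinmx0.
have low d (y : fg_dsum (fun s => K 0 (d s))) : (forall s, (d s <= u)%N) ->
    (u <= z)%N -> E z z *: y = 0.
  move=> du uz; apply: dprojP => s; apply: icoordP => t;
    rewrite linearZ linear0 /= icoord0 icoord_unit.
  case: ifP => // _; rewrite icoord_out // /in_interval; have := du s; lia.
case: m x => [[|m]|[|[|m]]] x m0 uz.
- by [].
- exact: z0.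
- by apply: low.
- by apply: low => // s; have := csu s; have := dsr s; lia.
exact: z0.
Qed.

(** Maps into the injective summands extend, and the other summands vanish
below u. *)
Lemma interval_ext m (c : {linear interval_res m -> T}) : m != 0 ->
  (forall j x, c (cdiff interval_res j m x) = 0) ->
  exists g : {linear interval_res (m + 1) -> T},
    forall x, c x = g (cdiff interval_res m (m + 1) x).
Proof.
move=> m0 cd.
have gP s : {g : {linear interval_res (m + 1) -> K (cs s) (ds s)} |
    forall x, dproj _ s (tau (c x)) = g (cdiff interval_res m (m + 1) x)}.
  apply: cid; case: (inj_or s) => [le|eu].
    pose c' : {linear interval_res m -> K (cs s) (ds s)} := dproj _ s \o tau \o c.
    have [|g gE] := @ext_into_injective _ _ _ (K (cs s) (ds s)) _ m c'
      interval_aug_qis (interval_module_injective le) m0; last by exists g.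
    by move=> j x; rewrite /c' /= cd linear0 ffunE.
  exists \0 => x; apply: icoordP => z; rewrite icoord0.
  have [lt|ge] := ltnP z u; first by rewrite icoord_out // /in_interval; lia.
  have : icoord (E z z *: dproj _ s (tau (c x))) z = 0.
    by rewrite -!linearZ interval_res_low // !linear0 icoord0.
  by rewrite icoord_unit eqxx leqnn andbT; case: ifP => // /negbT/icoord_out.
exists (tau' \o into_dsum (fun s => sval (gP s))) => x /=.
rewrite -[LHS]tauK; apply: (congr1 tau'); apply: dprojP => s.
by rewrite dproj_into -(svalP (gP s)).
Qed.
End IntervalResolution.

(** * The branch extension algebra *)

Section BranchQuiver.
Variables (u v : nat).
Hypotheses (u0 : (0 < u)%N) (v0 : (0 < v)%N).
Local Notation V := (branch_vertex v u).
Local Notation adj := (@branch_adj v u).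
Local Notation vt := (@vt v u).
Local Notation vb := (@vb v u).
Local Notation vc := (@vc v u).

(** The ends of the interval of the summand of T that belongs to the vertex s.
*)
Definition branch_lo (s : V) : nat :=
  match s with inl (inl i) => i | _ => u end.
Definition branch_hi (s : V) : nat :=
  match s with
  | inl (inl i) => i + (u + v + 1) | inl (inr i) => u + v + i + 1 | inr i => u + i + 1
  end%N.
Definition branch_le (s t : V) : bool :=
  (branch_lo s <= branch_lo t)%N && (branch_hi s <= branch_hi t)%N.

(** Every arrow raises this number by 1, so parallel paths have the same
length. *)
Definition branch_rank (s : V) : nat :=
  match s with
  | inl (inl i) => v.-1 + i | inl (inr i) => v + i | inr i => i
  end%N.

Lemma adj_le s t : adj s t -> branch_le s t.
Proof.
rewrite /branch_le; case: s t => [[i|i]|i] [[j|j]|j] //=;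
have := ltn_ord i; [lia | move=> h /eqP->; lia | lia | lia | lia].
Qed.

Lemma adj_rank s t : adj s t -> branch_rank t = (branch_rank s).+1.
Proof. by case: s t => [[i|i]|i] [[j|j]|j] //=; [lia | move/eqP->;
  lia | lia | lia | lia]. Qed.

Lemma path_rank s p : path adj s p -> branch_rank (last s p) = (branch_rank s + size p)%N.
Proof.
elim: p s => [|t p IH] s /=; first by rewrite addn0.
by case/andP=> /adj_rank e /IH ->; rewrite e addSnnS.
Qed.

Lemma chain_connect (m : nat) (f : 'I_m -> V) :
  (forall i j : 'I_m, j = i.+1 :> nat -> adj (f i) (f j)) ->
  forall i j : 'I_m, (i <= j)%N -> connect adj (f i) (f j).
Proof.
move=> fadj i j le; have [l] := ubnP (j - i); elim: l i le => // l IH i le lt.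
have [e|ne] := eqVneq (i : nat) j; first by rewrite (val_inj e).
have lt' : (i.+1 < m)%N by have := ltn_ord j; lia.
apply: (@connect_trans _ _ (f (Ordinal lt'))); first exact/connect1/fadj.
by apply: IH => /=; lia.
Qed.

Lemma branch_connect s t : connect adj s t = branch_le s t.
Proof.
apply/idP/idP.
  case/connectP=> p; elim: p s => [|x p IH] s /=.
    by move=> _ ->; rewrite /branch_le !leqnn.
  case/andP=> /adj_le + /IH h e => /andP[h1 h2]; have /andP[h3 h4] := h e.
  by rewrite /branch_le (leq_trans h1 h3) (leq_trans h2 h4).
have tt (i j : 'I_u) : (i <= j)%N -> connect adj (vt i) (vt j).
  by apply: chain_connect => a b e; apply/eqP.
have bb (i j : 'I_u) : (i <= j)%N -> connect adj (vb i) (vb j).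
  by apply: chain_connect => a b e; apply/eqP.
have cc (i j : 'I_v) : (i <= j)%N -> connect adj (vc i) (vc j).
  by apply: chain_connect => a b e; apply/eqP.
have tb (i : 'I_u) : connect adj (vt i) (vb i) by apply: connect1 => /=.
have lv : (v.-1 < v)%N by lia.
have cb : connect adj (vc (Ordinal lv)) (vb (Ordinal u0)).
  by apply: connect1; rewrite /= prednK ?eqxx.
case: s t => [[i|i]|i] [[j|j]|j]; rewrite /branch_le /= => h; try by
  have := ltn_ord i; have := ltn_ord j; move: h; lia.
- by apply: tt; lia.
- by apply: (connect_trans (tb i)); apply: bb; lia.
- by apply: bb; lia.
- apply: (connect_trans _ (connect_trans cb _)); [apply: cc | apply: bb] => //=.
  by have := ltn_ord i; lia.
by apply: cc; lia.
Qed.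
End BranchQuiver.

Section BranchAlgebra.
Variables (k : fieldType) (u v : nat).
Hypotheses (u0 : (0 < u)%N) (v0 : (0 < v)%N).
Local Notation V := (branch_vertex v u).
Local Notation adj := (@branch_adj v u).
Local Notation rels := (@branch_rels k v u).
Local Notation bpi := (bqa_pi rels).
Local Notation vt := (@vt v u).
Local Notation vb := (@vb v u).
Local Notation branch_le := (@branch_le u v).

Definition any_entry : rel V := fun _ _ => true.

Lemma any_entryP z y w : connect adj w y -> connect adj y z ->
  any_entry z w -> any_entry z y && any_entry y w.
Proof. by []. Qed.

Lemma branch_rels0 g z w : rels g -> any_entry z w -> path_coef g z w = 0.
Proof.
case=> i [j [p [q [_ ep eq ->]]]] _; rewrite path_coefB.
apply/eqP; rewrite subr_eq0; apply/eqP; etransitivity; first exact: path_coefU.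
apply: esym; etransitivity; first exact: path_coefU.
by rewrite /qend /qstart ep eq.
Qed.

(** Locked, because comparing the classes of two distinct paths would unfold
the quotient algebra. *)
Definition sealed_class : qpath adj -> bqa rels := locked (fun p => bpi << p >>).

Lemma sealed_classE p : sealed_class p = bpi << p >>.
Proof. by rewrite /sealed_class -lock. Qed.

Lemma sealed_class_cons (p p' a : qpath adj) x y s : val p = (x, y :: s) -> val p' = (y,
  s) ->
  val a = (x, [:: y]) -> sealed_class p = sealed_class p' * sealed_class a.
Proof.
move=> ep ep' ea; have e : qend a = qstart p' by rewrite /qend /qstart ep' ea.
have -> : p = qcomp p' a.
  by apply: val_inj; rewrite val_qcomp // ep ep' ea /qstart ea.
rewrite !sealed_classE -[RHS]/(bqa_mul _ _) bqa_piM -[_ * _]/(pa_mul _ _) pa_mulUU.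
by rewrite /path_mul e eqxx.
Qed.

Lemma qpath_ex x s : path adj x s -> exists p : qpath adj, val p = (x, s).
Proof. by move=> h; exists (exist (fun s => path adj s.1 s.2) (x, s) h). Qed.

Definition same_class m := forall (p q : qpath adj), qlength p = m -> qstart p = qstart q ->
  qend p = qend q -> sealed_class p = sealed_class q.

Lemma qlength_rank (p : qpath adj) :
  branch_rank (qend p) = (branch_rank (qstart p) + qlength p)%N.
Proof. exact: path_rank v0 _ _ (valP p). Qed.

(** The case of two paths whose first arrows differ: p starts with t_i -> t_j and q
with t_i -> b_i. Both end at some b_l with j <= l, so p can be moved to a path
through t_j -> b_j and q to a path through b_i -> b_j; these two differ by the
commutative square. *)
Lemma square_class m (i j : 'I_u) s s' (p q : qpath adj) : same_class m ->
  j = i.+1 :> nat -> size s = m ->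
  val p = (vt i, vt j :: s) -> val q = (vt i, vb i :: s') -> qend p = qend q ->
  sealed_class p = sealed_class q.
Proof.
move=> IH ij sm ep eq epq.
have := valP p; have := valP q; rewrite ep eq /= => /andP[_ ps'] /andP[aij ps].
have [p1 ep1] := qpath_ex ps; have [q1 eq1] := qpath_ex ps'.
have tj_le : branch_le (vt j) (qend p).
  by rewrite -branch_connect //; apply/connectP; exists s => //; rewrite /qend ep.
have bi_le : branch_le (vb i) (qend p).
  by rewrite -branch_connect // epq; apply/connectP; exists s' => //; rewrite /qend eq.
have : connect adj (vb j) (qend p).
  rewrite branch_connect //; move: tj_le bi_le; rewrite /branch_le.
  by case: (qend p) => [[l|l]|l] /=; have := ltn_ord l; lia.
case/connectP=> s2 ps2 es2.
have [p2 ep2] := qpath_ex ps2.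
have [tij etij] : exists a : qpath adj, val a = (vt i, [:: vt j]).
  by apply: qpath_ex; rewrite /= aij.
have [tbi etbi] : exists a : qpath adj, val a = (vt i, [:: vb i]).
  by apply: qpath_ex; rewrite /= eqxx.
have [tbj etbj] : exists a : qpath adj, val a = (vt j, [:: vb j]).
  by apply: qpath_ex; rewrite /= eqxx.
have [bij ebij] : exists a : qpath adj, val a = (vb i, [:: vb j]).
  by apply: qpath_ex; rewrite /= ij eqxx.
have [c1 ec1] : exists a : qpath adj, val a = (vt j, vb j :: s2).
  by apply: qpath_ex; rewrite /= eqxx.
have [c2 ec2] : exists a : qpath adj, val a = (vb i, vb j :: s2).
  by apply: qpath_ex; rewrite /= ij eqxx.
have [d1 ed1] : exists a : qpath adj, val a = (vt i, [:: vt j; vb j]).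
  by apply: qpath_ex; rewrite /= eqxx aij.
have [d2 ed2] : exists a : qpath adj, val a = (vt i, [:: vb i; vb j]).
  by apply: qpath_ex; rewrite /= eqxx ij eqxx.
have rel : sealed_class d1 = sealed_class d2.
  rewrite !sealed_classE; apply/bqa_piP/ideal_genP => J _; apply.
  by exists i, j, d1, d2.
have p1c : sealed_class p1 = sealed_class c1.
  apply: IH; first by rewrite /qlength ep1.
    by rewrite /qstart ep1 ec1.
  by rewrite /qend ep1 ec1 /= -es2 /qend ep.
have q1c : sealed_class c2 = sealed_class q1.
  have e : qend c2 = qend q1.
    by rewrite {1}/qend ec2 /= -es2 epq /qend eq eq1.
  apply: IH => //; last by rewrite /qstart ec2 eq1.
  have := qlength_rank c2; have := qlength_rank p; rewrite e.
  have -> : qend p = qend q1 by rewrite epq /qend eq eq1.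
  have -> : qlength p = m.+1 by rewrite /qlength ep /= sm.
  by rewrite /qstart ep ec2 /=; lia.
apply: (etrans (sealed_class_cons ep ep1 etij)).
apply: (etrans _ (esym (sealed_class_cons eq eq1 etbi))); rewrite p1c -q1c.
rewrite (sealed_class_cons ec1 ep2 etbj) (sealed_class_cons ec2 ep2 ebij).
apply: (etrans (esym (mulrA _ _ _))); apply: (etrans _ (mulrA _ _ _)).
apply: (congr1 (fun z => sealed_class p2 * z)).
apply: (etrans (esym (sealed_class_cons ed1 etbj etij))).
by apply: (etrans rel); apply: sealed_class_cons ed2 ebij etbi.
Qed.

(** Induction on the common length. If the first arrows differ, the paths start
at some t_i and leave the row of the t_i at different places. *)
Lemma branch_uniq (p q : qpath adj) : qstart p = qstart q ->
  qend p = qend q -> sealed_class p = sealed_class q.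
Proof.
move: {1}(qlength p) (erefl (qlength p)) => m; elim: m p q => [|m IH] p q ep es ee.
  have eq : qlength q = 0%N.
    by have := qlength_rank q; have := qlength_rank p; rewrite ep es ee; lia.
  congr (sealed_class _); apply: val_inj; move: ep eq es; rewrite /qlength /qstart.
  by case: (val p) (val q) => [x [|? ?]] [y [|? ?]] //= _ _ ->.
have eq : qlength q = m.+1.
  by have := qlength_rank q; have := qlength_rank p; rewrite ep es ee; lia.
have IH' : same_class m by move=> p' q' e; apply: IH.
case Ep : (val p) => [x [|y s]]; first by move: ep; rewrite /qlength Ep.
case Eq : (val q) => [x' [|y' s']]; first by move: eq; rewrite /qlength Eq.
have ex : x' = x by move: es; rewrite /qstart Ep Eq.
subst x'; have sz : size s = m by move: ep; rewrite /qlength Ep => -[].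
have sz' : size s' = m by move: eq; rewrite /qlength Eq => -[].
have := valP p; have := valP q; rewrite Ep Eq /= => /andP[a' ps'] /andP[a ps].
have [eyy|neyy] := eqVneq y y'.
  subst y'; have [p1 ep1] := qpath_ex ps; have [q1 eq1] := qpath_ex ps'.
  have [al eal] : exists a : qpath adj, val a = (x, [:: y]).
    by apply: qpath_ex; rewrite /= a.
  apply: (etrans (sealed_class_cons Ep ep1 eal)).
  apply: (etrans _ (esym (sealed_class_cons Eq eq1 eal))).
  apply: (congr1 (fun z => z * sealed_class al)); apply: IH'.
  - by rewrite /qlength ep1.
  - by rewrite /qstart ep1 eq1.
  by move: ee; rewrite /qend Ep Eq ep1 eq1.
case: x y y' => [[i|i]|i] [[j|j]|j] [[j'|j']|j'] //= in Ep Eq a a' ps ps' neyy *.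
- by case/eqP: neyy; congr (inl (inl _)); apply: val_inj => /=; lia.
- move/eqP: a => a; move/eqP: a' => a'; subst j'.
  exact: (square_class IH' a sz Ep Eq ee).
- move/eqP: a' => a'; move/eqP: a => a; subst j.
  by apply/esym/(square_class IH' a' sz' Eq Ep).
- by case/eqP: neyy; rewrite (eqP a) (eqP a').
- by case/eqP: neyy; congr (inl (inr _)); apply: val_inj => /=; lia.
- by case/eqP: neyy; congr (inl (inr _)); apply: val_inj => /=; lia.
- by have := ltn_ord j'; lia.
- by have := ltn_ord j; lia.
by case/eqP: neyy; congr inr; apply: val_inj => /=; lia.
Qed.

Lemma branch_class_uniq (p q : qpath adj) : qstart p = qstart q ->
  qend p = qend q -> bpi << p >> = bpi << q >>.
Proof.
move=> e1 e2; apply: (etrans (esym (sealed_classE p))); apply: (etrans _ (sealed_classE q)).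
exact: branch_uniq.
Qed.

Definition branch_coef (b : bqa rels) : V -> V -> k := bqa_coef any_entry b.

Lemma branch_coef_nle b t s : ~~ branch_le s t -> branch_coef b t s = 0.
Proof. by move=> nle; apply: bqa_coef_connect; rewrite branch_connect. Qed.

Lemma branch_coefM b c t s :
  branch_coef (b * c) t s = \sum_y branch_coef b t y * branch_coef c y s.
Proof. exact: (bqa_coefM any_entryP branch_rels0 b c (z := t) (w := s)). Qed.

Lemma branch_coefD b c t s :
  branch_coef (b + c) t s = branch_coef b t s + branch_coef c t s.
Proof. exact: (bqa_coefD any_entryP branch_rels0 b c t s). Qed.

Lemma branch_coefZ l b t s : branch_coef (l *: b) t s = l * branch_coef b t s.
Proof. exact: (bqa_coefZ any_entryP branch_rels0 l b t s). Qed.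

Lemma branch_coef1 t s : branch_coef 1 t s = (t == s)%:R.
Proof. exact: (bqa_coef1 any_entryP branch_rels0 (z := t) (w := s)). Qed.

Lemma branch_coef_inj b c : (forall t s, branch_coef b t s = branch_coef c t s) -> b = c.
Proof.
have E a : a = \sum_t \sum_s branch_coef a t s *: path_class rels t s.
  exact: (bqaE branch_class_uniq).
move=> e; apply: (etrans (E b)); apply: (etrans _ (esym (E c))).
apply: eq_bigr => t _; apply: eq_bigr => s _.
exact: (congr1 (fun x => x *: path_class rels t s) (e t s)).
Qed.

(** With [branch_coef_inj], the algebra is the incidence algebra of the order
on its vertices. *)
Lemma branch_coef_surj (l : V -> V -> k) : (forall t s, ~~ branch_le s t -> l t s = 0) ->
  exists b, forall t s, branch_coef b t s = l t s.
Proof.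
move=> l0; exists (\sum_x \sum_y l x y *: path_class rels x y) => t s.
have c0 : branch_coef 0 t s = 0.
  by apply: (@addrI _ (branch_coef 0 t s)); rewrite -branch_coefD !addr0.
have csum (I : finType) (F : I -> bqa rels) :
    branch_coef (\sum_i F i) t s = \sum_i branch_coef (F i) t s.
  exact: (big_morph (fun b => branch_coef b t s) (fun b c => branch_coefD b c t s) c0).
have cu x y : branch_coef (l x y *:
  path_class rels x y) t s = l x y * ((x == t) && (y == s))%:R.
  apply: (etrans (branch_coefZ _ _ _ _)).
  have [le|nle] := boolP (branch_le y x); last by rewrite l0 // !mul0r.
  apply: (congr1 (fun c => l x y * c)).
  apply: (bqa_coef_class any_entryP branch_rels0 branch_class_uniq) => //.
  by rewrite branch_connect.
transitivity (\sum_x \sum_y l x y * ((x == t) && (y == s))%:R).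
  apply: (etrans (csum _ _)); apply: eq_bigr => x _.
  apply: (etrans (csum _ _)); apply: eq_bigr => y _; exact: cu.
rewrite (bigD1 t) //= [X in _ + X]big1 => [|x ne]; last first.
  by rewrite big1 // => y _; rewrite (negPf ne) mulr0.
rewrite addr0 (bigD1 s) //= big1 => [|y ne]; last by rewrite (negPf ne) andbF mulr0.
by rewrite addr0 !eqxx mulr1.
Qed.

End BranchAlgebra.

(** * Endomorphisms of a sum of interval modules *)

Section Endomorphisms.
Variables (k : fieldType) (n r : nat) (N : band_algebra k n r).
Local Notation sc := (@band_scal k n r N).
Local Notation K := (interval_module N).
Variables (V : finType) (cs ds : V -> nat) (u : nat).
Hypotheses (csu : forall s, (cs s <= u)%N) (uds : forall s, (u < ds s)%N)
  (dsn : forall s, (ds s <= n)%N) (dsr : forall s, (ds s <= cs s + r)%N).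
Local Notation D := (fg_dsum (fun s => K (cs s) (ds s))).
Local Notation le s t := (sub_interval (cs s) (ds s) (cs t) (ds t)).
Local Notation km s t := (interval_map N (cs s) (ds s) (cs t) (ds t)).

Lemma matrix_act_linear (l : V -> V -> k) : linear (fun x : D =>
  finfun (fun t => \sum_s sc (l t s) *: km s t (dproj _ s x)) : D).
Proof.
move=> a x y; apply/ffunP => t; rewrite !ffunE scaler_sumr -big_split.
apply: eq_bigr => s _; rewrite !linearP scalerDr scalerA.
by rewrite -band_scal_comm scalerA.
Qed.
(** The matrices that vanish outside the order of the intervals correspond to
the endomorphisms, by [matrix_act_inj] and [matrix_act_surj]. *)
Definition matrix_act (l : V -> V -> k) : {linear D -> D} :=
  mk_linear (matrix_act_linear l).

Lemma dproj_matrix_act l x t : dproj _ t (matrix_act l x) = \sum_s sc (l t s) *: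
  km s t (dproj _ s x).
Proof. by rewrite /= ffunE. Qed.

Lemma matrix_act_ext l1 l2 : (forall t s, l1 t s = l2 t s) -> forall x,
  matrix_act l1 x = matrix_act l2 x.
Proof.
move=> e x; apply: dprojP => t; rewrite !dproj_matrix_act.
by apply: eq_bigr => s _; rewrite e.
Qed.

Lemma interval_map_nle s t x : ~~ le s t -> km s t x = 0.
Proof. by move=> nle; apply: icoordP => z; rewrite icoord_map (negPf nle) icoord0. Qed.

Lemma interval_map_id s x : km s s x = x.
Proof.
apply: icoordP => z; rewrite icoord_map /sub_interval !leqnn /=.
by case: ifP => // /negbT nz; rewrite icoord_out.
Qed.

(** Restricting through an intermediate interval loses nothing: a vertex in the
first and in the last interval lies in the middle one. *)
Lemma interval_map_comp s y t x : le s y -> le y t -> km y t (km s y x) = km s t x.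
Proof.
move=> h1 h2; apply: icoordP => z; rewrite !icoord_map h1 h2 /=.
have -> : le s t by move: h1 h2; rewrite /sub_interval; lia.
case: ifP => //= Cz; case: ifP => // /negbT ny; rewrite icoord_out //.
apply: contra ny; move: Cz h1 h2; rewrite /sub_interval /in_interval.
move=> /and3P[? ? ?] /andP[? ?] /andP[? ?] /and3P[? ? ?].
by apply/and3P; split; lia.
Qed.

Definition supported (l : V -> V -> k) : Prop := forall t s, ~~ le s t -> l t s = 0.

Lemma matrix_act_one x : matrix_act (fun t s => (t == s)%:R) x = x.
Proof.
apply: dprojP => t; rewrite dproj_matrix_act (bigD1 t) // big1 => [|s ne].
  by rewrite eqxx band_scal1 scale1r interval_map_id; exact: addr0.
by rewrite eq_sym (negPf ne) band_scal0 scale0r.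
Qed.

Lemma matrix_act_mul l1 l2 l x : supported l1 -> supported l2 ->
  (forall t s, l t s = \sum_y l1 t y * l2 y s) ->
    matrix_act l x = matrix_act l1 (matrix_act l2 x).
Proof.
move=> S1 S2 lE; apply: dprojP => t; rewrite !dproj_matrix_act.
transitivity (\sum_s \sum_y sc (l1 t y * l2 y s) *: km s t (dproj _ s x)).
  by apply: eq_bigr => s _; rewrite lE band_scal_sum scaler_suml.
rewrite exchange_big; apply: eq_bigr => y _;
  rewrite dproj_matrix_act linear_sum scaler_sumr.
apply: eq_bigr => s _; rewrite linearZ_LR scalerA band_scalM.
have [h1|/S2->] := boolP (le s y); last by rewrite mulr0 band_scal0 !scale0r.
have [h2|/S1->] := boolP (le y t); last by rewrite mul0r band_scal0 !scale0r.
by rewrite interval_map_comp.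
Qed.

Lemma matrix_act_add l1 l2 l x : (forall t s, l t s = l1 t s + l2 t s) ->
  matrix_act l x = matrix_act l1 x + matrix_act l2 x.
Proof.
move=> lE; apply: dprojP => t; rewrite linearD !dproj_matrix_act -big_split.
by apply: eq_bigr => s _; rewrite lE band_scalD scalerDl.
Qed.

Lemma matrix_act_scale c l1 l x : (forall t s, l t s = c * l1 t s) ->
  matrix_act l x = sc c *: matrix_act l1 x.
Proof.
move=> lE; apply: dprojP => t; rewrite linearZ /= !ffunE scaler_sumr.
by apply: eq_bigr => s _; rewrite lE -band_scalM scalerA.
Qed.

(** The entry l t s is recovered from the value at the top vertex of the image
of the generator of the summand s. *)
Lemma matrix_act_inj l1 l2 : supported l1 -> supported l2 ->
  (forall x, matrix_act l1 x = matrix_act l2 x) -> forall t s, l1 t s = l2 t s.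
Proof.
move=> S1 S2 e t s; have [h|nh] := boolP (le s t); last by rewrite S1 ?S2.
have lt : ((ds s).-1 < n)%N by have := dsn s; have := uds s; lia.
pose z := Ordinal lt; pose x : D := dinj (fun s =>
  K (cs s) (ds s)) s (idelta k r (cs s) (ds s) z).
have Cs : in_interval r (cs s) (ds s) z.
  by rewrite /in_interval /=; have := csu s; have := uds s; have := dsr s; lia.
have Ct : in_interval r (cs t) (ds t) z.
  move: h => /andP[h1 h2]; rewrite /in_interval /=.
  by have := csu t; have := uds s; have := dsr s; lia.
have H l : icoord (dproj _ t (matrix_act l x)) z = l t s.
  rewrite dproj_matrix_act (bigD1 s) // big1 => [|s' ne].
    rewrite /x dprojK icoordD icoord0 icoord_scal icoord_map h Ct icoord_delta Cs eqxx
      mulr1.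
    exact: addr0.
  by rewrite /x dproj_neq 1?eq_sym // linear0 scaler0.
by rewrite -(H l1) -(H l2) e.
Qed.

Lemma matrix_act_surj (f : {linear D -> D}) : exists2 l, supported l & forall x,
  matrix_act l x = f x.
Proof.
have lP t s : exists c : k, forall h, dproj _ t (f (dinj (fun s =>
  K (cs s) (ds s)) s h)) = sc c *: km s t h.
  pose g : {linear K (cs s) (ds s) -> K (cs t) (ds t)} := dproj (fun s =>
    K (cs s) (ds s)) t \o f \o dinj (fun s => K (cs s) (ds s)) s.
  have [||c cE] := hom_scalar g; last by exists c => h; rewrite -cE.
    by have := csu s; have := uds s; have := dsn s; lia.
  exact: dsr.
pose l0 t s := sval (cid (lP t s)).
exists (fun t s => if le s t then l0 t s else 0) => [t s /negPf-> //|x].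
apply: dprojP => t; rewrite dproj_matrix_act [x in RHS]dsumE !linear_sum.
apply: eq_bigr => s _; rewrite (svalP (cid (lP t s))) -/(l0 t s).
by case: ifP => // /negbT nle; rewrite interval_map_nle // !scaler0.
Qed.
End Endomorphisms.

Section LinearIso.
Variable A : pzRingType.

Lemma linear_bijective (M L : lmodType A) (f : {linear M -> L}) : bijective f ->
  exists g : {linear L -> M}, cancel f g /\ cancel g f.
Proof.
case=> g fK gK; have lin : linear g by move=> a x y; apply: (can_inj fK);
  rewrite linearP !gK.
by exists (mk_linear lin).
Qed.

(** The data pr and inj say that T is the direct sum of the M j; sigma matches
the two index sets. *)
Lemma biproduct_iso (J V : finType) (M : J -> fgModule A) (L : V -> fgModule A)
    (T : fgModule A) (pr : forall j, {linear T -> M j}) (inj : forall j, {linear M j -> T})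
    (sigma : V -> J) :
  (forall j x, pr j (inj j x) = x) -> (forall i j x, i != j -> pr j (inj i x) = 0) ->
  (forall x, (forall j, pr j x = 0) -> x = 0) ->
  injective sigma -> (forall j, exists s, sigma s = j) ->
  (forall s, exists f : {linear M (sigma s) -> L s}, bijective f) ->
  exists tau : {linear T -> fg_dsum L}, bijective tau.
Proof.
move=> prK pr0 prI sinj ssurj fex.
have fP s : {f : {linear M (sigma s) -> L s} & {g : {linear L s -> M (sigma s)} |
    cancel f g /\ cancel g f}}.
  have [f fb] := cid (fex s); exists f; apply: cid; exact: linear_bijective.
pose f s := projT1 (fP s); pose g s := sval (projT2 (fP s)).
have fK s : cancel (f s) (g s) by case: (svalP (projT2 (fP s))).
have gK s : cancel (g s) (f s) by case: (svalP (projT2 (fP s))).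
exists (into_dsum (fun s => f s \o pr (sigma s))).
exists (fun y => \sum_s inj (sigma s) (g s (dproj _ s y))) => [x|y].
  apply/eqP; rewrite -subr_eq0; apply/eqP/prI => j; have [s <-] := ssurj j.
  rewrite linearB linear_sum (bigD1 s) //= big1 => [|s' ne].
    by rewrite ffunE /= prK fK addr0 subrr.
  by rewrite pr0 // (inj_eq sinj).
apply: dprojP => s; rewrite dproj_into /= linear_sum (bigD1 s) //= big1 => [|s' ne].
  by rewrite addr0 prK gK.
by rewrite pr0 // (inj_eq sinj).
Qed.

Section PairOfSums.
Variables (J1 J2 : finType) (M1 : J1 -> fgModule A) (M2 : J2 -> fgModule A).
Local Notation T := (fg_pair (fg_dsum M1) (fg_dsum M2)).

Definition sum_mod (j : J1 + J2) : fgModule A :=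
  match j with inl a => M1 a | inr b => M2 b end.

Definition pair_proj (j : J1 + J2) : {linear T -> sum_mod j} :=
  match j with
  | inl a => dproj M1 a \o fst
  | inr b => dproj M2 b \o snd
  end.

Lemma pair_inj1_linear a : linear (fun x : M1 a => (dinj M1 a x, 0) : T).
Proof.
move=> e x y; apply: injective_projections; first exact: linearP.
by rewrite /= scaler0 addr0.
Qed.

Lemma pair_inj2_linear b : linear (fun x : M2 b => (0, dinj M2 b x) : T).
Proof.
move=> e x y; apply: injective_projections; last exact: linearP.
by rewrite /= scaler0 addr0.
Qed.

Definition pair_inj (j : J1 + J2) : {linear sum_mod j -> T} :=
  match j with
  | inl a => mk_linear (@pair_inj1_linear a)
  | inr b => mk_linear (@pair_inj2_linear b)
  end.

Lemma pair_projK j x : pair_proj j (pair_inj j x) = x.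
Proof. by case: j x => [a|b] x; [exact: (@dprojK A J1 M1 a x) | exact:
  (@dprojK A J2 M2 b x)]. Qed.

Lemma pair_proj_neq i j x : i != j -> pair_proj j (pair_inj i x) = 0.
Proof.
case: i x => [a|a] x; case: j => [b|b] ne.
- by apply: (@dproj_neq A J1 M1); apply: contraNneq ne => ->.
- exact: (linear0 (dproj M2 b)).
- exact: (linear0 (dproj M1 b)).
by apply: (@dproj_neq A J2 M2); apply: contraNneq ne => ->.
Qed.

Lemma pair_projI x : (forall j, pair_proj j x = 0) -> x = 0.
Proof.
move=> h; apply: injective_projections; apply: dprojP => a; rewrite linear0.
  exact: (h (inl a)).
exact: (h (inr a)).
Qed.
End PairOfSums.
End LinearIso.

(** * The tilting module *)

Section Summands.
Variables (k : fieldType) (u v : nat).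
Hypotheses (u0 : (0 < u)%N) (v0 : (0 < v)%N).
Local Notation n := (2 * u + v)%N.
Local Notation r := (u + v + 1)%N.
Local Notation N := (nakayama_band k n r).
Local Notation V := (branch_vertex v u).
Local Notation L := (fun s : V => interval_module N (branch_lo s) (branch_hi s)).
Variables (I : nat -> fgModule (nakayama k n r)) (S : nat -> nat ->
  fgModule (nakayama k n r)).
Hypothesis HI : forall x : 'I_n, indec_injective_at x (I x.+1).
Hypothesis HS : forall (x : 'I_n) (j : nat), (1 <= j <= u + v - 1)%N -> x.+1 = (u + j)%N ->
  indec_of_length_at x j (S x.+1 j).
Local Notation T := (branch_tilting_module I S).

Lemma branch_lo_u (s : V) : (branch_lo s <= u)%N.
Proof. by case: s => [[i|i]|i] //=; apply: ltnW. Qed.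

Lemma branch_hi_bounds (s : V) : [/\ (u < branch_hi s)%N,
  (branch_hi s <= n)%N & (branch_hi s <= branch_lo s + r)%N].
Proof. by case: s => [[i|i]|i] /=; have := ltn_ord i; split; lia. Qed.

Lemma branch_lo_injective (s : V) :
  (minn n (branch_lo s + r) <= branch_hi s)%N \/ branch_lo s = u.
Proof. by case: s => [[i|i]|i] /=; [left; lia | right | right]. Qed.

Lemma I_interval (x : 'I_n) : exists phi : {linear (I x.+1 : fgModule N) ->
  interval_module N x n}, bijective phi.
Proof.
have [Mind Minj [M0 [f [[Ss [s hs]] finj]]]] := HI x.
have Ex : @band_unit k n r N x x = vertex_idem (@nakayama_rels k n r) x by apply:
  nak_unit_idem.
have [//||phi [g gK Kg]] :=
  @injective_hull_interval k n r N (I x.+1) x _ Mind Minj M0 f Ss _ finj.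
  by rewrite addn1.
  by exists s; rewrite Ex.
have [g' [h1 h2]] := linear_bijective (Bijective gK Kg).
by exists g'; exists phi.
Qed.

Lemma S_interval j : (0 < j <= u + v - 1)%N ->
  exists phi : {linear (S (u + j) j : fgModule N) -> interval_module N u (u + j)},
    bijective phi.
Proof.
move=> jb; have lt : ((u + j).-1 < n)%N by lia.
pose x : 'I_n := Ordinal lt; have ex : x.+1 = (u + j)%N by rewrite /=; lia.
have := HS jb ex; rewrite ex => -[_ hl [M0 [[Ss [s hs]] ht]]].
have Ex : @band_unit k n r N x x = vertex_idem (@nakayama_rels k n r) x by apply:
  nak_unit_idem.
have [|_ [phi phib]] := @length_top_interval k n r N (S (u + j)%N j) M0 x j hl Ss _ ht.
  by exists s; rewrite Ex.
move: phi phib; rewrite ex addnK => phi phib.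
have [g' [h1 h2]] := linear_bijective phib.
by exists g'; exists phi.
Qed.

(** The cut to length r makes the two modules have the same support. *)
Lemma widen_interval c d : (d <= n)%N -> (minn n (c + r) <= d)%N ->
  exists phi : {linear interval_module N c n -> interval_module N c d}, bijective phi.
Proof.
move=> dn le; have s1 : sub_interval c d c n by rewrite /sub_interval leqnn.
have inKE (z : 'I_n) : in_interval r c d z = in_interval r c n z.
  by have lz := ltn_ord z; rewrite /in_interval; apply/idP/idP; lia.
have b : bijective (interval_map N c d c n).
  exists (fun f => ibuild r c d (icoord f)) => f; apply: icoordP => z.
    rewrite icoord_build icoord_map s1 /= -inKE.
    by have [//|nz] := boolP (in_interval r c d z); rewrite icoord_out.
  rewrite icoord_map s1 /= icoord_build inKE.
  by have [//|nz] := boolP (in_interval r c n z); rewrite icoord_out.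
have [g [h1 h2]] := linear_bijective b.
by exists g; exists (interval_map N c d c n).
Qed.

Local Notation J := ('I_(u + 1) + 'I_(u + v - 1))%type.

(** The summand of T with index j is the interval module of the vertex s. The last
b_i is the injective module at u, which is listed among the I_i; the other b_i
follow the c_i among the S_i. *)
Definition same_summand (s : V) (j : J) : Prop :=
  match s, j with
  | inl (inl i), inl a => a = i :> nat
  | inl (inr i), inl a => i.+1 = u /\ a = u :> nat
  | inl (inr i), inr b => (i.+1 < u)%N /\ b = (v + i)%N :> nat
  | inr i, inr b => b = i :> nat
  | _, _ => False
  end.

Lemma same_summandV (s : V) : exists j, same_summand s j.
Proof.
case: s => [[i|i]|i]; have li := ltn_ord i.
- have lt : (i < u + 1)%N by lia.
  by exists (inl (Ordinal lt)).
- have [e|ne] := eqVneq i.+1 u.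
    have lt : (u < u + 1)%N by lia.
    by exists (inl (Ordinal lt)).
  have lt : (v + i < u + v - 1)%N by lia.
  by exists (inr (Ordinal lt)); split=> //; lia.
have lt : (i < u + v - 1)%N by lia.
by exists (inr (Ordinal lt)).
Qed.

Lemma same_summandJ (j : J) : exists s, same_summand s j.
Proof.
case: j => a; have la := ltn_ord a.
  have [lt|ge] := ltnP a u; first by exists (inl (inl (Ordinal lt))).
  have lt : (u.-1 < u)%N by lia.
  by exists (inl (inr (Ordinal lt))); split=> /=; lia.
have [lt|ge] := ltnP a v; first by exists (inr (Ordinal lt)).
have lt : (a - v < u)%N by lia.
by exists (inl (inr (Ordinal lt))); split=> /=; lia.
Qed.

Lemma same_summand_inj s s' j : same_summand s j -> same_summand s' j -> s = s'.
Proof.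
case: s s' j => [[i|i]|i] [[i'|i']|i'] [a|a] //=;
  try (by move=> e e'; congr (inl (inl _)); apply: val_inj; rewrite /= -e -e');
  try (by move=> e e'; congr inr; apply: val_inj; rewrite /= -e -e');
  try (by move=> [e1 e2] [e1' e2']; congr (inl (inr _)); apply: val_inj => /=; lia);
  by have := ltn_ord i; have := ltn_ord i'; lia.
Qed.

Lemma same_summand_fun s j j' : same_summand s j -> same_summand s j' -> j = j'.
Proof.
case: s j j' => [[i|i]|i] [a|a] [a'|a'] //=;
  try (by move=> e e'; congr inl; apply: val_inj => /=; lia);
  try (by move=> e e'; congr inr; apply: val_inj => /=; lia);
  lia.
Qed.

Local Notation M := (sum_mod (fun i : 'I_(u + 1) => I i.+1)
  (fun j : 'I_(u + v - 1) => S (u + j.+1)%N j.+1)).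

Lemma summand_iso s j : same_summand s j ->
  exists f : {linear (M j : fgModule N) -> L s}, bijective f.
Proof.
have SI (b : 'I_(u + v - 1)) d : d = (u + b.+1)%N ->
    exists f : {linear (S (u + b.+1)%N b.+1 : fgModule N) -> interval_module N u d},
      bijective f.
  by move=> ->; apply: S_interval; have := ltn_ord b; lia.
have II (a : 'I_(u + 1)) c : c = a :> nat ->
    exists f : {linear (I a.+1 : fgModule N) -> interval_module N c n}, bijective f.
  move=> ->; have lt : (a < n)%N by have := ltn_ord a; lia.
  exact: (I_interval (Ordinal lt)).
case: s j => [[i|i]|i] [a|a] //=.
- move=> e; have [f fb] := II a i (esym e); have li := ltn_ord i.
  have [||g gb] := @widen_interval i (i + r); [lia | lia |].
  by exists (g \o f); apply: bij_comp.
- case=> e1 e2; have [f fb] := II a u (esym e2).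
  by have -> : (u + v + i + 1 = n)%N; [lia | exists f].
- by case=> e1 e2; apply: SI; lia.
by move=> e; apply: SI; lia.
Qed.

Lemma tilting_module_iso : exists tau : {linear (T : fgModule N) -> fg_dsum L},
  bijective tau.
Proof.
have [sigma sigmaP] := choice same_summandV.
apply: (@biproduct_iso N J V M L T (@pair_proj N _ _ _ _) (@pair_inj N _ _ _ _) sigma).
- exact: pair_projK.
- exact: pair_proj_neq.
- exact: pair_projI.
- by move=> s s' e; apply: (@same_summand_inj s s' (sigma s)); rewrite // e.
- move=> j; have [s sj] := same_summandJ j; exists s.
  exact: same_summand_fun (sigmaP s) sj.
by move=> s; apply: summand_iso.
Qed.

Section Conclusion.
Variables (tau : {linear (T : fgModule N) -> fg_dsum L})
  (tau' : {linear fg_dsum L -> (T : fgModule N)}).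
Hypotheses (tauK : cancel tau tau') (tau'K : cancel tau' tau).

Let ur : (u <= r)%N. Proof. lia. Qed.
Let branch_lo_hi (s : V) : (branch_lo s <= branch_hi s)%N.
Proof. by have := branch_lo_u s; have [] := branch_hi_bounds s; lia. Qed.
Let u_hi (s : V) : (u < branch_hi s)%N. Proof. by case: (branch_hi_bounds s). Qed.
Let hi_n (s : V) : (branch_hi s <= n)%N. Proof. by case: (branch_hi_bounds s). Qed.
Let hi_r (s : V) : (branch_hi s <= branch_lo s + r)%N. Proof. by case:
  (branch_hi_bounds s). Qed.

Let Q := interval_res N branch_lo_u ur branch_lo_hi hi_r.
Let q : cmap Q (stalk (T : fgModule N)) :=
  interval_aug branch_lo_u ur branch_lo_hi hi_r tau'.

Let Q_proj i : rel_projective (Q i).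
Proof. exact: (@interval_res_projective _ _ _ N _ _ _ _ branch_lo_u ur branch_lo_hi hi_n
  hi_r i). Qed.

Let q_qis : quasi_iso q.
Proof. exact: (interval_aug_qis branch_lo_u ur branch_lo_hi hi_r tauK tau'K). Qed.

Lemma branch_module_tilting : tilting (stalk (T : fgModule N)).
Proof.
split.
  apply: (stalk_ext_vanish Q_proj q_qis).
  by move=> m m0 c; apply: (interval_ext branch_lo_injective tauK tau'K m0).
move=> P thP PT.
have PD : P (stalk (fg_dsum L)).
  by apply/(thick_iso thP (f := tau)) => //; exists tau'.
have PK s : P (stalk (L s)) by apply: thick_stalk_summand PD.
apply: (@thick_from_intervals k n r N _ P u thP); try lia.
  move=> j jb; have [le|gt] := leqP j v.
    have lt : (j.-1 < v)%N by lia.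
    have := PK (inr (Ordinal lt)); rewrite /=.
    by have -> : (u + j.-1 + 1 = u + j)%N by lia.
  have lt : ((j - v).-1 < u)%N by lia.
  have := PK (inl (inr (Ordinal lt))); rewrite /=.
  by have -> : (u + v + (j - v).-1 + 1 = u + j)%N by lia.
by move=> i lt; exact: (PK (inl (inl (Ordinal lt)))).
Qed.

Lemma branch_module_endomorphisms : endomorphism_algebra_iso (stalk (T :
  fgModule N)) (@branch_rels k v u).
Proof.
pose F (b : bqa (@branch_rels k v u)) : {linear (T : fgModule N) -> (T : fgModule N)} :=
  tau' \o matrix_act N (@branch_lo u v) (@branch_hi u v) (branch_coef b) \o tau.
have bsupp b : @supported k _ (@branch_lo u v) (@branch_hi u v) (branch_coef b).
  by move=> t s; apply: (branch_coef_nle u0 v0).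
apply: (@endomorphism_algebra_isoI _ _ _ _ _ _ _ _ F Q q Q_proj q_qis).
- by move=> x; rewrite [x]thinmx0 [RHS]thinmx0.
- move=> x; rewrite /F /= -[RHS]tauK; apply: (congr1 tau').
  apply: etrans (matrix_act_one _); apply: matrix_act_ext => t s; exact: branch_coef1.
- move=> b c x; rewrite /F /= tau'K; apply: (congr1 tau').
  by apply: matrix_act_mul; [exact: bsupp | exact: bsupp | exact: branch_coefM].
- move=> b c x; rewrite /F /= -linearD; apply: (congr1 tau').
  by apply: matrix_act_add; exact: branch_coefD.
- move=> l b x; rewrite /F /= -linearZ; apply: (congr1 tau').
  by apply: matrix_act_scale; exact: branch_coefZ.
- move=> b c e; apply: branch_coef_inj => //.
  apply: (matrix_act_inj (N := N) branch_lo_u u_hi hi_n hi_r (bsupp b) (bsupp c)) => x.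
  apply: (can_inj tau'K); have h := tau'K x.
  pose A c y := tau' (matrix_act N (@branch_lo u v) (@branch_hi u v) (branch_coef c) y).
  exact: (etrans (congr1 (A b) (esym h)) (etrans (e (tau' x)) (congr1 (A c) h))).
move=> f; pose f' : {linear fg_dsum L -> fg_dsum L} := tau \o f \o tau'.
have [l Sl lE] := matrix_act_surj branch_lo_u u_hi hi_n hi_r f'.
have [b bE] := branch_coef_surj (k := k) u0 v0 Sl.
exists b => x; rewrite /F /=; apply: (can_inj tauK); rewrite tau'K.
apply: (etrans (matrix_act_ext bE _)); apply: (etrans (lE _)).
by rewrite /f' /= tauK.
Qed.
End Conclusion.
End Summands.

Theorem proposition5p5 (k : closedFieldType) (u v : nat)
    (I : nat -> fgModule (nakayama k (2 * u + v) (u + v + 1)))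
    (S : nat -> nat -> fgModule (nakayama k (2 * u + v) (u + v + 1))) :
  (1 <= u)%N -> (1 <= v)%N ->
  (forall x : 'I_(2 * u + v), indec_injective_at x (I x.+1)) ->
  (forall (x : 'I_(2 * u + v)) (j : nat),
     (1 <= j <= u + v - 1)%N -> x.+1 = (u + j)%N ->
     indec_of_length_at x j (S x.+1 j)) ->
  let T := stalk (branch_tilting_module I S) in
  tilting T /\ endomorphism_algebra_iso T (@branch_rels k v u).
Proof.
move=> u0 v0 HI HS T.
have [tau /linear_bijective[tau' [tauK tau'K]]] := tilting_module_iso u0 v0 HI HS.
split; first exact: (branch_module_tilting u0 v0 tauK tau'K).
exact: (branch_module_endomorphisms u0 v0 tauK tau'K).
Qed.
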